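(* Suppose $\Phi^*$ holds and $\mathsf{Cov}(\mathcal{K}) \geq \aleph_2$. Suppose $T$ is a complete theory in a language of size $\aleph_1$ with atomic models, and the class $\mathbf{K}_T$ of atomic models of $T$ is not club totally transcendental. Then $T$ has $2^{\aleph_1}$ pairwise nonisomorphic atomic models of size $\aleph_1$.
   Context: For stationary $S \subseteq \omega_1$, $\Phi(S)$ (weak diamond on $S$) is the statement: for every $F: 2^{<\omega_1} \to 2$ there is $g: S \to 2$ such that for every $f: \omega_1 \to 2$ the set $\{\alpha \in S : F(f\restriction_\alpha) = g(\alpha)\}$ is stationary. $\Phi^*$ is the statement: for all stationary $S \subseteq \omega_1$, $\Phi(S)$ holds. $\mathsf{Cov}(\mathcal{K})$ is the covering number of the meager ideal: the least $\kappa$ such that $2^\omega$ is the union of $\kappa$-many closed nowhere dense sets. A model is atomic if every finite tuple from it has its type over $\emptyset$ isolated by a single formula. Let $T$ be a complete theory in a language $\mathcal{L}$ of size $\aleph_1$ with atomic models. Fix a continuous increasing chain of countable languages $(\mathcal{L}_\alpha : \alpha<\omega_1)$ with union $\mathcal{L}$. An $\mathcal{L}$-formula $\phi(\overline{x})$ is $T$-complete if it is consistent with $T$ and for every $\mathcal{L}$-formula $\psi(\overline{x})$, $T + \phi(\overline{x})$ decides $\psi(\overline{x})$. Fix a club $\mathbf{C}_0 \subseteq \omega_1$ such that for every $\alpha \in \mathbf{C}_0$, every $\mathcal{L}_\alpha$-formula $\phi(\overline{x})$ consistent with $T$ is implied (modulo $T$) by some $T$-complete formula $\psi(\overline{x})$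 which is itself an $\mathcal{L}_\alpha$-formula (such a club exists). Let $\mathfrak{C}$ be a monster model of $T$. An atomic set is a countable set $A \subset \mathfrak{C}$ such that every finite tuple from $A$ has its type over $\emptyset$ isolated by a single $\mathcal{L}$-formula; $A$ is $\alpha$-atomic if moreover these formulas can be chosen in $\mathcal{L}_\alpha$. For $\alpha \in \mathbf{C}_0$, an $\alpha$-base is an $\alpha$-atomic set $A$ with $A\restriction_{\mathcal{L}_\alpha} \preceq \mathfrak{C}\restriction_{\mathcal{L}_\alpha}$; $\alpha$-bases exist and are unique up to isomorphism. For an atomic set $A$, $S^n_{at}(A)$ is the set of $p(\overline{x}) \in S^n(A)$ (complete $n$-types over $A$) such that $A\overline{a}$ is atomic whenever $\overline{a}$ realizes $p$, with the subspace topology from the Stone space $S^n(A)$; $S_{at}(A) = \bigcup_n S^n_{at}(A)$ with the disjoint union topology. For $\alpha \in \mathbf{C}_0$, $\mathbf{K}_T$ is totally transcendental at $\alpha$ if, for $A$ any $\alpha$-base, $S_{at}(A)$ is scattered, i.e. has no perfect subset. $\mbox{Spec}_{\mathbf{K}_T}(t.t.)$ is the set of all $\alpha \in \mathbf{C}_0$ at which $\mathbf{K}_T$ is totally transcendental. $\mathbf{K}_T$ is club totally transcendental if $\mbox{Spec}_{\mathbf{K}_T}(t.t.)$ contains a club. *)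

(* Defs.v *)
From HB Require Import structures.
From mathcomp Require Import all_boot all_order.
From mathcomp Require Import boolp classical_sets functions cardinality.
From mathcomp Require Import topology cantor.

Set Implicit Arguments.
Unset Strict Implicit.
Unset Printing Implicit Defensive.

Local Open Scope classical_set_scope.
Local Open Scope card_scope.
Local Open Scope order_scope.

(* omega_1, given up to isomorphism as an uncountable well-order all of whose
   proper initial segments are countable. *)
Definition is_omega1 d (W : orderType d) : Prop :=
  [/\ forall A : set W, A !=set0 ->
        exists2 a, A a & forall b, A b -> a <= b,
      forall a : W, countable [set b | b < a] &
      ~ countable [set: W]].

Section Omega1.
Context {d : Order.disp_t} {W : orderType d}.

Definition is_limit (a : W) : Prop :=
  (exists b, b < a) /\ forall b, b < a -> exists c, b < c < a.

(* [C] is closed: [a] belongs to [C] whenever [a] is not the least element and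
   [C] is cofinal below [a] (such an [a] is a limit). *)
Definition club (C : set W) : Prop :=
  (forall b, exists2 c, C c & b < c) /\
  (forall a, (exists b, b < a) ->
     (forall b, b < a -> exists2 c, C c & b < c < a) -> C a).

Definition stationary (S : set W) : Prop :=
  forall C, club C -> S `&` C !=set0.

Definition below (a : W) : Type := {b : W | b < a}.

Definition restrict_below (f : W -> bool) (a : W) : below a -> bool :=
  fun b => f (sval b).

(* [forall a : W, (below a -> bool) -> bool] is the type of functions
   F : 2^{<omega_1} -> 2. *)
Definition weak_diamond (S : set W) : Prop :=
  forall F : forall a : W, (below a -> bool) -> bool,
  exists g : S -> bool,
  forall f : W -> bool,
    stationary [set \val s | s in
      [set s : S | F (\val s) (restrict_below f (a := \val s)) = g s]].

End Omega1.

Definition weak_diamond_star d (W : orderType d) : Prop :=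
  forall S : set W, stationary S -> weak_diamond S.

Definition nowhere_dense (X : topologicalType) (A : set X) : Prop :=
  (closure A)° = set0.

(* Cardinals are represented by types, compared through [#<=]. *)
Definition covers_cantor (K : Type) : Prop :=
  exists C : K -> set cantor_space,
    (forall k, closed (C k) /\ nowhere_dense (C k)) /\
    \bigcup_k C k = [set: cantor_space].

Definition is_cov_meager (K : Type) : Prop :=
  covers_cantor K /\
  forall K' : Type, covers_cantor K' -> [set: K] #<= [set: K'].

Definition is_succ_card (K K' : Type) : Prop :=
  ~~ ([set: K'] #<= [set: K]) /\
  forall X : Type, ~~ ([set: X] #<= [set: K]) -> [set: K'] #<= [set: X].

Definition cov_meager_ge_succ (W : Type) : Prop :=
  exists K W' : Type,
    [/\ is_cov_meager K, is_succ_card W W' & [set: W'] #<= [set: K]].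

Record language := Language {
  fsym : Type;
  far : fsym -> nat;
  rsym : Type;
  rar : rsym -> nat }.

Arguments far {l}.
Arguments rar {l}.

Definition symbol (L : language) : Type := (fsym L + rsym L)%type.

#[universes(template=no)]
Inductive term (L : language) (V : Type) : Type :=
| Var of V
| App (f : fsym L) of ('I_(far f) -> term L V).

(* First-order formulas with free variables in [V]; the quantifier binds the
   variable [None].  Formulas phi(x_0, ..., x_{n-1}) are [fml L 'I_n] and
   sentences are [fml L void]. *)
#[universes(template=no)]
Inductive fml (L : language) (V : Type) : Type :=
| FBot
| FEq of term L V & term L V
| FRel (r : rsym L) of ('I_(rar r) -> term L V)
| FImp of fml L V & fml L V
| FAll of fml L (option V).

Arguments Var {L V}.
Arguments App {L V}.
Arguments FBot {L V}.
Arguments FRel {L V}.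

Definition FNeg L V (phi : fml L V) : fml L V := FImp phi FBot.

Record structure (L : language) := Structure {
  carrier :> Type;
  carrier_inhabited : inhabited carrier;
  fint : forall f : fsym L, ('I_(far f) -> carrier) -> carrier;
  rint : forall r : rsym L, ('I_(rar r) -> carrier) -> Prop }.

Arguments fint {L}.
Arguments rint {L}.

Fixpoint term_eval L (M : structure L) V (v : V -> M) (t : term L V) : M :=
  match t with
  | Var x => v x
  | App f ts => fint M f (fun i => term_eval v (ts i))
  end.

Definition extend_asg (X V : Type) (v : V -> X) (x : X) (o : option V) : X :=
  if o is Some y then v y else x.

Fixpoint sat L (M : structure L) V (phi : fml L V) : (V -> M) -> Prop :=
  match phi with
  | FBot => fun _ => False
  | FEq t u => fun v => term_eval v t = term_eval v u
  | FRel r ts => fun v => rint M r (fun i => term_eval v (ts i))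
  | FImp p q => fun v => sat p v -> sat q v
  | FAll p => fun v => forall x : M, sat p (extend_asg v x)
  end.

Definition isomorphic L (M N : structure L) : Prop :=
  exists h : M -> N,
    [/\ bijective h,
        forall f a, h (fint M f a) = fint N f (h \o a) &
        forall r a, rint M r a <-> rint N r (h \o a)].

Definition elementary_embedding L (M N : structure L) (e : M -> N) : Prop :=
  forall n (phi : fml L 'I_n) (a : 'I_n -> M), sat phi a <-> sat phi (e \o a).

Definition sublang (L : language) (S : set (symbol L)) : language :=
  {| fsym := {f : fsym L | S (inl f)}; far := fun f => far (sval f);
     rsym := {r : rsym L | S (inr r)}; rar := fun r => rar (sval r) |}.

Definition reduct L (S : set (symbol L)) (M : structure L) :
    structure (sublang S) :=
  @Structure (sublang S) M (carrier_inhabited M)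
    (fun f => fint M (sval f)) (fun r => rint M (sval r)).

Fixpoint lift_term L (S : set (symbol L)) V (t : term (sublang S) V) :
    term L V :=
  match t with
  | Var x => Var x
  | App f ts => App (sval f) (fun i => lift_term (ts i))
  end.

Fixpoint lift_fml L (S : set (symbol L)) V (phi : fml (sublang S) V) :
    fml L V :=
  match phi with
  | FBot => FBot
  | FEq t u => FEq (lift_term t) (lift_term u)
  | FRel r ts => FRel (sval r) (fun i => lift_term (ts i))
  | FImp p q => FImp (lift_fml p) (lift_fml q)
  | FAll p => FAll (lift_fml p)
  end.

Definition theory (L : language) : Type := set (fml L void).

Section Theories.
Context {L : language}.
Implicit Types (T : theory L) (M : structure L).

Definition models M T : Prop := forall s, T s -> sat s (of_void M).

(* T entails the universal closure of [phi]. *)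
Definition entails T V (phi : fml L V) : Prop :=
  forall M, models M T -> forall v : V -> M, sat phi v.

Definition consistent_with T V (phi : fml L V) : Prop :=
  exists2 M, models M T & exists v : V -> M, sat phi v.

Definition complete_theory T : Prop :=
  (exists M, models M T) /\
  forall s : fml L void, entails T s \/ entails T (FNeg s).

Definition T_complete T n (phi : fml L 'I_n) : Prop :=
  consistent_with T phi /\
  forall psi : fml L 'I_n,
    entails T (FImp phi psi) \/ entails T (FImp phi (FNeg psi)).

(* [phi] isolates the type of [a] over the empty set. *)
Definition isolates T M n (a : 'I_n -> M) (phi : fml L 'I_n) : Prop :=
  sat phi a /\ forall psi : fml L 'I_n, sat psi a -> entails T (FImp phi psi).

Definition atomic_model T M : Prop :=
  models M T /\
  forall n (a : 'I_n -> M), exists phi : fml L 'I_n, isolates T a phi.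

Definition atomic_set T M (A : set M) : Prop :=
  countable A /\
  forall n (a : 'I_n -> M), (forall i, A (a i)) ->
    exists phi : fml L 'I_n, isolates T a phi.

(* For [S] the set of symbols of the sublanguage L_alpha, [S_atomic_set T S] is
   "alpha-atomic" and [S_base T S] is "alpha-base". *)
Definition S_atomic_set T (S : set (symbol L)) M (A : set M) : Prop :=
  countable A /\
  forall n (a : 'I_n -> M), (forall i, A (a i)) ->
    exists phi : fml (sublang S) 'I_n, isolates T a (lift_fml phi).

(* [A] is the universe of an elementary substructure of [M] (of which [N] is a
   copy). *)
Definition elementary_subset L' (M : structure L') (A : set M) : Prop :=
  exists (N : structure L') (e : N -> M),
    elementary_embedding e /\ range e = A.

Definition S_base T (S : set (symbol L)) M (A : set M) : Prop :=
  S_atomic_set T S A /\ @elementary_subset (sublang S) (reduct S M) A.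

(* An L(A)-formula in n variables is a formula over [A + 'I_n], each element of
   [A] being a variable that is always interpreted by itself. *)
Definition with_params M (A : set M) n (b : 'I_n -> M) (x : A + 'I_n) : M :=
  match x with inl a => \val a | inr i => b i end.

Definition realizes M (A : set M) n (b : 'I_n -> M)
    (p : set (fml L (A + 'I_n))) : Prop :=
  forall phi, p phi -> sat phi (with_params b).

Definition is_complete_type M (A : set M) n (p : set (fml L (A + 'I_n))) :
    Prop :=
  (forall q, finite_set q -> q `<=` p -> exists b : 'I_n -> M, realizes b q) /\
  (forall phi, p phi \/ p (FNeg phi)).

Definition stone M (A : set M) n : Type :=
  {p : set (fml L (A + 'I_n)) | is_complete_type p}.

End Theories.

Section StoneTopology.
Context {L : language} {M : structure L} (A : set M) (n : nat).

Definition stone_basic (phi : fml L (A + 'I_n)) : set (stone A n) :=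
  [set p | sval p phi].

HB.instance Definition _ := gen_eqMixin (stone A n).
HB.instance Definition _ := gen_choiceMixin (stone A n).
HB.instance Definition _ :=
  isSubBaseTopological.Build (stone A n) (range stone_basic) id.

End StoneTopology.

Section AtomicTypes.
Context {L : language} (T : theory L) {M : structure L} (A : set M).

Definition S_at (n : nat) : set (stone A n) :=
  [set p | forall b : 'I_n -> M, realizes b (sval p) ->
             atomic_set T (A `|` range b)].

Arguments S_at n : clear implicits.

(* Disjoint union over n of the subspaces [S_at n] of the Stone spaces. *)
Definition S_at_all : topologicalType :=
  {n : nat & set_type (S_at n)}.

End AtomicTypes.

Arguments S_at {L} T {M} A n.

Definition scattered (X : topologicalType) : Prop :=
  ~ exists P : set X, P !=set0 /\ perfect_set P.

(* A monster model of [T]: aleph_2-saturated and strongly aleph_2-homogeneous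
   ([W] being of size aleph_1). *)
Definition monster (W : Type) L (T : theory L) (M : structure L) : Prop :=
  [/\ models M T,
      forall A : set M, A #<= [set: W] ->
        forall n (p : stone A n), exists b : 'I_n -> M, realizes b (sval p) &
      forall (A : set M) (e : A -> M), A #<= [set: W] ->
        (forall phi : fml L A, sat phi \val <-> sat phi e) ->
        exists h : M -> M,
          [/\ bijective h,
              forall f a, h (fint M f a) = fint M f (h \o a),
              forall r a, rint M r a <-> rint M r (h \o a) &
              forall a : A, h (\val a) = e a]].

Section Spectrum.
Context {d : Order.disp_t} {W : orderType d} {L : language}.
Implicit Types (T : theory L) (La : W -> set (symbol L)) (C : structure L).

Definition language_chain La : Prop :=
  [/\ forall a, countable (La a),
      forall a b, a <= b -> La a `<=` La b,
      forall a, is_limit a -> La a = \bigcup_(b in [set b | b < a]) La b &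
      \bigcup_a La a = setT].

Definition T_complete_dense T La (a : W) : Prop :=
  forall n (phi : fml (sublang (La a)) 'I_n),
    consistent_with T (lift_fml phi) ->
    exists psi : fml (sublang (La a)) 'I_n,
      T_complete T (lift_fml psi) /\
      entails T (FImp (lift_fml psi) (lift_fml phi)).

Definition tt_at T La C (a : W) : Prop :=
  forall A : set C, S_base T (La a) A -> scattered (S_at_all T A).

Definition spec_tt T La (C0 : set W) C : set W :=
  [set a | C0 a /\ tt_at T La C a].

Definition club_tt T La (C0 : set W) C : Prop :=
  exists D : set W, club D /\ D `<=` spec_tt T La C0 C.

End Spectrum.

(* Main.v *)
Require Import Defs.
From mathcomp Require finmap.
From mathcomp Require Import all_boot all_order.
From mathcomp Require Import boolp classical_sets functions cardinality.
From mathcomp Require Import topology cantor.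

(** Most of the proof takes place in a [frame]: tuples of points of the monster
    model, its automorphisms, and the relation [At a s] that the type of the
    tuple [s] is isolated by a formula of the language at [a].  Alpha-bases
    become [base]s, and a [rich_model], a set that is a directed union of bases
    of unbounded level, is an atomic elementary submodel of size aleph_1
    ([rich_tarski_vaught], [submodel_atomic]).  Isomorphisms between rich models
    preserve types, as types in atomic models are isolated
    ([isomorphic_tp_iso]); so it is enough to find 2^aleph_1 rich models with no
    type-preserving bijection between any two of them ([many_models]).

    Rich models are unions along the branches of a binary tree of [state]s, a
    state being a base together with promises to omit some types.  At stage [b]
    of the branch [f] the bit [f b] decides between two extensions of the state
    [s] reached before: one realises a type over [bas s], the other excludes
    this type for ever.  An isomorphism may move [bas s], and here weak diamond
    comes in ([many_models_diamond]).  If the fate of the types over [bas s] is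
    determined by [f] up to stage [b], the bits on a stationary set can be chosen
    so as to defeat every coded isomorphism, independently on aleph_1 many
    disjoint stationary sets.  It is determined if the two extensions are
    [stable].  If some state has no stable extension, choosing repeatedly over
    one fixed countable set gives models that are pairwise nonisomorphic over
    this set, and a counting argument suffices ([many_models_split]), as weak
    diamond implies 2^aleph_1 > aleph_1^aleph_0 ([diamond_not_embeds]).

    It remains to find the two extensions.  Non-scattered spaces of atomic types
    give a [crowded] set of types over a base at some level of each club
    ([crowded_not_scattered]).  If at stationarily many levels some atomic type
    over a base does not extend to an atomic superset [D'] ([splits]), one
    extension realises this type and the other includes [D']
    ([many_models_splitting]).  Otherwise there is a club of levels where atomic
    types extend.  A crowded set has 2^aleph_0 types, and this exceeds aleph_1
    as Cov(K) >= aleph_2; a type with more than aleph_1 extensions ([large])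
    then keeps this property over larger bases ([large_push]).  Since
    Cov(K) >= aleph_2, there are chains of finite conditions that meet aleph_1
    dense sets ([generic]).  They produce an extension of a base that realises a
    type outside any list of aleph_1 types and that respects the promises
    ([generic_extension]).  A type may be promised if it is [good]: no finite
    condition for an iteration of such extensions forces it to be realised.  All
    types except aleph_1 many are good ([not_good_few]), hence some type can be
    realised in one extension and promised in the other
    ([promise_state_undecided], [many_models_nonsplitting]). *)

Set Implicit Arguments.
Unset Strict Implicit.
Unset Printing Implicit Defensive.
Import Order.TTheory.
Local Open Scope order_scope.
Local Open Scope classical_set_scope.

(** * The order omega_1 *)

Definition embeds (X Y : Type) : Prop := exists f : X -> Y, injective f.

Lemma embeds_trans X Y Z : embeds X Y -> embeds Y Z -> embeds X Z.
Proof. by move=> [f fI] [g gI]; exists (g \o f); apply: inj_comp. Qed.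

Lemma embeds_prod X X' Y Y' :
  embeds X X' -> embeds Y Y' -> embeds (X * Y) (X' * Y').
Proof.
move=> [f fI] [g gI]; exists (fun p => (f p.1, g p.2)).
by move=> [x y] [x' y'] /= [/fI-> /gI->].
Qed.

Lemma choice_rel (X Y : Type) (R : X -> Y -> Prop) :
  (forall x, exists y, R x y) -> exists f : X -> Y, forall x, R x (f x).
Proof.
move=> H; exists (fun x => projT1 (cid (H x))) => x.
exact: (projT2 (cid (H x))).
Qed.

Lemma countable_code T (A : set T) : countable A ->
  exists c : T -> nat, forall x y, A x -> A y -> c x = c y -> x = y.
Proof.
move=> /countable_injP[f fI]; exists f => x y Ax Ay E.
by apply: fI => //; rewrite inE.
Qed.

Lemma code_countable T (A : set T) (c : T -> nat) :
  (forall x y, A x -> A y -> c x = c y -> x = y) -> countable A.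
Proof.
move=> H; apply/countable_injP; exists c => x y.
by rewrite !inE; exact: H.
Qed.

Lemma countable_sub T (A B : set T) : A `<=` B -> countable B -> countable A.
Proof. by move=> AB; apply: sub_countable; apply: subset_card_le. Qed.

Lemma countable_image T U (f : T -> U) (A : set T) : countable A -> countable (f @` A).
Proof. by apply: sub_countable; apply: card_image_le. Qed.

Lemma countable_range (T : countType) U (f : T -> U) : countable (range f).
Proof. by apply: countable_image; apply: countableP. Qed.

Lemma countable_cup T (F : nat -> set T) :
  (forall n, countable (F n)) -> countable (\bigcup_n F n).
Proof. by move=> H; apply: bigcup_countable => //; apply: countableP. Qed.

Lemma countable_setU T (A B : set T) : countable A -> countable B -> countable (A `|` B).
Proof.
move=> Ac Bc; apply: (@countable_sub _ _ (\bigcup_n (if n is 0 then A else B))).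
  by move=> x [Ax|Bx]; [exists 0%N|exists 1%N].
by apply: countable_cup => -[].
Qed.

Lemma countable_surj T (A : set T) : countable A -> A !=set0 ->
  exists2 e : nat -> T, forall n, A (e n) & forall x, A x -> exists n, e n = x.
Proof.
move=> Ac [x0 Ax0]; have [c cI] := countable_code Ac.
have /choice_rel[e eP] : forall n, exists z, A z /\ forall y, A y -> c y = n -> z = y.
  move=> n; have [[y [Ay yn]]|h] := pselect (exists y, A y /\ c y = n).
    by exists y; split=> // y' Ay' yn'; apply: cI => //; rewrite yn.
  by exists x0; split=> // y Ay yn; case: h; exists y.
exists e => [n|x Ax]; first by case: (eP n).
by exists (c x); have [_] := eP (c x); apply.
Qed.

Section Omega1.
Context {d : Order.disp_t} {W : orderType d} (W1 : is_omega1 W).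

Lemma W_min (A : set W) : A !=set0 -> exists2 a, A a & forall b, A b -> a <= b.
Proof. by case: W1 => h _ _; exact: h. Qed.

Lemma ltW_wf : well_founded (fun a b : W => a < b).
Proof.
move=> a; apply: contrapT => nacc.
have [|b nb bmin] := @W_min [set a | ~ Acc (fun a b : W => a < b) a].
  by exists a.
apply: nb; constructor => c cb; apply: contrapT => /bmin.
by rewrite leNgt cb.
Qed.

Lemma W_ind (P : W -> Prop) :
  (forall a, (forall b, b < a -> P b) -> P a) -> forall a, P a.
Proof. by move=> H; apply: (well_founded_ind ltW_wf). Qed.

Lemma below_countable (a : W) : countable [set b | b < a].
Proof. by case: W1 => _ h _; exact: h. Qed.

Lemma W_uncountable : ~ countable [set: W].
Proof. by case: W1. Qed.

Lemma countable_bounded (A : set W) : countable A -> exists b, forall a, A a -> a < b.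
Proof.
move=> Ac; apply: contrapT => nb; apply: W_uncountable.
have : countable (\bigcup_(a in A) ([set b | b < a] `|` [set a])).
  apply: bigcup_countable => // a _; apply: countable_setU.
    exact: below_countable.
  exact: countable1.
apply: countable_sub => b _.
have [a [Aa ba]] : exists a, A a /\ b <= a.
  apply: contrapT => H; apply: nb; exists b => a Aa; rewrite ltNge; apply/negP => ba.
  by apply: H; exists a.
by exists a => //=; move: ba; rewrite le_eqVlt => /orP[/eqP->|]; [right|left].
Qed.

Lemma W_inh : inhabited W.
Proof.
have [b _] := @countable_bounded set0 (countable0 _); by constructor.
Qed.

Definition w0 : W := projT1 (cid (@countable_bounded set0 (countable0 _))).

Lemma seq_bounded (u : nat -> W) : exists b, forall n, u n < b.
Proof.
have [b bP] := @countable_bounded (range u) (countable_range u).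
by exists b => n; apply: bP; exists n.
Qed.

Lemma W_lub (A : set W) : (exists b, forall a, A a -> a <= b) ->
  exists l, (forall a, A a -> a <= l) /\ forall b, (forall a, A a -> a <= b) -> l <= b.
Proof.
move=> [b bP]; have [|l lP lmin] := @W_min [set b | forall a, A a -> a <= b].
  by exists b.
by exists l.
Qed.

(** Well-founded recursion in relational form. The functions [g] are total,
    with [x0] in place of the values that are not yet known, so that no
    dependent types arise. *)
Lemma W_rec_exists (X : Type) (x0 : X) (R : W -> (W -> X) -> X -> Prop) :
  (forall a g, exists x, R a g x) ->
  (forall a g g' x, (forall b, b < a -> g b = g' b) -> R a g x -> R a g' x) ->
  exists F : W -> X, forall a, R a F (F a).
Proof.
move=> Rex Rloc.
pose st a (g : forall b, b < a -> X) : X :=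
  projT1 (cid (Rex a (fun b => if pselect (b < a) is left h then g b h else x0))).
pose F := Fix ltW_wf (fun=> X) st.
exists F => a; rewrite {2}/F Fix_eq; last first.
  move=> b g g' gg'; rewrite /st; congr (projT1 (cid (Rex b _))).
  by apply/funext => c; case: pselect => // h; apply: gg'.
rewrite /st; case: cid => x /= Rx; apply: Rloc Rx => b ba.
by case: pselect => //; rewrite ba.
Qed.

Definition wrec (X : Type) (x0 : X) (st : W -> (W -> X) -> X) : W -> X :=
  projT1 (cid (@W_rec_exists X x0
    (fun a g x => x = st a (fun b => if b < a then g b else x0))
    (fun a g => ex_intro _ _ erefl)
    (fun a g g' x E Ex => etrans Ex (congr1 (st a)
       (funext (fun b => match boolP (b < a) with
         | AltTrue h => etrans (ifT _ _ h) (etrans (E b h) (esym (ifT _ _ h)))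
         | AltFalse h => etrans (ifN _ _ h) (esym (ifN _ _ h)) end)))))).

Lemma wrecE X x0 st (a : W) :
  @wrec X x0 st a = st a (fun b => if b < a then wrec x0 st b else x0).
Proof. by rewrite /wrec; case: cid => F /= FP; apply: FP. Qed.

Lemma ex_gt (a : W) : exists b, a < b.
Proof. by have [b bP] := countable_bounded (countable1 a); exists b; apply: bP. Qed.

(** Clubs are handled through closure points, as every club contains the
    closure points of a function ([club_cl]). *)
Definition cl_pts (R : W -> set W) : set W :=
  [set a | (exists b, b < a) /\ forall x, x < a -> forall y, R x y -> y < a].

(** The countably many [R]-successors of the points up to [x] are bounded by
    some [phi x]; the supremum of the iterates of [phi] is a closure point. *)
Lemma cl_pts_club (R : W -> set W) : (forall x, countable (R x)) -> club (cl_pts R).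
Proof.
move=> Rc.
have /choice_rel[phi phiP] : forall x, exists p,
    x < p /\ forall z, z <= x -> forall y, R z y -> y < p.
  move=> x.
  have [|b bP] := @countable_bounded ([set x] `|` \bigcup_(z in [set z | z < x] `|` [set x]) R z).
    apply: countable_setU; first exact: countable1.
    by apply: bigcup_countable => [|? _ //]; apply: countable_setU; [exact: below_countable|exact: countable1].
  exists b; split; first by apply: bP; left.
  move=> z zx y Ry; apply: bP; right; exists z => //.
  by move: zx; rewrite le_eqVlt => /orP[/eqP->|]; [right|left].
split=> [b|a ab H].
  pose u n := iter n phi b.
  have uS n : u n < u n.+1 by rewrite /u /=; case: (phiP (u n)).
  have [|l [lu lmin]] := @W_lub (range u).
    by have [l lP] := seq_bounded u; exists l => _ [n _ <-]; apply: ltW.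
  have ul n : u n < l by apply: lt_le_trans (uS n) _; apply: lu; exists n.+1.
  have lx x : x < l -> exists n, x <= u n.
    move=> xl; apply: contrapT => H; suff: l <= x by rewrite leNgt xl.
    apply: lmin => _ [n _ <-]; rewrite leNgt; apply/negP => xu; apply: H.
    by exists n; apply: ltW.
  exists l; last exact: (ul 0%N).
  split; first by exists b; apply: (ul 0%N).
  move=> x /lx[n xu] y Ry; apply: lt_trans (ul n.+1).
  by have [_ /(_ x xu y Ry)] := phiP (u n).
split=> // x xa y Ry; have [c [_ Hc] /andP[xc ca]] := H x xa.
exact: lt_trans (Hc x xc y Ry) ca.
Qed.

Lemma club_cl (D : set W) : club D -> exists f : W -> W, cl_pts (fun x => [set f x]) `<=` D.
Proof.
move=> [Du Dc]; have /choice_rel[f fP] : forall b, exists c, D c /\ b < c.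
  by move=> b; have [c ? ?] := Du b; exists c.
exists f => a [ab H]; apply: Dc => // b ba; have [Df bf] := fP b.
by exists (f b) => //; rewrite bf (H b ba (f b)).
Qed.

(** A common closure point of the countably many functions given by
    [club_cl] lies in all the clubs. *)
Lemma club_cap (D : nat -> set W) : (forall n, club (D n)) -> club (\bigcap_n D n).
Proof.
move=> Dc; have /choice_rel[f fP] := fun n => club_cl (Dc n).
split=> [b|a ab H n _].
  have [|cu _] := @cl_pts_club (fun x => range (f^~ x)).
    by move=> x; apply: countable_range.
  have [c [c1 c2] bc] := cu b; exists c => // n _.
  by apply: fP; split=> // x xc y ->; apply: (c2 x) => //; exists n.
have [_] := Dc n; apply=> // b ba; have [c cD bca] := H b ba; exists c => //.
exact: cD.
Qed.

Lemma clubI (D E : set W) : club D -> club E -> club (D `&` E).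
Proof.
move=> Dc Ec; suff -> : D `&` E = \bigcap_n (if n is 0 then D else E) by apply: club_cap => -[].
apply/seteqP; split=> [x [Dx Ex] [|n] _ //|x H].
by split; [apply: (H 0%N)|apply: (H 1%N)].
Qed.

Lemma club_limit : club [set a : W | is_limit a].
Proof.
have [f fP] := choice_rel ex_gt.
have [u c] := @cl_pts_club (fun x => [set f x]) (fun x => countable1 _).
split=> [b|a ab H].
  have [e [e1 e2] be] := u b; exists e => //; split=> // x xe.
  by exists (f x); rewrite fP (e2 x xe (f x)).
by split=> // b /H[e _ h]; exists e.
Qed.

Lemma club_gt (a : W) : club [set b | a < b].
Proof.
split=> [b|c [b bc] H].
  by have [e eP] := ex_gt (Order.max a b); exists e; move: eP; rewrite gt_max => /andP[].
by have [e /= ae /andP[_ ec]] := H b bc; apply: lt_trans ec.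
Qed.

Lemma stationaryT : stationary [set: W].
Proof. by move=> D [Du _]; have [c Dc _] := Du (w0); exists c. Qed.

Lemma iter_lt (s : W -> W) : (forall a, a < s a) ->
  forall x m n, (m < n)%N -> iter m s x < iter n s x.
Proof.
move=> sP x m n; elim: n => // n IH; rewrite ltnS leq_eqVlt => /orP[/eqP->|/IH h].
  by rewrite /=; apply: sP.
exact: lt_trans h (sP _).
Qed.

(** The points [L a] are spaced so widely that the sequences of iterated
    successors starting from them are disjoint. *)
Lemma embeds_prod_nat : embeds (W * nat) W.
Proof.
have [s sP] := choice_rel ex_gt.
have [||L LP] := @W_rec_exists W (w0)
   (fun a g x => forall b, b < a -> forall n, iter n s (g b) < x).
- move=> a g.
  have [|x xP] := @countable_bounded (\bigcup_(b in [set b | b < a]) range (fun n => iter n s (g b))).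
    by apply: bigcup_countable => [|b _]; [exact: below_countable|exact: countable_range].
  by exists x => b ba n; apply: xP; exists b => //; exists n.
- by move=> a g g' x E H b ba n; rewrite -E//; apply: H.
have key a b m n : a < b -> iter m s (L a) <> iter n s (L b).
  move=> ab E; have := LP b a ab m; rewrite E => h.
  have : L b <= iter n s (L b) by case: n {E} h => // n _; apply/ltW/(@iter_lt s sP _ 0%N).
  by rewrite leNgt h.
exists (fun p => iter p.2 s (L p.1)) => -[a m] [b n] /=.
have [ab /(key _ _ _ _ ab) //|ba /esym/(key _ _ _ _ ba)//|-> E] := ltgtP a b.
congr pair; have [h|h|//] := ltngtP m n; have := iter_lt sP (L b) h; by rewrite E ltxx.
Qed.

Lemma below_code (a : W) : exists c : W -> nat, forall x y, x <= a -> y <= a -> c x = c y -> x = y.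
Proof.
have [b ab] := ex_gt a; have [c cP] := countable_code (below_countable b).
by exists c => x y xa ya; apply: cP; apply: le_lt_trans ab.
Qed.

Lemma embeds_nat : embeds nat W.
Proof.
apply: embeds_trans embeds_prod_nat; exists (fun n => (w0, n)).
by move=> m n [].
Qed.

(** A pair is coded by its maximum and a natural number, as only countably
    many pairs have a given maximum. *)
Lemma embeds_prodW : embeds (W * W) W.
Proof.
have [e eP] := choice_rel below_code.
apply: embeds_trans embeds_prod_nat.
pose m (p : W * W) := Order.max p.1 p.2.
exists (fun p => (m p, pickle (e (m p) p.1, e (m p) p.2))).
move=> p q [Em /(pcan_inj pickleK) [E1 E2]].
rewrite -Em in E1 E2; rewrite (surjective_pairing p) (surjective_pairing q).
congr pair; [apply: (eP (m p)) E1|apply: (eP (m p)) E2].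
- by rewrite /m le_max lexx.
- by rewrite Em /m le_max lexx.
- by rewrite /m le_max lexx orbT.
- by rewrite Em /m le_max lexx orbT.
Qed.

Lemma embeds_option : embeds (option W) W.
Proof.
apply: embeds_trans embeds_prod_nat.
exists (fun o => if o is Some x then (x, 1%N) else (w0, 0%N)).
by move=> [x|] [y|] // [->].
Qed.

Lemma embeds_seq : embeds (seq W) W.
Proof.
have [j jI] := embeds_trans (let: ex_intro f fI := embeds_prodW in
  ex_intro _ (omap f) (inj_omap fI)) embeds_option.
pose c := fix c (s : seq W) := if s is x :: s then j (Some (x, c s)) else j None.
exists c; elim=> [|x s IH] [|y t] //= /jI // [-> /IH ->//].
Qed.

Lemma embeds_count (X : countType) : embeds X W.
Proof.
by apply: embeds_trans embeds_nat; exists pickle; apply: pcan_inj pickleK.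
Qed.

Lemma embeds_pair X Y : embeds X W -> embeds Y W -> embeds (X * Y) W.
Proof. by move=> h k; apply: embeds_trans embeds_prodW; apply: embeds_prod. Qed.

Lemma embeds_either X Y : embeds X W -> embeds Y W -> embeds (X + Y) W.
Proof.
move=> [f fI] [g gI]; apply: embeds_trans embeds_prod_nat.
exists (fun i => match i with inl x => (f x, 0%N) | inr y => (g y, 1%N) end).
by move=> [x|x] [y|y] // [] => [/fI->|/gI->].
Qed.

Lemma embeds_set X (P : set X) : countable P -> embeds {z | P z} W.
Proof.
move=> /countable_code[c cI]; apply: embeds_trans embeds_nat.
by exists (fun z => c (sval z)) => -[z Ez] [y Ey] /= /cI E; apply: eq_exist; exact: E.
Qed.

Lemma embeds_enum X : inhabited X -> embeds X W -> exists e : W -> X, forall x, exists w, e w = x.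
Proof.
move=> [x0] [c cI]; have /choice_rel[e eP] : forall w, exists x, (exists y, c y = w) -> c x = w.
  move=> w; case: (pselect (exists y, c y = w)) => [[y cy]|n]; first by exists y.
  by exists x0.
by exists e => x; exists (c x); apply: cI; apply: eP; exists x.
Qed.

(** Bookkeeping: enumerate the pairs with uncountable repetition; then each
    pair [(a, i)] is listed at some stage after [a]. *)
Lemma W_tasks (I : Type) : inhabited I -> embeds I W ->
  exists p : W -> W * I, forall a i, exists2 b, a < b & p b = (a, i).
Proof.
move=> Ii IW.
have [e eP] := @embeds_enum (W * (W * I)) (let: inhabits i := Ii in inhabits (w0,(w0, i)))
   (embeds_pair (ex_intro _ id (fun _ _ => id)) (embeds_pair (ex_intro _ id (fun _ _ => id)) IW)).
exists (fun w => (e w).2) => a i; apply: contrapT => H.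
have [g gP] := choice_rel (fun x : W => eP (x, (a, i))).
have gI : injective g by move=> x y E; have := gP x; rewrite E gP => -[].
apply: W_uncountable.
have gc : countable (range g).
  have [b ab] := ex_gt a.
  apply: countable_sub (below_countable b) => _ [x _ <-] /=; apply: le_lt_trans ab.
  rewrite leNgt; apply/negP => ag; apply: H; exists (g x) => //; by rewrite gP.
have [c cP] := countable_code gc.
by apply: (@code_countable _ _ (c \o g)) => x y _ _ /cP E; apply: gI; apply: E; eexists.
Qed.

Lemma uncountable_enum (A : set W) : ~ countable A ->
  exists2 g : W -> W, injective g & forall w, A (g w).
Proof.
move=> nA.
have [||g gP] := @W_rec_exists W (w0)
   (fun a g x => A x /\ forall b, b < a -> g b <> x).
- move=> a g; apply: contrapT => H; apply: nA.
  apply: countable_sub (countable_image g (below_countable a)) => x Ax.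
  apply: contrapT => nx; apply: H; exists x; split=> // b ba E; apply: nx.
  by exists b.
- by move=> a g g' x E [Ax H]; split=> // b ba; rewrite -E//; apply: H.
exists g => [x y E|w]; last by case: (gP w).
have [xy|yx|//] := ltgtP x y.
  by have [_ /(_ x xy)] := gP y.
by have [_ /(_ y yx)] := gP x; rewrite E.
Qed.

(** The Ulam matrix. For each [a] the countably many sets [V a n] cover the
    part of [S] above [a], so one of them is stationary. The same [n] serves
    uncountably many [a], and for a fixed [n] the sets [V a n] are disjoint
    since the code [e b] is injective below [b]. *)
Lemma ulam (S : set W) : stationary S -> exists U : W -> set W,
  [/\ forall i, stationary (U i), forall i, U i `<=` S &
      forall i j x, U i x -> U j x -> i = j].
Proof.
move=> SS; have [e eP] := choice_rel below_code.
pose V a n := [set b | [/\ S b, a < b & e b a = n]].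
have VS a : exists n, stationary (V a n).
  apply: contrapT => H.
  have /choice_rel[D DP] : forall n, exists D, club D /\ ~ (V a n `&` D !=set0).
    move=> n; apply: contrapT => nD; apply: H; exists n => D Dc; apply: contrapT => ND.
    by apply: nD; exists D.
  have [b [Sb [ab Db]]] := SS _ (clubI (club_gt a) (club_cap (fun n => (DP n).1))).
  by apply: (DP (e b a)).2; exists b; split=> //; apply: Db.
have [n nP] := choice_rel VS.
have [m mP] : exists m, ~ countable [set a | n a = m].
  apply: contrapT => H; apply: W_uncountable.
  apply: (@countable_sub _ _ (\bigcup_m [set a | n a = m])); first by move=> a _; exists (n a).
  by apply: countable_cup => m; apply: contrapT => h; apply: H; exists m.
have [g gI gP] := uncountable_enum mP.
exists (fun i => V (g i) m); split=> [i|i x []//|i j x [_ ix E] [_ jx]].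
  by rewrite -(gP i); apply: nP.
by rewrite -E => /eP E'; apply: gI; rewrite E' //; apply: ltW.
Qed.
End Omega1.

(** * Comparing and multiplying cardinals *)

Definition inj_graph (X Y : Type) (G : set (X * Y)) : Prop :=
  (forall x y y', G (x, y) -> G (x, y') -> y = y') /\
  (forall x x' y, G (x, y) -> G (x', y) -> x = x').

Lemma inj_graph_cup X Y (F : set (set (X * Y))) :
  (forall G, F G -> inj_graph G) -> total_on F subset ->
  inj_graph (\bigcup_(G in F) G).
Proof.
move=> FG Ft; split.
- move=> x y y' [G FG1 Gy] [H FH Hy].
  by have [GH|HG] := Ft _ _ FG1 FH; [apply: (FG _ FH).1 (GH _ Gy) Hy|apply: (FG _ FG1).1 Gy (HG _ Hy)].
- move=> x y y' [G FG1 Gy] [H FH Hy].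
  by have [GH|HG] := Ft _ _ FG1 FH; [apply: (FG _ FH).2 (GH _ Gy) Hy|apply: (FG _ FG1).2 Gy (HG _ Hy)].
Qed.

Lemma embeds_graph X Y (G : set (X * Y)) :
  inj_graph G -> (forall x, exists y, G (x, y)) -> embeds X Y.
Proof.
move=> [_ GI] /choice_rel[f fP]; exists f => x x' E.
by apply: (GI _ _ (f x)) (fP x) _; rewrite E; apply: fP.
Qed.

Lemma inj_graph_add X Y (G : set (X * Y)) x y : inj_graph G ->
  (forall y', ~ G (x, y')) -> (forall x', ~ G (x', y)) -> inj_graph (G `|` [set (x, y)]).
Proof.
move=> [Gf Gi] nx ny; split.
- move=> a b b' [h|e] [h'|e']; first exact: Gf h h'.
  + by move: h; rewrite (congr1 fst e' : a = x) => /nx.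
  + by move: h'; rewrite (congr1 fst e : a = x) => /nx.
  + by rewrite (congr1 snd e : b = y) (congr1 snd e' : b' = y).
- move=> a a' b [h|e] [h'|e']; first exact: Gi h h'.
  + by move: h; rewrite (congr1 snd e' : b = y) => /ny.
  + by move: h'; rewrite (congr1 snd e : b = y) => /ny.
  + by rewrite (congr1 fst e : a = x) (congr1 fst e' : a' = x).
Qed.

(** A maximal partial injection is total or onto. *)
Lemma embeds_total X Y : embeds X Y \/ embeds Y X.
Proof.
have [G [GP Gmax]] := @Zorn_bigcup (X * Y) (@inj_graph X Y)
  (fun F FP Ft => inj_graph_cup FP Ft).
apply: contrapT => /not_orP[nXY nYX].
have [x nx] : exists x, forall y, ~ G (x, y).
  apply: contrapT => H; apply: nXY; apply: (embeds_graph GP) => x.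
  by apply: contrapT => h; apply: H; exists x => y Gy; apply: h; exists y.
have [y ny] : exists y, forall x, ~ G (x, y).
  apply: contrapT => H; apply: nYX; apply: (@embeds_graph _ _ [set p | G (p.2, p.1)]).
    by split=> [a b b' /=|a b b' /=]; [apply: GP.2|apply: GP.1].
  by move=> y; apply: contrapT => h; apply: H; exists y => x' Gx; apply: h; exists x'.
apply: (Gmax _ _ (inj_graph_add GP nx ny)); split; first by move=> p; left.
by move=> /(_ (x, y) (or_intror erefl)) /nx.
Qed.

Lemma embeds_sum X X' Y Y' :
  embeds X X' -> embeds Y Y' -> embeds (X + Y) (X' + Y').
Proof.
move=> [f fI] [g gI].
exists (fun p => match p with inl x => inl (f x) | inr y => inr (g y) end).
by move=> [x|x] [y|y] // [] => [/fI->|/gI->].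
Qed.

(** In terms of cardinals: if [R = R * R], and [D <= T * R] but not [D <=
    R], then [D <= T]. Take [P] in [T] maximal with [P * R <= P]. By
    maximality [R] does not embed into the complement of [P], which
    therefore embeds into [R]. So [T * R <= P * R + R * R <= P + P <= P] if
    [P] is nonempty, and [D <= R] if [P] is empty. *)
Lemma embeds_prod_absorb D T R : (exists r s : R, r <> s) ->
  embeds (R * R) R -> ~ embeds D R -> embeds D (T * R) -> embeds D T.
Proof.
move=> [r0 [s0 rs]] RR nDR DTR.
pose dm (G : set ((T * R) * T)) := [set p | exists r q, G ((p, r), q)].
pose ok G := [/\ inj_graph G, forall p r, dm G p -> exists q, G ((p, r), q) &
                 forall p r q, G ((p, r), q) -> dm G q].
have [|G [[Gi Gt Gc] Gmax]] := @Zorn_bigcup ((T * R) * T) ok.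
  move=> F FP Ft; split.
  - by apply: inj_graph_cup => // G /FP[].
  - move=> p r [r' [q [G FG Gq]]]; have [_ h _] := FP _ FG.
    by have [|q' ?] := h p r; [exists r', q|exists q', G].
  - move=> p r q [G FG Gq]; have [_ _ h] := FP _ FG.
    by have [r' [q' ?]] := h p r q Gq; exists r', q', G.
pose P := dm G.
have PRP : embeds ({p | P p} * R) {p | P p}.
  have /choice_rel[f fP] : forall x : {p | P p} * R, exists q : {p | P p}, G ((sval x.1, x.2), sval q).
    by move=> [[p Pp] r] /=; have [q Gq] := Gt p r Pp; exists (exist _ q (Gc _ _ _ Gq)).
  exists f => -[[p Pp] r] [[p' Pp'] r'] E.
  have := Gi.2 _ _ _ (fP (exist _ p Pp, r)); rewrite E => /(_ _ (fP (exist _ p' Pp', r'))) /=.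
  by move=> [E1 ->]; congr pair; apply: eq_exist.
have [RQ|QR] := embeds_total R {p | ~ P p}.
  exfalso; case: RQ => g gI; have [j jI] := RR.
  pose G' := G `|` [set x | exists r s, x = ((sval (g r), s), sval (g (j (r, s))))].
  have Gg r s q : ~ G ((sval (g r), s), q).
    by move=> h; apply: (svalP (g r)); exists s, q.
  have gG r x : ~ G (x, sval (g r)).
    by case: x => p s h; apply: (svalP (g r)); apply: Gc h.
  have gsI r r' : sval (g r) = sval (g r') -> r = r'.
    move=> E; apply: gI; case: (g r) E => u pu; case: (g r') => v pv /= E.
    exact: eq_exist.
  have dG' r : dm G' (sval (g r)).
    by exists r0, (sval (g (j (r, r0)))); right; exists r, r0.
  apply: (Gmax G'); split; first by move=> x; left.
  - have : G' ((sval (g r0), r0), sval (g (j (r0, r0)))) by right; exists r0, r0.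
    by move=> h /(_ _ h) /Gg.
  - split.
    + move=> x y y' [h|[r [s [-> ->]]]] [h'|[r' [s' [E ->]]]].
      * exact: Gi.1 h h'.
      * by move: h; rewrite E => /Gg.
      * by move: h' => /Gg.
      * by case: E => /gsI -> ->.
    + move=> x y y' [h|[r [s [-> ->]]]] [h'|[r' [s' [-> E]]]].
      * exact: Gi.2 h h'.
      * by move: h; rewrite E => /gG.
      * by move: h' => /gG.
      * by move/gsI/jI: E => [-> ->].
  - move=> p r [r' [q [h|[a [b [-> _ _]]]]]].
      by have [|q' ?] := Gt p r; [exists r', q|exists q'; left].
    by exists (sval (g (j (a, r)))); right; exists a, r.
  - move=> p r q [/Gc[r' [q' h]]|[a [b [_ _ ->]]]]; first by exists r', q'; left.
    exact: dG'.
have [[p0 Pp0]|nP] := pselect (exists p, P p); last first.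
  exfalso; apply: nDR; apply: embeds_trans DTR _; apply: embeds_trans RR.
  apply: embeds_prod; last by exists id.
  apply: embeds_trans QR; exists (fun t => exist _ t (fun h => nP (ex_intro _ t h))).
  by move=> t t' [].
have RP : embeds R {p | P p}.
  by apply: embeds_trans PRP; exists (fun r => (exist _ p0 Pp0, r)) => r s [].
apply: embeds_trans DTR _.
have E1 : embeds (T * R) ({p | P p} + {p | P p}).
  apply: (@embeds_trans _ (({p | P p} * R) + ({p | ~ P p} * R))).
    exists (fun x => match pselect (P x.1) with
      | left h => inl (exist _ x.1 h, x.2) | right h => inr (exist _ x.1 h, x.2) end).
    move=> [t r] [t' r'] /=.
    by case: pselect => h; case: pselect => h' // [-> ->].
  apply: embeds_sum => //; apply: embeds_trans RP; apply: embeds_trans RR.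
  by apply: embeds_prod => //; exists id.
apply: embeds_trans E1 _; apply: (@embeds_trans _ {p | P p}); last first.
  by exists sval => -[x px] [y py] /= E; apply: eq_exist.
apply: embeds_trans PRP.
exists (fun x => match x with inl p => (p, r0) | inr p => (p, s0) end).
by move=> [x|x] [y|y] [] // -> // /esym.
Qed.

(** * Baire category and the size of the continuum *)

Lemma cantor_nbhs_cyl (x : cantor_space) (A : set cantor_space) : nbhs x A ->
  exists n, forall y : cantor_space, (forall i, (i < n)%N -> y i = x i) -> A y.
Proof.
move=> xA; apply: contrapT => H.
have /choice_rel[g gP] : forall n, exists y : cantor_space,
    (forall i, (i < n)%N -> y i = x i) /\ ~ A y.
  move=> n; apply: contrapT => h; apply: H; exists n => y yx.
  by apply: contrapT => nA; apply: h; exists y.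
have gcvg : g @ \oo --> x.
  apply/cvg_sup => N U [V] [[O] oO <-] OxN OU.
  apply: (filterS OU); rewrite nbhs_simpl /=; exists N.+1 => // i /= Ni.
  by rewrite (gP i).1.
move: xA => /gcvg; rewrite nbhs_simpl => -[N _ An].
by apply: (gP N).2; apply: An => /=.
Qed.

Lemma cantor_cyl_nbhs (x : cantor_space) n (A : set cantor_space) :
  (forall y : cantor_space, (forall i, (i < n)%N -> y i = x i) -> A y) -> nbhs x A.
Proof.
move=> H; suff : nbhs x [set y : cantor_space | forall i, (i < n)%N -> y i = x i].
  by apply: filterS.
elim: n {H} => [|n IH]; first by apply: (filterS _ filterT).
have : nbhs x [set y : cantor_space | y n = x n].
  have := @proj_continuous nat (fun=> bool) n x [set x n].
  by apply; rewrite nbhs_principalE.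
move=> /(filterI IH); apply: filterS => y [h1 h2] i.
by rewrite ltnS leq_eqVlt => /orP[/eqP->|/h1].
Qed.

(** Finite bit strings are the conditions for a real, with their extensions
    as basic open sets. *)
Definition extends (r : nat -> bool) (s : seq bool) : Prop := mkseq r (size s) = s.

Lemma extendsP r s : extends r s <-> forall i, (i < size s)%N -> r i = nth false s i.
Proof.
split=> [<- i|H]; first by rewrite size_mkseq => h; rewrite nth_mkseq.
apply: (@eq_from_nth _ false); rewrite size_mkseq // => i h.
by rewrite nth_mkseq ?H.
Qed.

Section Omega1.
Context {d : Order.disp_t} {W : orderType d} (W1 : is_omega1 W).

(** Applied to the interiors [U w] of the [O w], whose complements are
    closed and nowhere dense, Cov(K) >= aleph_2 says that aleph_1 many of
    these do not cover the Cantor space. *)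
Lemma baire_W (cov : cov_meager_ge_succ W) (O : W -> set (nat -> bool)) :
  (forall w s, exists t, forall r, extends r (s ++ t) -> O w r) ->
  exists r, forall w, O w r.
Proof.
move=> Od; apply: contrapT => nr.
have [K [W' [[_ Kmin] [nW' _] W'K]]] := cov.
suff /Kmin KW : covers_cantor W by move: nW'; rewrite (card_le_trans W'K KW).
pose U w : set cantor_space := [set r | exists n, forall y : cantor_space, (forall i, (i < n)%N -> y i = r i) -> O w y].
have Uo w : open (U w).
  rewrite openE => x [n nP]; apply: (@cantor_cyl_nbhs x n) => y yx.
  by exists n => z zy; apply: nP => i h; rewrite zy ?yx.
exists (fun w => ~` U w); split=> [w|].
  have cU : closed (~` U w) by apply: open_closedC.
  split=> //; rewrite /nowhere_dense -(closure_id _).1 //.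
  apply/seteqP; split=> // x /cantor_nbhs_cyl[n nP].
  have [t tP] := Od w (mkseq x n).
  pose z i := nth false (mkseq x n ++ t) i.
  have : (~` U w) z.
    by apply: nP => i h; rewrite /z nth_cat size_mkseq h nth_mkseq.
  apply; exists (size (mkseq x n ++ t)) => y yz; apply: tP; apply/extendsP.
  exact: yz.
apply/seteqP; split=> // r _; apply: contrapT => H; apply: nr; exists r => w.
apply: contrapT => nO; apply: H; exists w => // -[n] /(_ r (fun _ _ => erefl)).
exact: nO.
Qed.

(** Missing one given real is a dense open condition, so aleph_1 many reals
    are not all. *)
Lemma cantor_not_embeds (cov : cov_meager_ge_succ W) : ~ embeds (nat -> bool) W.
Proof.
move=> [c cI].
have [|r rP] := @baire_W cov (fun w => [set r | c r <> w]); last exact: (rP (c r)).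
move=> w s; have [[q qs <-]|h] := pselect (exists2 q, extends q s & c q = w).
  exists [:: ~~ q (size s)] => r /extendsP rs /cI E; have := rs (size s).
  by rewrite size_cat addn1 nth_cat ltnn subnn /= E => /(_ (ltnSn _)); case: (q _).
by exists [::] => r; rewrite cats0 => rs E; apply: h; exists r.
Qed.

(** The counterpart for weak diamond of 2^aleph_1 > aleph_1^aleph_0. If [h]
    were determined by a sequence [j h] of ordinals, the set of its values,
    with indices, would be a countable subset of [W]; so [h a] could be
    computed from a bit string of length [a], for all large [a]. This is
    absurd when [h] is the negation of the function that guesses the result. *)
Lemma diamond_not_embeds : weak_diamond_star W -> ~ embeds (W -> bool) (nat -> W).
Proof.
move=> Phi [j jI].
have [c cI] : embeds (nat * W) W.
  apply: embeds_trans (embeds_prod_nat W1); exists (fun p => (p.2, p.1)).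
  by move=> [m x] [n y] [-> ->].
pose codes (h : W -> bool) a (r : below a -> bool) :=
  forall n x, x = j h n <-> exists p : c (n, x) < a, r (exist _ (c (n, x)) p).
have [g gP] := Phi _ (@stationaryT _ _ W1)
  (fun a r => `[< exists2 h, @codes h a r & h a >]).
pose h x := ~~ g (exist _ x (mem_set I)).
pose f (w : W) : bool := `[< exists n, w = c (n, j h n) >].
have [b bP] := seq_bounded W1 (fun n => c (n, j h n)).
have [a [[[a' aP] /= E aa] ba]] := gP f _ (club_gt W1 b).
move: aP E; rewrite aa => aP E.
have hc : @codes h a (restrict_below f (a := a)).
  move=> n x; split=> [->|[p /asboolP[m /cI[-> ->]]] //].
  have p : c (n, j h n) < a by apply: lt_trans (bP n) ba.
  by exists p; apply/asboolP; exists n.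
have : `[< exists2 h, @codes h a (restrict_below f (a := a)) & h a >] = h a.
  apply/asboolP/idP => [[h' h'c h'a]|ha]; last by exists h.
  suff <- : h' = h by [].
  apply: jI; apply/funext => n; apply/(hc n _).2/(h'c n _).1; exact: erefl.
rewrite E /h (_ : exist _ a (mem_set I) = exist _ a aP); last exact: eq_exist.
by case: (g _).
Qed.
End Omega1.

(** * Frames *)

(** What the construction needs from the monster model. [At a s] says that
    the type of [s] is isolated by a formula of the language at [a], and
    then [orb a s] is a code for such a formula, among countably many.
    [aut_ext] is homogeneity for countable sets. [At_amalg] is what density
    of isolated types at a level of [lev] gives: tuples [t] and [u] over [s]
    fit together after a move of [u] over [s]. *)
Record frame d (W : orderType d) := Frame {
  pt : choiceType;
  aut : set (pt -> pt);
  At : W -> seq pt -> Prop;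
  lev : set W;
  orb : W -> seq pt -> nat;
  aut_id : aut id;
  aut_comp : forall s t, aut s -> aut t -> aut (s \o t);
  aut_inv : forall s, aut s -> exists t, [/\ aut t, cancel s t & cancel t s];
  aut_ext : forall (A : set pt) (g : pt -> pt), countable A ->
    (forall s, (forall x, x \in s -> A x) ->
       exists2 t, aut t & map t s = map g s) ->
    exists2 t, aut t & forall x, A x -> t x = g x;
  lev_club : club lev;
  At_nil : forall a, lev a -> At a [::];
  At_sub : forall a s t, At a s -> {subset t <= s} -> At a t;
  At_le : forall a b s, a <= b -> At a s -> At b s;
  At_limit : forall a s, is_limit a -> At a s -> exists2 b, b < a & At b s;
  At_aut : forall a t s, aut t -> At a s -> At a (map t s);
  orb_aut : forall a t s, aut t -> orb a (map t s) = orb a s;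
  orb_inj : forall a s t, At a s -> At a t -> size s = size t ->
    orb a s = orb a t -> exists2 u, aut u & map u s = t;
  At_amalg : forall a s t u, lev a -> At a (s ++ t) -> At a (s ++ u) ->
    exists2 v, aut v & map v s = s /\ At a (s ++ t ++ map v u) }.

Arguments aut {d W} f _.
Arguments At {d W} {f}.
Arguments lev {d W} f _.
Arguments orb {d W} {f}.
Arguments aut_id {d W}.

Section Frame.
Context {d : Order.disp_t} {W : orderType d} (G : frame W).
Notation pt := (pt G).
Notation aut := (aut G).
Implicit Types (s e : seq pt) (A B D : set pt).

Definition fixes (t : pt -> pt) s := {in s, t =1 id}.

Definition inside s D := forall x, x \in s -> D x.

(** Equality of types over a finite tuple [e], and over a set [D]. *)
Definition eqo e x y := exists2 t, aut t & fixes t e /\ map t x = y.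

Definition eqs D x y := forall e, inside e D -> eqo e x y.

Lemma fixes_map t s : fixes t s <-> map t s = s.
Proof. by rewrite -{3}(map_id s); split => [/eq_in_map|/eq_in_map]. Qed.

Lemma fixes_cat t s u : fixes t (s ++ u) <-> fixes t s /\ fixes t u.
Proof.
split=> [h|[h1 h2] x]; last by rewrite mem_cat => /orP[/h1|/h2].
by split=> x xs; apply: h; rewrite mem_cat xs // orbT.
Qed.

Lemma fixes_sub t s u : {subset u <= s} -> fixes t s -> fixes t u.
Proof. by move=> us h x /us/h. Qed.

Lemma fixes_comp t u s : fixes t s -> fixes u s -> fixes (t \o u) s.
Proof. by move=> h k x xs; rewrite /= k // h. Qed.

Lemma fixes_inv t u s : cancel t u -> fixes t s -> fixes u s.
Proof. by move=> tu h x xs; rewrite -{1}(h x xs) tu. Qed.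

Lemma inside_cat s u D : inside (s ++ u) D <-> inside s D /\ inside u D.
Proof.
split=> [h|[h1 h2] x]; last by rewrite mem_cat => /orP[/h1|/h2].
by split=> x xs; apply: h; rewrite mem_cat xs // orbT.
Qed.

Lemma inside_sub s D E : D `<=` E -> inside s D -> inside s E.
Proof. by move=> DE h x /h/DE. Qed.

Lemma inside_nil D : inside [::] D. Proof. by []. Qed.

Lemma inside1 x D : D x -> inside [:: x] D.
Proof. by move=> Dx y; rewrite inE => /eqP->. Qed.

Lemma eqo_refl e x : eqo e x x.
Proof. by exists id; [exact: aut_id|split=> //; rewrite map_id]. Qed.

Lemma eqo_sym e x y : eqo e x y -> eqo e y x.
Proof.
move=> [t ta [te <-]]; have [u [ua tu ut]] := aut_inv ta; exists u => //.
by split; [exact: fixes_inv te|rewrite mapK].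
Qed.

Lemma eqo_trans e x y z : eqo e x y -> eqo e y z -> eqo e x z.
Proof.
move=> [t ta [te <-]] [u ua [ue <-]]; exists (u \o t); first exact: aut_comp.
by split; [exact: fixes_comp|rewrite map_comp].
Qed.

Lemma eqo_sub e e' x y : {subset e' <= e} -> eqo e x y -> eqo e' x y.
Proof. by move=> h [t ta [te <-]]; exists t => //; split=> //; exact: fixes_sub te. Qed.

Lemma eqo_size e x y : eqo e x y -> size x = size y.
Proof. by move=> [t _ [_ <-]]; rewrite size_map. Qed.

Lemma eqo_aut t e x y : aut t -> eqo e x y -> eqo (map t e) (map t x) (map t y).
Proof.
move=> ta [u ua [ue <-]]; have [v [va tv vt]] := aut_inv ta.
exists (t \o u \o v); first by do 2?apply: aut_comp => //.
split; first by move=> _ /mapP[z ze ->] /=; rewrite tv ue.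
by rewrite -!map_comp; apply: eq_map => z /=; rewrite tv.
Qed.

Lemma eqo_autE t e x y : aut t -> eqo (map t e) (map t x) (map t y) <-> eqo e x y.
Proof.
move=> ta; split=> [h|]; last exact: eqo_aut.
have [v [va tv vt]] := aut_inv ta.
by have := eqo_aut va h; rewrite !mapK.
Qed.

Lemma eqo_cat e x y : eqo [::] (e ++ x) (e ++ y) <-> eqo e x y.
Proof.
split=> [] [t ta [te E]]; exists t => //; last first.
  by split=> //; rewrite map_cat E (fixes_map t e).1.
move/eqP: E; rewrite map_cat eqseq_cat ?size_map // => /andP[/eqP h /eqP ->].
by split=> //; apply/fixes_map.
Qed.

Lemma eqo_take e x y n : eqo e x y -> eqo e (take n x) (take n y).
Proof. by move=> [t ta [te <-]]; exists t => //; split=> //; rewrite map_take. Qed.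

Lemma eqs_refl D x : eqs D x x. Proof. by move=> e _; exact: eqo_refl. Qed.
Lemma eqs_sym D x y : eqs D x y -> eqs D y x.
Proof. by move=> h e /h/eqo_sym. Qed.
Lemma eqs_trans D x y z : eqs D x y -> eqs D y z -> eqs D x z.
Proof. by move=> h k e eD; apply: eqo_trans (h e eD) (k e eD). Qed.
Lemma eqs_sub D E x y : D `<=` E -> eqs E x y -> eqs D x y.
Proof. by move=> DE h e eD; apply: h; exact: inside_sub eD. Qed.
Lemma eqs_take D x y n : eqs D x y -> eqs D (take n x) (take n y).
Proof. by move=> h e /h/eqo_take. Qed.
Lemma eqs_autE t D x y : aut t -> eqs (t @` D) (map t x) (map t y) <-> eqs D x y.
Proof.
move=> ta; have [v [va tv vt]] := aut_inv ta; split=> h e eD.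
  apply/(eqo_autE _ _ _ ta)/h => _ /mapP[z /eD Dz ->]; by exists z.
have := h (map v e); rewrite -(eqo_autE _ _ _ ta) (mapK vt); apply.
by move=> _ /mapP[z /eD[z0 Dz <-] ->]; rewrite tv.
Qed.

(** Conditions are lists of tagged points. The points of tag 0, from a base
    that is being extended, stay fixed; in an iteration of extensions the
    points of tag [k.+1] are added at step [k], and for a single extension
    they have tag 1. Points of tag [k] form the block [bk k], and [up k]
    collects the blocks up to this one. *)
Definition act (t : pt -> pt) (w : seq (pt * nat)) := [seq (t p.1, p.2) | p <- w].
Definition els (w : seq (pt * nat)) := [seq p.1 | p <- w].
Definition bk k (w : seq (pt * nat)) := [seq p.1 | p <- w & p.2 == k].
Definition up k (w : seq (pt * nat)) := [seq p.1 | p <- w & (p.2 <= k)%N].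
Definition tags (w : seq (pt * nat)) := [seq p.2 | p <- w].
Definition put k s : seq (pt * nat) := [seq (c, k) | c <- s].
Implicit Types (w p q f : seq (pt * nat)).

Lemma act_cat t p q : act t (p ++ q) = act t p ++ act t q.
Proof. exact: map_cat. Qed.
Lemma act_comp t u p : act (t \o u) p = act t (act u p).
Proof. by rewrite /act -map_comp. Qed.
Lemma act_id p : act id p = p.
Proof. by rewrite -[RHS]map_id; apply: eq_map => -[]. Qed.
Lemma actK t u : cancel t u -> cancel (act t) (act u).
Proof. by move=> tu p; rewrite -act_comp -[RHS]act_id; apply: eq_map => z /=; rewrite tu. Qed.
Lemma els_act t p : els (act t p) = map t (els p).
Proof. by rewrite /els /act -!map_comp. Qed.
Lemma bk_act t k p : bk k (act t p) = map t (bk k p).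
Proof. by rewrite /bk /act filter_map -!map_comp. Qed.
Lemma up_act t k p : up k (act t p) = map t (up k p).
Proof. by rewrite /up /act filter_map -!map_comp. Qed.
Lemma tags_act t p : tags (act t p) = tags p.
Proof. by rewrite /tags /act -map_comp. Qed.
Lemma bk_cat k p q : bk k (p ++ q) = bk k p ++ bk k q.
Proof. by rewrite /bk filter_cat map_cat. Qed.
Lemma up_cat k p q : up k (p ++ q) = up k p ++ up k q.
Proof. by rewrite /up filter_cat map_cat. Qed.
Lemma els_cat p q : els (p ++ q) = els p ++ els q.
Proof. exact: map_cat. Qed.
Lemma bk_put k j s : bk k (put j s) = if j == k then s else [::].
Proof.
rewrite /bk /put filter_map -map_comp /= map_id /preim /=.
by case: eqP => _; [exact: filter_predT|exact: filter_pred0].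
Qed.
Lemma up_put k j s : up k (put j s) = if (j <= k)%N then s else [::].
Proof.
rewrite /up /put filter_map -map_comp /= map_id /preim /=.
by case: (j <= k)%N; [exact: filter_predT|exact: filter_pred0].
Qed.
Lemma els_put k s : els (put k s) = s.
Proof. by rewrite /els /put -map_comp map_id. Qed.
Lemma size_act t p : size (act t p) = size p. Proof. exact: size_map. Qed.
Lemma bk_sub k p : {subset bk k p <= els p}.
Proof. by move=> _ /mapP[z + ->]; rewrite mem_filter => /andP[_ zp]; apply: map_f. Qed.
Lemma bk_up k l p : (k <= l)%N -> {subset bk k p <= up l p}.
Proof.
move=> kl _ /mapP[z + ->]; rewrite mem_filter => /andP[/eqP zk zp].
by apply: map_f; rewrite mem_filter zk kl.
Qed.
Lemma up_up k l p : (k <= l)%N -> {subset up k p <= up l p}.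
Proof.
move=> kl _ /mapP[z + ->]; rewrite mem_filter => /andP[zk zp].
by apply: map_f; rewrite mem_filter (leq_trans zk).
Qed.
Lemma up_all k p : all (fun n => (n <= k)%N) (tags p) -> up k p = els p.
Proof.
move=> /allP h; congr map; apply/all_filterP/allP => z zp.
by apply: h; apply: map_f.
Qed.
Lemma els_tags_eq p q : els p = els q -> tags p = tags q -> p = q.
Proof.
elim: p q => [|[c n] p IH] [|[c' n'] q] //= [-> E1] [-> E2].
by rewrite (IH q).
Qed.
Lemma inside_act_bk0 t p B : fixes t (bk 0 p) -> inside (bk 0 p) B -> inside (bk 0 (act t p)) B.
Proof. by move=> h; rewrite bk_act ((fixes_map _ _).1 h). Qed.

Lemma map_code_inj B (c : pt -> nat) s s' :
  (forall y z, B y -> B z -> c y = c z -> y = z) ->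
  inside s B -> inside s' B -> map c s = map c s' -> s = s'.
Proof.
move=> cI; elim: s s' => [|z s IH] [|y s'] //= sB s'B [h h']; congr cons.
  by apply: cI h; [apply: sB|apply: s'B]; rewrite mem_head.
by apply: IH h' => w ws; [apply: sB|apply: s'B]; rewrite inE ws orbT.
Qed.

Definition cjg p q := exists2 t, aut t & fixes t (bk 0 p) /\ act t p = q.

(** The composites [th n] of the inverses of the moves turn the chain into
    one of prefixes, but displace the points of tag 0. As the displacements
    [th n] agree where they are both relevant, homogeneity for countable
    sets gives one automorphism [v] that undoes all of them. *)
Lemma straighten B (p : nat -> seq (pt * nat)) : countable B ->
  (forall n, inside (bk 0 (p n)) B) ->
  (forall n, exists t f, [/\ aut t, fixes t (bk 0 (p n)) & p n.+1 = act t (p n) ++ f]) ->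
  exists e : nat -> seq (pt * nat), (forall n, cjg (p n) (e n)) /\
    forall n, prefix (e n) (e n.+1).
Proof.
move=> Bc pB /choice_rel[t /choice_rel[f pS]].
have /choice_rel[t' t'P] : forall n, exists u, [/\ aut u, cancel (t n) u & cancel u (t n)].
  by move=> n; apply: aut_inv; case: (pS n).
pose th := fix th n := if n is m.+1 then th m \o t' m else id.
have tha n : aut (th n).
  elim: n => [|n IH] /=; first exact: aut_id.
  by apply: aut_comp => //; case: (t'P n).
have thS n : act (th n.+1) (p n.+1) = act (th n) (p n) ++ act (th n.+1) (f n).
  have [_ _ ->] := pS n; rewrite act_cat /= act_comp (actK (t := t n) (u := t' n)) //.
  by case: (t'P n).
have bS m n : (m <= n)%N -> {subset bk 0 (p m) <= bk 0 (p n)} /\ {in bk 0 (p m), th n =1 th m}.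
  move=> /subnK <-; elim: (n - m)%N => [|k [IH1 IH2]]; first by split.
  rewrite addSn; have [_ fx E] := pS (k + m)%N; split=> [z zm|z zm /=].
    rewrite E bk_cat bk_act ((fixes_map _ _).1 fx) mem_cat.
    by rewrite IH1.
  have [_ c _] := t'P (k + m)%N.
  by rewrite (fixes_inv c fx) ?IH1 ?IH2.
pose Z : set pt := [set z | exists n b, b \in bk 0 (p n) /\ z = th n b].
have /choice_rel[g gP] : forall z, exists b, Z z -> exists n, b \in bk 0 (p n) /\ z = th n b.
  move=> z; have [[n [b h]]|] := pselect (Z z); last by exists z.
  by exists b => _; exists n.
have Zc : countable Z.
  have /countable_sub : Z `<=` \bigcup_n (th n @` B).
    by move=> z [n [b [/pB bB ->]]]; exists n => //; exists b.
  by apply; apply: countable_cup => n; apply: countable_image.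
have gh n b : b \in bk 0 (p n) -> g (th n b) = b.
  move=> bn; have [|m [h E]] := gP (th n b); first by exists n, b.
  have Hb l h' := (bS l (maxn m n) h').2.
  have [u [_ c _]] := aut_inv (tha (maxn m n)).
  apply: (can_inj c); by rewrite (Hb _ (leq_maxl m n)) // (Hb _ (leq_maxr m n)) // -E.
have [v va vP] : exists2 v, aut v & forall z, Z z -> v z = g z.
  apply: aut_ext => // s sZ.
  have [N NP] : exists N, forall z, z \in s -> exists2 b, b \in bk 0 (p N) & z = th N b.
    elim: s sZ => [|z s IH] sZ; first by exists 0%N.
    have [|N NP] := IH; first by move=> y ys; apply: sZ; rewrite inE ys orbT.
    have [n [b [bn E]]] := sZ z (mem_head _ _).
    exists (maxn n N) => y; rewrite inE => /orP[/eqP->|/NP[b' b'N ->]].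
      by exists b; [apply: (bS _ _ (leq_maxl n N)).1|rewrite (bS _ _ (leq_maxl n N)).2].
    by exists b'; [apply: (bS _ _ (leq_maxr n N)).1|rewrite (bS _ _ (leq_maxr n N)).2].
  have [u [ua c _]] := aut_inv (tha N).
  exists u => //; apply/eq_in_map => z /NP[b bN ->]; by rewrite c gh.
exists (fun n => act (v \o th n) (p n)); split=> [n|n].
  exists (v \o th n); first exact: aut_comp.
  by split=> // b bn /=; rewrite vP ?gh //; exists n, b.
by rewrite (act_comp v (th n)) (act_comp v (th n.+1)) thS act_cat prefix_prefix.
Qed.
End Frame.

(** * Generic chains of conditions *)

Section Generic.
Context {d : Order.disp_t} {W : orderType d} (W1 : is_omega1 W)
  (cov : cov_meager_ge_succ W) (G : frame W).
Notation pt := (pt G).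
Notation aut := (aut G).
Implicit Types (s e : seq pt) (A B D : set pt) (w p q f : seq (pt * nat)).

(** A stronger condition may move the points of positive tags before it adds
    new points. *)
Definition extendable p q := exists t f, [/\ aut t, fixes t (bk 0 p) & q = act t p ++ f].

Lemma extendable_cjg p q r : extendable p q -> cjg q r -> extendable p r.
Proof.
move=> [t [f [ta tf ->]]] [u ua [uf <-]].
exists (u \o t), (act u f); split; [exact: aut_comp| |by rewrite (act_comp u t) act_cat].
apply: (fixes_comp _ tf); apply: fixes_sub uf => z zp.
by rewrite bk_cat bk_act ((fixes_map _ _).1 tf) mem_cat zp.
Qed.

Definition cjginv (cond : set (seq (pt * nat))) := forall p q, cjg p q -> cond p -> cond q.

Lemma cjg_orb dl p q : At dl (els p) -> At dl (els q) -> tags p = tags q ->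
  bk 0 p = bk 0 q -> orb dl (els p) = orb dl (els q) -> cjg p q.
Proof.
move=> Ap Aq E1 bE E3; have [|u ua uE] := orb_inj Ap Aq _ E3.
  by have := congr1 size E1; rewrite !size_map.
have aE : act u p = q by apply: els_tags_eq; rewrite ?els_act ?tags_act.
by exists u => //; split=> //; apply/fixes_map; rewrite -bk_act aE.
Qed.

(** Up to conjugacy over the points of tag 0 there are only countably many
    conditions, as these points belong to the countable set [B] and the
    orbit of the whole condition has a code. So a real describes a sequence
    of conditions: a run of bits [false] counts up to the code of a
    condition, and the next bit [true] replaces the current condition by this
    one, if it is stronger. The dense sets of conditions become dense open
    sets of reals, and [baire_W] finds a real that meets aleph_1 many of
    them. *)
Lemma generic B (cond : set (seq (pt * nat))) (dl : W) (I : Type) (Dn : I -> set (seq (pt * nat))) p0 :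
  countable B -> embeds I W ->
  cjginv cond -> (forall p, cond p -> inside (bk 0 p) B) -> (forall p, cond p -> At dl (els p)) ->
  (forall i, cjginv (cond `&` Dn i)) ->
  (forall i p, cond p -> exists q, [/\ extendable p q, cond q & Dn i q]) ->
  cond p0 ->
  exists e : nat -> seq (pt * nat), [/\ cjg p0 (e 0), forall n, cond (e n),
    forall n, prefix (e n) (e n.+1) & forall i, exists n, Dn i (e n)].
Proof.
move=> Bc [ci ciI] Cinv CB CA Dinv Dd C0.
have [c cI] := countable_code Bc.
pose cd p := pickle (tags p, (map c (bk 0 p), orb dl (els p))).
have cdP p q : cond p -> cond q -> cd p = cd q -> cjg p q.
  move=> Cp Cq /(pcan_inj pickleK)[E1 E2 E3]; apply: cjg_orb E3 => //; try exact: CA.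
  exact: map_code_inj cI (CB p Cp) (CB q Cq) E2.
have /choice_rel[rep repP] : forall k, exists p, cond p /\ forall q, cond q -> cd q = k -> cjg q p.
  move=> k; have [[p Cp pk]|h] := pselect (exists2 p, cond p & cd p = k).
    by exists p; split=> // q Cq E; apply: cdP; rewrite // E.
  by exists p0; split=> // q Cq E; case: h; exists q.
pose move_ p k := if pselect (extendable p (rep k)) then rep k else p.
pose step (kp : nat * seq (pt * nat)) (b : bool) :=
  if b then (0%N, move_ kp.2 kp.1) else (kp.1.+1, kp.2).
pose run (s : seq bool) := foldl step (0%N, p0) s.
have moveC p k : cond p -> cond (move_ p k).
  by rewrite /move_; case: pselect => [h _ /=|//]; case: (repP k).
have moveE p k : extendable p (move_ p k).
  rewrite /move_; case: pselect => [//|_ /=]; exists id, [::].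
  by rewrite act_id cats0; split=> //; exact: aut_id.
have runC (s : seq bool) : cond (run s).2.
  suff h (s' : seq bool) kp : cond kp.2 -> cond (foldl step kp s').2 by apply: h.
  elim: s' kp => [//|b s' IH] kp Ck /=.
  by apply: IH; case: b => //=; apply: moveC.
have runF k p n : foldl step (k, p) (nseq n false) = ((k + n)%N, p).
  by elim: n k => [|n IH] k /=; rewrite ?addn0 // IH addSnnS.
pose O (w : W) : set (nat -> bool) := [set r | forall i, ci i = w -> exists n, Dn i (run (mkseq r n)).2].
have [|r rP] := @baire_W _ _ cov O.
  move=> w s; have [[i iw]|h] := pselect (exists i, ci i = w); last first.
    by exists [::] => r _ i iw; case: h; exists i.
  have [q [pq Cq Dq]] := Dd i (run (s ++ [:: true])).2 (runC _).
  have [_ /(_ q Cq erefl) qr] := repP (cd q).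
  (* The first bit resets the counter, and the bits [false] count up to the
     code of [q]. *)
  exists ([:: true] ++ nseq (cd q) false ++ [:: true]) => r rE j /esym E.
  have {E} -> : j = i by apply: ciI; rewrite -E.
  exists (size (s ++ [:: true] ++ nseq (cd q) false ++ [:: true])); rewrite rE.
  rewrite catA /run foldl_cat foldl_cat -/(run _).
  have -> : run (s ++ [:: true]) = (0%N, (run (s ++ [:: true])).2).
    by rewrite /run foldl_cat /=.
  rewrite runF /= add0n /move_; case: pselect => [h /=|[]]; last exact: extendable_cjg qr.
  by have [] := Dinv i q _ qr.
pose p n := (run (mkseq r n)).2.
have pE n : extendable (p n) (p n.+1).
  rewrite /p -[n.+1]addn1 /mkseq iotaD map_cat /= add0n /run foldl_cat /= /step.
  case: (r n) => //=; exists id, [::].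
  by rewrite act_id cats0; split=> //; exact: aut_id.
have [e [ep eS]] := straighten Bc (fun n => CB _ (runC (mkseq r n))) pE.
exists e; split=> //; first exact: (ep 0%N).
  by move=> n; apply: Cinv (ep n) (runC _).
move=> i; have [n Dp] := rP _ i erefl; exists n.
by have [] := Dinv i _ _ (ep n) (conj (runC _) Dp).
Qed.

Lemma cjg_extendable p q : cjg p q -> extendable p q.
Proof. by move=> [t ta [tf <-]]; exists t, [::]; rewrite cats0. Qed.

Lemma extendable_cat p q : extendable p (p ++ q).
Proof.
by exists id, q; rewrite act_id; split=> //; exact: aut_id.
Qed.

Lemma extendable_trans p q r : extendable p q -> extendable q r -> extendable p r.
Proof.
move=> [t [f [ta tf ->]]] [u [g [ua uf ->]]].
exists (u \o t), (act u f ++ g); split; [exact: aut_comp| |].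
  apply: (fixes_comp _ tf); apply: fixes_sub uf => z zp.
  by rewrite bk_cat bk_act ((fixes_map _ _).1 tf) mem_cat zp.
by rewrite (act_comp u t) act_cat catA.
Qed.

Lemma prefix_le (e : nat -> seq (pt * nat)) : (forall n, prefix (e n) (e n.+1)) ->
  forall m n, (m <= n)%N -> prefix (e m) (e n).
Proof.
move=> eS m n /subnK <-; elim: (n - m)%N => [|k IH]; first exact: prefix_refl.
by rewrite addSn; apply: prefix_trans IH (eS _).
Qed.

Lemma take_chain (e : nat -> seq (pt * nat)) k n : (forall n, prefix (e n) (e n.+1)) ->
  (size (e k) <= size (e n))%N -> take (size (e k)) (e n) = e k.
Proof.
move=> eS le; have [/(prefix_le eS)/prefixP[f ->]|/ltnW/(prefix_le eS)/prefixP[f Ef]] := leqP k n.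
  by rewrite take_size_cat.
have f0 : f = [::].
  apply/nilP; rewrite /nilp; move: le.
  by rewrite Ef size_cat /= -[X in (_ <= X)%N]addn0 leq_add2l leqn0.
by rewrite Ef f0 cats0 take_size.
Qed.

(** The generic chain decides each task: it meets [Dn i], or reaches a
    condition below which [Dn i] is empty. So density is required only below
    some member of the chain, and a task may refer to a member of the chain
    as long as its description has aleph_1 many possibilities. *)
Lemma generic_dec B (cond : set (seq (pt * nat))) (dl : W) (I : Type) (Dn : I -> set (seq (pt * nat))) p0 :
  countable B -> embeds I W ->
  cjginv cond -> (forall p, cond p -> inside (bk 0 p) B) -> (forall p, cond p -> At dl (els p)) ->
  (forall i, cjginv (cond `&` Dn i)) ->
  cond p0 ->
  exists e : nat -> seq (pt * nat), [/\ cjg p0 (e 0), forall n, cond (e n),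
    forall n, prefix (e n) (e n.+1) &
    forall i m, (forall p, cond p -> prefix (e m) p ->
       exists q, [/\ extendable p q, cond q & Dn i q]) -> exists n, Dn i (e n)].
Proof.
move=> Bc IW Cinv CB CA Dinv C0.
pose D' i : set (seq (pt * nat)) := [set p | Dn i p \/ forall q, extendable p q -> cond q -> ~ Dn i q].
have [||e [e0 eC eS eD]] := @generic B cond dl I D' p0 Bc IW Cinv CB CA _ _ C0.
- move=> i p q pq [Cp [Dp|nD]]; first by have [? ?] := Dinv i _ _ pq (conj Cp Dp); split=> //; left.
  split; [exact: Cinv pq Cp|right=> r qr]; apply: nD.
  by apply: extendable_trans qr; apply: cjg_extendable.
- move=> i p Cp; have [[q [pq Cq Dq]]|h] := pselect (exists q, [/\ extendable p q, cond q & Dn i q]).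
    by exists q; split=> //; left.
  exists p; split=> //; first by have := extendable_cat p [::]; rewrite cats0.
  by right=> q pq Cq Dq; apply: h; exists q.
exists e; split=> // i m H; have [n [Dn_|nD]] := eD i; first by exists n.
have [|q [pq Cq Dq]] := H (e (maxn m n)) (eC _).
  by apply: (prefix_le eS); exact: leq_maxl.
case: (nD q) => //; have /prefixP[g Eg] := prefix_le eS (leq_maxr m n).
by apply: extendable_trans pq; rewrite Eg; apply: extendable_cat.
Qed.
End Generic.

(** * Bases *)

Section Bases.
Context {d : Order.disp_t} {W : orderType d} (W1 : is_omega1 W)
  (cov : cov_meager_ge_succ W) (G : frame W).
Notation pt := (pt G).
Notation aut := (aut G).
Implicit Types (s : seq pt) (A B D E : set pt) (w p q f : seq (pt * nat)).

Definition atomicAt a D := countable D /\ forall s, inside s D -> At a s.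
Definition atomic D := countable D /\ forall s, inside s D -> exists2 a, lev G a & At a s.

(** The alpha-bases: elementarity for the language at [a] takes the form
    that each one-point type over a tuple of [D], isolated at [a], is
    realised in [D]. *)
Definition base a D := atomicAt a D /\
  forall s z, inside s D -> At a (s ++ [:: z]) -> exists2 z', D z' & eqo s [:: z] [:: z'].

Lemma countable_mem s : countable [set z | z \in s].
Proof. exact/finite_set_countable/finite_seq. Qed.

Lemma lev_gt : forall a, exists2 b, lev G b & a < b.
Proof. by case: (lev_club G). Qed.

Lemma lev_bound (I : Type) (A : set I) (g : I -> W) : countable A ->
  exists2 b, lev G b & forall i, A i -> g i < b.
Proof.
move=> Ac; have [c cP] := countable_bounded W1 (countable_image g Ac).
have [b lb cb] := lev_gt c; exists b => // i Ai; apply: lt_trans cb.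
by apply: cP; exists i.
Qed.

Lemma lists_enum D : countable D -> exists a : nat -> seq pt,
  (forall k, inside (a k) D) /\ forall s, inside s D -> exists k, a k = s.
Proof.
move=> /countable_code[c cI]; have [||a aD aE] := @countable_surj _ [set s | inside s D].
- apply: (@code_countable _ _ (fun s => pickle (map c s))) => s s' sD s'D /(pcan_inj pickleK).
  exact: map_code_inj cI sD s'D.
- by exists [::].
- by exists a.
Qed.

Lemma atomic_lev D : atomic D -> exists2 a, lev G a & atomicAt a D.
Proof.
move=> [Dc DA]; have [l [lD lE]] := lists_enum Dc.
have /choice_rel[a aP] : forall n, exists b, lev G b /\ At b (l n).
  by move=> n; have [b ? ?] := DA _ (lD n); exists b.
have [b lb bP] := @lev_bound nat setT a (countableP _).
exists b => //; split=> // s /lE[n <-].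
by apply: At_le (aP n).2; apply: ltW; exact: bP.
Qed.

Lemma atomicAt_atomic a D : lev G a -> atomicAt a D -> atomic D.
Proof. by move=> la [Dc DA]; split=> // s /DA; exists a. Qed.

Lemma atomicAt_le a b D : a <= b -> atomicAt a D -> atomicAt b D.
Proof. by move=> ab [Dc DA]; split=> // s /DA; apply: At_le. Qed.

Lemma atomicAt_sub a D E : E `<=` D -> atomicAt a D -> atomicAt a E.
Proof.
move=> ED [Dc DA]; split; first exact: countable_sub Dc.
by move=> s sE; apply: DA; apply: inside_sub sE.
Qed.

Lemma atomic_sub D E : E `<=` D -> atomic D -> atomic E.
Proof.
move=> ED [Dc DA]; split; first exact: countable_sub Dc.
by move=> s sE; apply: DA; apply: inside_sub sE.
Qed.

Definition union_els (e : nat -> seq (pt * nat)) : set pt := [set z | exists n, z \in els (e n)].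

Lemma union_els_countable e : countable (union_els e).
Proof.
apply: (@countable_sub _ _ (\bigcup_n [set z | z \in els (e n)])).
  by move=> z [n zn]; exists n.
by apply: countable_cup => n; apply: countable_mem.
Qed.

Lemma prefix_els p q : prefix p q -> {subset els p <= els q}.
Proof. by move=> /prefixP[f ->] z zp; rewrite els_cat mem_cat zp. Qed.

Lemma union_els_fin (e : nat -> seq (pt * nat)) s :
  (forall n, prefix (e n) (e n.+1)) -> inside s (union_els e) ->
  exists n, {subset s <= els (e n)}.
Proof.
move=> eS; elim: s => [|z s IH] h; first by exists 0%N.
have [|n nP] := IH; first by move=> x xs; apply: h; rewrite inE xs orbT.
have [m mP] := h z (mem_head _ _); exists (maxn m n) => x.
rewrite inE => /orP[/eqP->|/nP xn].
  by apply: prefix_els mP; apply: (prefix_le eS); apply: leq_maxl.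
by apply: prefix_els xn; apply: (prefix_le eS); apply: leq_maxr.
Qed.

Lemma els_bk01 p : all (fun n => (n <= 1)%N) (tags p) -> els p =i bk 0 p ++ bk 1 p.
Proof.
move=> /allP h x; rewrite mem_cat; apply/idP/orP => [/mapP[[z n] zp ->] /=|[|]]; try exact: bk_sub.
have : (n <= 1)%N by apply: h; apply/mapP; exists (z, n).
case: n zp => [|[|//]] zp _; [left|right]; apply/mapP.
  by exists (z, 0%N) => //; rewrite mem_filter zp.
by exists (z, 1%N) => //; rewrite mem_filter zp.
Qed.

(** The task to realise a one-point type over the first [i.1] entries;
    together with these, the point has orbit code [i.2]. *)
Definition henkin (dl : W) (i : nat * nat) : set (seq (pt * nat)) :=
  [set p | (i.1 <= size p)%N /\ forall y, At dl (els (take i.1 p) ++ [:: y]) ->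
     orb dl (els (take i.1 p) ++ [:: y]) = i.2 ->
     exists2 z, z \in els p & eqo (els (take i.1 p)) [:: y] [:: z]].

Lemma henkin_cjg dl i p q : cjg p q -> henkin dl i p -> henkin dl i q.
Proof.
move=> [t ta [_ <-]] [ip H]; split; first by rewrite size_act.
have [u [ua tu ut]] := aut_inv ta.
have E : els (take i.1 (act t p)) = map t (els (take i.1 p)).
  by rewrite -els_act /act map_take.
move=> y; rewrite E => Ay oy.
have Eu : els (take i.1 p) ++ [:: u y] = map u (map t (els (take i.1 p)) ++ [:: y]).
  by rewrite map_cat (mapK tu).
have [||z zp ez] := H (u y).
- by rewrite Eu; exact: At_aut.
- by rewrite Eu orb_aut.
- exists (t z); first by rewrite els_act map_f.
  by have := eqo_aut ta ez; rewrite /= ut.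
Qed.

(** A point of the required type over the first [k] entries is moved, by
    amalgamation over these entries, so as to be isolated at [dl] together
    with the whole condition. *)
Lemma henkin_dense dl p k c : lev G dl -> At dl (els p) -> (k <= size p)%N ->
  exists2 q, p = q \/ (exists2 y, At dl (els p ++ [:: y]) & q = p ++ [:: (y, 1%N)]) & henkin dl (k, c) q.
Proof.
move=> ldl Ap kp; set s := els (take k p).
have [[y [Ay oy]]|h] := pselect (exists y, At dl (s ++ [:: y]) /\ orb dl (s ++ [:: y]) = c); last first.
  by exists p; [left|split=> //= y Ay oy; case: h; exists y].
have sp : {subset s <= els p} by move=> x /mapP[z /mem_take zp ->]; apply: map_f.
have [|v va [vs Av]] := @At_amalg _ _ _ dl s (els p) [:: y] ldl _ Ay.
  by apply: At_sub Ap _ => x; rewrite mem_cat => /orP[/sp|].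
exists (p ++ [:: (v y, 1%N)]).
  right; exists (v y) => //; apply: At_sub Av _ => x; rewrite !mem_cat => ->; exact: orbT.
have E : take k (p ++ [:: (v y, 1%N)]) = take k p by rewrite takel_cat.
split; first by rewrite size_cat (leq_trans kp) ?leq_addr.
rewrite /= E -/s => y' Ay' oy'; exists (v y); first by rewrite els_cat mem_cat mem_head orbT.
have [|u ua uE] := orb_inj Ay' Ay _ (etrans oy' (esym oy)); first by rewrite !size_cat.
apply: (@eqo_trans _ _ _ _ _ [:: y]).
  by apply/eqo_cat; exists u.
by exists v => //; split=> //; apply/fixes_map.
Qed.

(** A tuple [s] of the union lies in some [e m]. A point [y] over [s] can be
    amalgamated with [e m] over [s], and the Henkin task for the resulting
    type over [e m] realises it. *)
Lemma henkin_base dl (e : nat -> seq (pt * nat)) : lev G dl ->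
  (forall n, At dl (els (e n))) -> (forall n, prefix (e n) (e n.+1)) ->
  (forall i m, (i.1 = size (e m))%N -> exists n, henkin dl i (e n)) ->
  base dl (union_els e).
Proof.
move=> ldl eA eS eH; split; first split; first exact: union_els_countable.
  by move=> s /(union_els_fin eS)[n nP]; apply: At_sub (eA n) nP.
move=> s y /(union_els_fin eS)[m sm] Ay.
have [|v va [vs Av]] := @At_amalg _ _ _ dl s (els (e m)) [:: y] ldl _ Ay.
  by apply: At_sub (eA m) _ => x; rewrite mem_cat => /orP[/sm|].
have Avy : At dl (els (e m) ++ [:: v y]).
  by apply: At_sub Av _ => x; rewrite !mem_cat => ->; exact: orbT.
have [n [le H]] := eH (size (e m), orb dl (els (e m) ++ [:: v y])) m erefl.
have T : take (size (e m)) (e n) = e m by exact: take_chain.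
rewrite /= T in H; have [z zn ez] := H (v y) Avy erefl; exists z; first by exists n.
apply: (@eqo_trans _ _ _ _ _ [:: v y]); last exact: eqo_sub ez.
by exists v => //; split=> //; apply/fixes_map.
Qed.

(** The generic chain starts from [s] with tag 0 and [x] with tag 1, and is
    subject to the tasks of containing each point of [E], with tag 0, and to
    the Henkin tasks. Thus [E] is contained in the union while [x] is moved
    over [s]. *)
Lemma base_embed a E s x : lev G a -> atomicAt a E -> inside s E -> At a (s ++ x) ->
  exists x' D, [/\ eqo s x x', base a D, E `<=` D & inside x' D].
Proof.
move=> la [Ec EA] sE Asx.
pose cond p := [/\ inside (bk 0 p) E, all (fun n => (n <= 1)%N) (tags p) & At a (els p)].
pose Dn (i : {z | E z} + nat * nat) : set (seq (pt * nat)) :=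
  match i with inl z => [set p | (sval z, 0%N) \in p] | inr i => henkin a i end.
pose p0 := put 0 s ++ put 1 x.
have IW : embeds ({z | E z} + nat * nat) W.
  by apply: (embeds_either W1); [exact: (embeds_set W1)|exact: (embeds_count W1)].
have Cinv : cjginv cond.
  move=> p _ [t ta [tf <-]] [pE pt_ pA]; split; first exact: inside_act_bk0.
    by rewrite tags_act.
  by rewrite els_act; apply: At_aut.
have [||||e [e0 eC eS eD]] := @generic_dec _ _ cov G E cond a _ Dn p0 Ec IW Cinv.
- by move=> p [].
- by move=> p [].
- case=> [z|i] p q pq [Cp Dp]; split; try exact: Cinv pq Cp.
    case: pq => t ta [tf <-]; apply/mapP; exists (sval z, 0%N) => //=.
    by congr pair; rewrite tf //; apply/mapP; exists (sval z, 0%N) => //; rewrite mem_filter.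
  exact: henkin_cjg pq Dp.
- split; rewrite /p0.
  + by rewrite bk_cat !bk_put /= cats0.
  + by rewrite /tags map_cat all_cat; apply/andP; split; apply/allP => n /mapP[_ /mapP[z _ ->] ->].
  + by rewrite els_cat !els_put.
case: e0 => t ta [tf e0].
exists (map t x), (union_els e); split.
- exists t => //; split=> //; move: tf; by rewrite /p0 bk_cat !bk_put /= cats0.
- apply: henkin_base => //; first by move=> n; case: (eC n).
  move=> [k c] m /= km; apply: (eD (inr (k, c)) m) => p Cp /size_prefix mp.
  have [pB pt_ pA] := Cp.
  have [|q [<-|[y Ay ->]] Hq] := @henkin_dense a p k c la pA; first by rewrite km.
    by exists p; split=> //; have := extendable_cat p [::]; rewrite cats0.
  exists (p ++ [:: (y, 1%N)]); split=> //; first exact: extendable_cat.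
  split; first by rewrite bk_cat cats0.
    by rewrite /tags map_cat all_cat pt_.
  by rewrite els_cat.
- move=> z Ez; have [|n zn] := eD (inl (exist _ z Ez)) 0%N; last first.
    by exists n; apply/mapP; exists (z, 0%N).
  move=> p [pB pt_ pA] _.
  have [||v va [vs Av]] := @At_amalg _ _ _ a (bk 0 p) [:: z] (bk 1 p) la.
  + by apply: EA; apply/inside_cat; split=> //; exact: inside1.
  + by apply: At_sub pA _ => y; rewrite (els_bk01 pt_).
  exists (act v p ++ [:: (z, 0%N)]); split.
  + by exists v, [:: (z, 0%N)]; split=> //; apply/fixes_map.
  + split.
    * rewrite bk_cat /bk /=; apply/inside_cat; split; last exact: inside1.
      by apply: inside_act_bk0 => //; apply/fixes_map.
    * by rewrite /tags map_cat all_cat /= andbT; have := pt_; rewrite -(tags_act v).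
    * apply: At_sub Av _ => y; rewrite els_cat !mem_cat els_act => /orP[|->]; last by rewrite orbT.
      move=> /mapP[y' + ->]; rewrite els_bk01 // mem_cat => /orP[h|h].
        by rewrite (fixes_map v (bk 0 p)).2 ?h.
      by rewrite (map_f v h) !orbT.
  + by rewrite /Dn /= mem_cat mem_head orbT.
- move=> z zx; exists 0%N; rewrite -e0 /p0 els_act els_cat !els_put map_cat mem_cat.
  by rewrite zx orbT.
Qed.

Lemma base_ext a E : lev G a -> atomicAt a E -> exists2 D, base a D & E `<=` D.
Proof.
move=> la EA; have [|x' [D [_ bD ED _]]] := @base_embed a E [::] [::] la EA (@inside_nil _ _ _ E).
  exact: At_nil.
by exists D.
Qed.

Lemma atomic_ext E s x : atomic E -> inside s E -> (exists2 a, lev G a & At a (s ++ x)) ->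
  exists x', eqo s x x' /\ atomic (E `|` [set z | z \in x']).
Proof.
move=> /atomic_lev[a la EA] sE [b lb bA].
have [c lc cP] := @lev_bound bool setT (fun i => if i then a else b) (countableP _).
have [x' [D [ex [DA _] ED xD]]] := @base_embed c E s x lc
  (atomicAt_le (ltW (cP true I)) EA) sE (At_le (ltW (cP false I)) bA).
exists x'; split=> //; apply: (atomicAt_atomic lc); apply: atomicAt_sub DA.
by move=> z [/ED//|/xD].
Qed.

Lemma base_union a D : countable D -> (forall s, inside s D -> At a s) ->
  (forall s z, inside s D -> At a (s ++ [:: z]) -> exists b D',
     [/\ base b D', D' `<=` D, inside s D' & At b (s ++ [:: z])]) -> base a D.
Proof.
move=> Dc DA H; split=> // s z sD Az; have [b [D' [[_ bD'] D'D sD' Bz]]] := H s z sD Az.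
by have [z' /D'D ? ?] := bD' s z sD' Bz; exists z'.
Qed.
End Bases.

(** * Uniqueness of bases *)

Section Conjugacy.
Context {d : Order.disp_t} {W : orderType d} (W1 : is_omega1 W) (G : frame W).
Notation pt := (pt G).
Notation aut := (aut G).
Implicit Types (s e : seq pt) (A B D E M N : set pt).

Definition eqv s e := eqo [::] s e.

Lemma eqvP s e : eqv s e <-> exists2 t, aut t & map t s = e.
Proof. by split=> [[t ta [_ E]]|[t ta E]]; exists t. Qed.

Definition tp_map M (h : pt -> pt) := forall s, inside s M -> eqv s (map h s).

Definition tp_iso M N h k :=
  [/\ forall z, M z -> N (h z), forall z, N z -> M (k z), {in M, cancel h k},
      {in N, cancel k h} & tp_map M h].

Lemma tp_iso_sym M N h k : tp_iso M N h k -> tp_iso N M k h.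
Proof.
move=> [h1 h2 h3 h4 h5]; split=> // s sN; apply: eqo_sym.
have {2}-> : s = map h (map k s).
  rewrite -map_comp -[LHS]map_id; apply/eq_in_map => z /sN Nz /=; by rewrite h4 ?inE.
by apply: h5 => _ /mapP[z /sN Nz ->]; apply: h2.
Qed.

Lemma tp_iso_trans M N P h k h' k' : tp_iso M N h k -> tp_iso N P h' k' ->
  tp_iso M P (h' \o h) (k \o k').
Proof.
move=> [h1 h2 h3 h4 h5] [g1 g2 g3 g4 g5]; split.
- by move=> z /h1/g1.
- by move=> z /g2/h2.
- by move=> z; rewrite inE => Mz /=; rewrite g3 ?inE ?h3 ?inE //; exact: h1.
- by move=> z; rewrite inE => Mz /=; rewrite h4 ?inE ?g4 ?inE //; exact: g2.
- move=> s sM; apply: eqo_trans (h5 s sM) _; rewrite map_comp; apply: g5.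
  by move=> _ /mapP[z /sM Mz ->]; apply: h1.
Qed.

Lemma tp_iso_id M : tp_iso M M id id.
Proof. by split=> // s _; rewrite map_id; apply: eqo_refl. Qed.

Lemma tp_map_aut A h : countable A -> tp_map A h -> exists2 t, aut t & forall z, A z -> t z = h z.
Proof. by move=> Ac Ah; apply: aut_ext => // s /Ah/eqvP. Qed.

Lemma tp_iso_on M N P h k : P `<=` M -> tp_iso M N h k -> tp_map P h.
Proof. by move=> PM [_ _ _ _ H] s sP; apply: H; exact: inside_sub sP. Qed.

(** Back and forth between two bases of one level gives a type-preserving
    bijection [g], which is induced by an automorphism because the bases are
    countable. *)
Lemma base_conj a D D' s s' : base a D -> base a D' -> inside s D -> inside s' D' -> eqv s s' ->
  exists2 t, aut t & (t @` D = D' /\ map t s = s').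
Proof.
move=> bD bD' sD sD' ss'.
have one D1 D2 x y z : base a D1 -> base a D2 -> inside x D1 -> inside y D2 -> eqv x y -> D1 z ->
    exists2 z', D2 z' & eqv (x ++ [:: z]) (y ++ [:: z']).
  move=> b1 b2 xD yD /eqvP[t ta tx] Dz.
  have Ax : At a (y ++ [:: t z]).
    have -> : y ++ [:: t z] = map t (x ++ [:: z]) by rewrite map_cat tx.
    by apply: At_aut => //; apply: b1.1.2; apply/inside_cat; split=> //; exact: inside1.
  have [z' Dz' ez] := b2.2 y (t z) yD Ax; exists z' => //.
  apply: (@eqo_trans _ _ _ _ _ (y ++ [:: t z])); last by apply/eqo_cat.
  by apply/eqvP; exists t => //; rewrite map_cat tx.
pose ok (p : seq pt * seq pt) := [/\ inside p.1 D, inside p.2 D' & eqv p.1 p.2].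
have [c cI] := countable_code bD.1.1; have [c' cI'] := countable_code bD'.1.1.
have /choice_rel[st stP] : forall np : nat * (seq pt * seq pt), exists q, ok np.2 ->
   [/\ ok q, exists u u', [/\ size u = size u', q.1 = np.2.1 ++ u & q.2 = np.2.2 ++ u'],
    forall z, D z -> c z = np.1 -> z \in q.1 & forall z, D' z -> c' z = np.1 -> z \in q.2].
  move=> [n [x y]] /=; have [/= [xD yD xy]|h] := pselect (ok (x, y)); last by exists (x, y).
  have [x1 [y1 [x1D y1D xy1 E1 z1]]] : exists x1 y1, [/\ inside x1 D, inside y1 D', eqv x1 y1,
     exists u u', [/\ size u = size u', x1 = x ++ u & y1 = y ++ u'] & forall z, D z -> c z = n -> z \in x1].
    have [[z [Dz zn]]|h] := pselect (exists z, D z /\ c z = n); last first.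
      exists x, y; split=> //; first by exists [::], [::]; rewrite !cats0.
      by move=> z Dz zn; case: h; exists z.
    have [z' Dz' e] := one D D' x y z bD bD' xD yD xy Dz.
    exists (x ++ [:: z]), (y ++ [:: z']); split=> //.
    - by apply/inside_cat; split=> //; exact: inside1.
    - by apply/inside_cat; split=> //; exact: inside1.
    - by exists [:: z], [:: z'].
    - by move=> z0 Dz0 z0n; rewrite (cI z0 z Dz0 Dz) ?zn // mem_cat mem_head orbT.
  have [[z [Dz zn]]|h] := pselect (exists z, D' z /\ c' z = n); last first.
    exists (x1, y1); split=> // z Dz zn; case: h; exists z; by [].
  have [z' Dz' e] := one D' D y1 x1 z bD' bD y1D x1D (eqo_sym xy1) Dz.
  exists (x1 ++ [:: z'], y1 ++ [:: z]) => _; split=> /=.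
  - split=> /=; try by apply/inside_cat; split=> //; exact: inside1.
    exact: eqo_sym.
  - have [u [u' [su -> ->]]] := E1; exists (u ++ [:: z']), (u' ++ [:: z]).
    by rewrite !catA !size_cat su.
  - by move=> z0 Dz0 z0n; rewrite mem_cat z1.
  - by move=> z0 Dz0 z0n; rewrite (cI' z0 z Dz0 Dz) ?zn // mem_cat mem_head orbT.
pose ch := fix ch n := if n is m.+1 then st (m, ch m) else (s, s').
have chok n : ok (ch n) by elim: n => [//|n IH]; have [] := stP (n, ch n) IH.
have chS n : exists u u', [/\ size u = size u', (ch n.+1).1 = (ch n).1 ++ u & (ch n.+1).2 = (ch n).2 ++ u'].
  by have [] := stP (n, ch n) (chok n).
have chm m n : (m <= n)%N -> exists u u', [/\ size u = size u', (ch n).1 = (ch m).1 ++ u & (ch n).2 = (ch m).2 ++ u'].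
  move=> /subnK <-; elim: (n - m)%N => [|k [u [u' [E E1 E2]]]].
    by exists [::], [::]; rewrite !cats0.
  have [v [v' [F F1 F2]]] := chS (k + m)%N.
  by exists (u ++ v), (u' ++ v'); rewrite addSn F1 F2 E1 E2 !catA !size_cat E F.
have chsz n : size (ch n).1 = size (ch n).2 by have [_ _ /eqo_size] := chok n.
(* The graph of the bijection: all automorphisms that realise one stage
   agree on the points of the earlier stages. *)
pose R z z' := exists n t, [/\ aut t, map t (ch n).1 = (ch n).2, z \in (ch n).1 & z' = t z].
have Rfun n t z z' : aut t -> map t (ch n).1 = (ch n).2 -> z \in (ch n).1 -> R z z' -> z' = t z.
  move=> ta tn zn [m [u [ua um zm ->]]].
  have big (k l : nat) v v' : (k <= l)%N -> map v (ch k).1 = (ch k).2 -> map v' (ch l).1 = (ch l).2 ->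
      {in (ch k).1, v =1 v'}.
    move=> kl E1 E2; apply/eq_in_map; rewrite E1.
    have [w [w' [sw F1 F2]]] := chm k l kl; move: E2; rewrite F1 F2 map_cat.
    by move/eqP; rewrite eqseq_cat ?size_map ?chsz // => /andP[/eqP -> _].
  by have [mn|/ltnW nm] := leqP m n; [apply: (big m n)|apply/esym/(big n m)].
have Rex z : D z -> exists z', R z z'.
  move=> Dz; have [_ _ h _] := stP (c z, ch (c z)) (chok _).
  have [_ _ /eqvP[t ta tE]] := chok (c z).+1.
  by exists (t z), (c z).+1, t; split=> //; apply: h.
have /choice_rel[g gP] : forall z, exists z', D z -> R z z'.
  by move=> z; have [/Rex[z' ?]|] := pselect (D z); [exists z'|exists z].
have gn n t : aut t -> map t (ch n).1 = (ch n).2 -> {in (ch n).1, g =1 t}.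
  move=> ta tn z zn; have [h _ _] := chok n; exact: Rfun ta tn zn (gP z (h z zn)).
have [t ta tP] : exists2 t, aut t & forall z, D z -> t z = g z.
  apply: aut_ext; first exact: bD.1.1.
  move=> x xD.
  have [n xn] : exists n, {subset x <= (ch n).1}.
    elim: x xD => [|z x IH] xD; first by exists 0%N.
    have [|n nP] := IH; first by move=> y yx; apply: xD; rewrite inE yx orbT.
    have Dz : D z by apply: xD; rewrite mem_head.
    have [_ _ h _] := stP (c z, ch (c z)) (chok _).
    exists (maxn n (c z).+1) => y; rewrite inE => /orP[/eqP->|/nP yn].
      have [u [u' [_ -> _]]] := chm _ _ (leq_maxr n (c z).+1).
      by rewrite mem_cat h.
    by have [u [u' [_ -> _]]] := chm _ _ (leq_maxl n (c z).+1); rewrite mem_cat yn.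
  have [_ _ /eqvP[u ua uE]] := chok n; exists u => //.
  by apply/eq_in_map => z /xn zn; rewrite (gn n u).
have tn n : map t (ch n).1 = (ch n).2.
  have [h _ /eqvP[u ua uE]] := chok n; rewrite -uE; apply/eq_in_map => z zn.
  by rewrite tP ?(gn n u) //; exact: h.
exists t => //; split; last exact: (tn 0%N).
apply/seteqP; split=> [_ [z Dz <-]|z' Dz'].
  have [_ _ h _] := stP (c z, ch (c z)) (chok _); have [_ h' _] := chok (c z).+1.
  by apply: h'; rewrite -tn; apply: map_f; apply: h.
have [_ _ _ h] := stP (c' z', ch (c' z')) (chok _); have [h' _ _] := chok (c' z').+1.
have : z' \in (ch (c' z').+1).2 by apply: h.
by rewrite -tn => /mapP[z /h' Dz ->]; exists z.
Qed.
End Conjugacy.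

(** * Trees of states *)

Section Tree.
Context {d : Order.disp_t} {W : orderType d} (W1 : is_omega1 W) (G : frame W).
Notation pt := (pt G).
Notation aut := (aut G).

(** A node of a tree of models: a base [bas] of level [lv] and promises [(A,
    x)] in [prm] that the type of [x] over [A] will never be realised. *)
Record state := State { lv : W; bas : set pt; prm : set (set pt * seq pt) }.
Implicit Types (s t : state) (F : set state) (f g : W -> bool).

Definition sle s t := [/\ lv s <= lv t, bas s `<=` bas t & prm s `<=` prm t].

Lemma sle_refl s : sle s s. Proof. by split. Qed.
Lemma sle_trans s t u : sle s t -> sle t u -> sle s u.
Proof.
move=> [h1 h2 h3] [k1 k2 k3]; split; [exact: le_trans h1 k1|exact: subset_trans h2 k2|].
exact: subset_trans h3 k3.
Qed.

Definition lubW (A : set W) : W :=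
  if pselect (exists b, forall a, A a -> a <= b) is left h
  then projT1 (cid (W_lub W1 h)) else w0 W1.

Lemma lubW_ub A a : countable A -> A a -> a <= lubW A.
Proof.
move=> /(countable_bounded W1)[b bP] Aa; rewrite /lubW; case: pselect => [h|[]].
  by case: cid => l [/= h1 _]; apply: h1.
by exists b => c /bP/ltW.
Qed.

Lemma lubW_least A b : (forall a, A a -> a <= b) -> lubW A <= b.
Proof.
move=> Ab; rewrite /lubW; case: pselect => [h|[]]; last by exists b.
by case: cid => l [/= _ h2]; apply: h2.
Qed.

Lemma lubW_lt A b : b < lubW A -> exists2 a, A a & b < a.
Proof.
move=> bA; apply: contrapT => H; move: bA; rewrite ltNge => /negP; apply.
apply: lubW_least => a Aa; rewrite leNgt; apply/negP => ba; apply: H; by exists a.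
Qed.

Definition ssup F := State (lubW (lv @` F)) (\bigcup_(s in F) bas s) (\bigcup_(s in F) prm s).

Lemma ssup_ub F s : countable F -> F s -> sle s (ssup F).
Proof.
move=> Fc Fs; split=> /=; [|by move=> z bz; exists s..].
by apply: lubW_ub; [exact: countable_image|exists s].
Qed.

(** [class_sup] continues a branch at limit stages; [class_grow] makes its
    union uncountable and its levels unbounded. *)
Record state_class (V : set state) : Prop := StateClass {
  class_base : forall s, V s -> lev G (lv s) /\ base (lv s) (bas s);
  class_sup : forall F, F !=set0 -> countable F -> F `<=` V -> total_on F sle -> V (ssup F);
  class_grow : forall s a, V s -> exists t, [/\ V t, sle s t, a < lv t & exists2 z, bas t z & ~ bas s z] }.

Definition realised_in t A (x : seq pt) := exists2 y, inside y (bas t) & eqs A y x.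

(** The unions along branches of trees. In the monster model these are
    atomic elementary submodels of size aleph_1. *)
Definition rich_model (M : set pt) :=
  [/\ embeds {z | M z} W, embeds W {z | M z} &
      forall D, countable D -> D `<=` M -> forall a, exists b E,
        [/\ a < b, lev G b, base b E, E `<=` M & D `<=` E]].

Context (V : set state) (VP : state_class V) (s0 : state) (V0 : V s0)
  (step : W -> (W -> state) -> state -> bool -> state)
  (stepP : forall b h s i, V s -> sle s0 s -> V (step b h s i) /\ sle s (step b h s i)).

Definition grown a s t := [/\ V t, sle s t, a < lv t & exists2 z, bas t z & ~ bas s z].

Definition grow a s : state :=
  if pselect (exists t, grown a s t) is left h then projT1 (cid h) else s.

Lemma growP a s : V s -> grown a s (grow a s).
Proof.
move=> /(class_grow VP a) h; rewrite /grow; case: pselect => // h'.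
by case: cid.
Qed.

Definition before (h : W -> state) b := ssup ([set s0] `|` h @` [set a | a < b]).

(** At stage [b] the union of the earlier nodes is extended by [step], which
    may consult the history and the bit [f b], and then by [grow]. *)
Definition node f := wrec W1 s0 (fun b h => grow b (step b h (before h b) (f b))).
Definition cut f b := fun a => if a < b then node f a else s0.
Definition trunk f b := before (node f) b.

Lemma before_loc h h' b : (forall a, a < b -> h a = h' a) -> before h b = before h' b.
Proof.
move=> hh; rewrite /before; congr (ssup (_ `|` _)); apply/seteqP; split=> _ [a ab <-].
  by exists a => //; rewrite hh.
by exists a => //; rewrite hh.
Qed.

Lemma nodeE f b : node f b = grow b (step b (cut f b) (trunk f b) (f b)).
Proof.
rewrite /node wrecE -/(node f) /trunk; congr (grow _ (step _ _ _ _)).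
by apply: before_loc => a ab; rewrite ab.
Qed.

Lemma trunk_count f b : countable ([set s0] `|` node f @` [set a | a < b]).
Proof.
apply: countable_setU; first exact: countable1.
by apply: countable_image; exact: below_countable.
Qed.

Lemma trunk0 f b : sle s0 (trunk f b).
Proof. by apply: ssup_ub; [exact: trunk_count|left]. Qed.

Lemma node_trunk f a b : a < b -> sle (node f a) (trunk f b).
Proof. by move=> ab; apply: ssup_ub; [exact: trunk_count|right; exists a]. Qed.

Lemma node_ok f b : [/\ V (trunk f b), V (node f b) & forall a, a < b -> sle (node f a) (node f b)].
Proof.
elim/(W_ind W1): b => b IH.
have Vt : V (trunk f b).
  apply: (class_sup VP); [by exists s0; left|exact: trunk_count| |].
    by move=> s [->|[a ab <-]] //; have [] := IH a ab.
  have le0 a : a < b -> sle s0 (node f a).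
    move=> ab; have [Vt _ _] := IH a ab; apply: sle_trans (trunk0 f a) _; rewrite nodeE.
    have [h1 h2] := stepP a (cut f a) (f a) Vt (trunk0 f a).
    by apply: sle_trans h2 _; have [] := growP a h1.
  move=> s t [->|[a ab <-]] [->|[c cb <-]]; [by left; exact: sle_refl|by left; exact: le0|by right; exact: le0|].
  have [ac|ca|->] := ltgtP a c; [left|right|by left; exact: sle_refl].
    by have [_ _ H] := IH c cb; apply: H.
  by have [_ _ H] := IH a ab; apply: H.
have [h1 h2] := stepP b (cut f b) (f b) Vt (trunk0 f b).
have [g1 g2 _ _] := growP b h1; rewrite nodeE; split=> // a ab.
by apply: sle_trans (node_trunk f ab) (sle_trans h2 g2).
Qed.

Lemma V_trunk f b : V (trunk f b). Proof. by case: (node_ok f b). Qed.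
Lemma V_node f b : V (node f b). Proof. by case: (node_ok f b). Qed.

Lemma V_step f b : V (step b (cut f b) (trunk f b) (f b)).
Proof. by have [] := stepP b (cut f b) (f b) (V_trunk f b) (trunk0 f b). Qed.

Lemma trunk_step f b : sle (trunk f b) (step b (cut f b) (trunk f b) (f b)).
Proof. by have [] := stepP b (cut f b) (f b) (V_trunk f b) (trunk0 f b). Qed.

Lemma node_grown f b : grown b (step b (cut f b) (trunk f b) (f b)) (node f b).
Proof. by rewrite nodeE; apply: growP; apply: V_step. Qed.

Lemma step_node f b : sle (step b (cut f b) (trunk f b) (f b)) (node f b).
Proof. by case: (node_grown f b). Qed.

Lemma node_le f a b : a <= b -> sle (node f a) (node f b).
Proof.
rewrite le_eqVlt => /orP[/eqP->|]; first exact: sle_refl.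
by have [_ _ H] := node_ok f b; apply: H.
Qed.

Lemma node_lv f b : b < lv (node f b). Proof. by case: (node_grown f b). Qed.

Lemma node_new f b : exists2 z, bas (node f b) z & ~ bas (trunk f b) z.
Proof.
have [_ _ _ [z bz nz]] := node_grown f b; exists z => //.
by have [_ h _] := trunk_step f b => /h.
Qed.

Lemma node_loc f g b : (forall a, a <= b -> f a = g a) -> node f b = node g b.
Proof.
elim/(W_ind W1): b => b IH H.
have E a : a < b -> node f a = node g a.
  move=> ab; apply: IH => // c ca; apply: H; apply: le_trans ca (ltW ab).
rewrite !nodeE /trunk (before_loc E) H //; congr (grow _ (step _ _ _ _)).
by apply/funext => a; rewrite /cut; case: ifP => // /E.
Qed.

Lemma trunk_loc f g b : (forall a, a < b -> f a = g a) -> trunk f b = trunk g b.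
Proof.
move=> H; apply: before_loc => a ab; apply: node_loc => c ca; apply: H.
exact: le_lt_trans ab.
Qed.

Definition model f := \bigcup_b bas (node f b).

Lemma model_bounded f (D : set pt) : countable D -> D `<=` model f ->
  forall a, exists2 b, a < b & D `<=` bas (node f b).
Proof.
move=> Dc DM a.
have /choice_rel[i iP] : forall z, exists b, D z -> bas (node f b) z.
  by move=> z; have [/DM[b _ ?]|] := pselect (D z); [exists b|exists a].
have [b bP] := countable_bounded W1 (countable_setU (countable1 a) (countable_image i Dc)).
exists b; first by apply: bP; left.
move=> z Dz; have [_ h _] := @node_le f (i z) b (ltW (bP _ (or_intror (ex_intro2 _ _ z Dz erefl)))).
by apply: h; apply: iP.
Qed.

Lemma rich_node f : rich_model (model f).
Proof.
split.
- apply: embeds_trans (embeds_prod_nat W1).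
  have /choice_rel[i iP] : forall z : {z | model f z}, exists b, bas (node f b) (sval z).
    by move=> z; have [b _ ?] := svalP z; exists b.
  have /choice_rel[c cP] : forall b, exists c : pt -> nat, forall x y, bas (node f b) x -> bas (node f b) y -> c x = c y -> x = y.
    by move=> b; apply: countable_code; have [_ [[]]] := class_base VP (V_node f b).
  exists (fun z => (i z, c (i z) (sval z))) => x y [E Ec].
  have : sval x = sval y.
    by apply: (cP (i x)); [exact: iP|rewrite E; exact: iP|rewrite Ec E].
  by case: x y {E Ec} => [x px] [y py] /= E; apply: eq_exist.
- have /choice_rel[z zP] : forall b, exists z, bas (node f b) z /\ ~ bas (trunk f b) z.
    by move=> b; have [z ? ?] := node_new f b; exists z.
  have zM b : model f (z b) by exists b => //; case: (zP b).
  exists (fun b => exist _ (z b) (zM b)) => a b [E].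
  have [ab|ba|//] := ltgtP a b.
    have [_ []] := zP b; have [_ h _] := node_trunk f ab; rewrite -E; apply: h.
    by case: (zP a).
  have [_ []] := zP a; have [_ h _] := node_trunk f ba; rewrite E; apply: h.
  by case: (zP b).
- move=> D Dc DM a; have [b ab Db] := model_bounded Dc DM a.
  have [lb bb] := class_base VP (V_node f b).
  exists (lv (node f b)), (bas (node f b)); split=> //.
    exact: lt_trans (node_lv f b).
  by move=> z bz; exists b.
Qed.

Lemma realised_model f A x : (exists2 y, inside y (model f) & eqs A y x) <->
  exists b, realised_in (node f b) A x.
Proof.
split=> [[y yM yx]|[b [y yb yx]]]; last by exists y => // z /yb ?; exists b.
have [b _ h] := @model_bounded f [set z | z \in y] (countable_mem y) yM (w0 W1).
by exists b, y => // z /h.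
Qed.

Lemma realised_le s t A x : sle s t -> realised_in s A x -> realised_in t A x.
Proof. by move=> [_ h _] [y ys yx]; exists y => // z /ys/h. Qed.
End Tree.

(** * Counting up to isomorphism over a countable set *)

Section Counting.
Context {d : Order.disp_t} {W : orderType d} (W1 : is_omega1 W) (G : frame W).
Notation pt := (pt G).
Notation aut := (aut G).
Implicit Types (s t : state G) (f g : W -> bool) (A M : set pt).

Definition many_models := exists M : (W -> bool) -> set pt,
  (forall f, rich_model (M f)) /\ forall f g, f <> g -> forall h k, ~ tp_iso (M f) (M g) h k.

(** A function [f] is determined by the representative of the class of [M f]
    and by the images of the points of [A] in the representative, so there
    are at most aleph_1^aleph_0 functions for each class. As 2^aleph_1
    exceeds aleph_1^aleph_0, there are 2^aleph_1 classes
    ([embeds_prod_absorb]). *)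
Lemma many_models_over A (M : (W -> bool) -> set pt) : weak_diamond_star W ->
  countable A -> (forall f, A `<=` M f) -> (forall f, rich_model (M f)) ->
  (forall f g h k, tp_iso (M f) (M g) h k -> (forall z, A z -> h z = z) -> f = g) ->
  many_models.
Proof.
move=> Phi Ac AM Mr Mn.
pose E f := [set g | exists h k, tp_iso (M f) (M g) h k].
pose rep f : W -> bool := if pselect (E f !=set0) is left h then projT1 (cid h) else f.
have repE f : E f (rep f).
  rewrite /rep; case: pselect => [h|[]]; first by case: cid.
  by exists f, id, id; exact: tp_iso_id.
have repP f g : E f g -> rep f = rep g.
  move=> [h [k fg]]; have EE : E f = E g.
    apply/seteqP; split=> r [h' [k' i]].
      by exists (h' \o k), (h \o k'); apply: tp_iso_trans i; exact: tp_iso_sym.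
    by exists (h' \o h), (k \o k'); apply: tp_iso_trans i.
  rewrite /rep EE; case: pselect => // -[]; exists g, id, id; exact: tp_iso_id.
have [z0] : inhabited pt by have [_ [i _] _] := Mr (fun=> true); constructor; exact: (sval (i (w0 W1))).
have [|e _ eP'] := countable_surj (countable_setU (countable1 z0) Ac); first by exists z0; left.
have eP z : A z -> exists n, e n = z by move=> Az; apply: eP'; right.
have /choice_rel[c cI] : forall f, exists c : pt -> W, forall x y, M f x -> M f y -> c x = c y -> x = y.
  move=> f; have [[c cI] _ _] := Mr f.
  exists (fun z => if pselect (M f z) is left h then c (exist _ z h) else w0 W1) => x y Mx My.
  by case: pselect => // hx; case: pselect => // hy /cI[].
have /choice_rel[h hP] : forall f, exists h, exists k, tp_iso (M f) (M (rep f)) h k.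
  by move=> f; apply: repE.
have DTR : embeds (W -> bool) ({f | rep f = f} * (nat -> W)).
  have rr f : rep (rep f) = rep f by apply/esym/repP/repE.
  exists (fun f => (exist (fun f => rep f = f) (rep f) (rr f), fun n => c (rep f) (h f (e n)))) => f g [Er Ec].
  have [k hk] := hP f; have [k' hk'] := hP g.
  rewrite -Er in hk' Ec; apply: (Mn _ _ (k' \o h f) (k \o h g)).
    by apply: tp_iso_trans hk _; exact: tp_iso_sym.
  move=> z Az /=; have [n nz] := eP z Az; have En := congr1 (fun r => r n) Ec.
  have [a1 _ _ _ _] := hk; have [b1 _ b3 _ _] := hk'.
  have -> : h f z = h g z.
    by move: En => /=; rewrite nz; apply: cI; [apply: a1|apply: b1]; apply: AM.
  by rewrite b3 // inE; apply: AM.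
have RR : embeds ((nat -> W) * (nat -> W)) (nat -> W).
  have [p pI] := embeds_prodW W1.
  exists (fun u n => p (u.1 n, u.2 n)) => -[u v] [u' v'] /= Eu.
  by congr pair; apply/funext => n; have /pI[] := congr1 (fun r => r n) Eu.
have [i iI] : embeds (W -> bool) {f | rep f = f}.
  apply: embeds_prod_absorb DTR; [|exact: RR|exact: diamond_not_embeds].
  have [b ab] := ex_gt W1 (w0 W1).
  by exists (fun=> w0 W1), (fun=> b) => /(congr1 (fun r => r 0%N)) E'; rewrite E' ltxx in ab.
exists (fun f => M (sval (i f))); split=> // f g fg h' k' iso; apply: fg; apply: iI.
have : rep (sval (i f)) = rep (sval (i g)) by apply: repP; exists h', k'.
rewrite (svalP (i f)) (svalP (i g)).
by case: (i f) (i g) => [x px] [y py] /= E'; apply: eq_exist.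
Qed.

(** At the least [b] where [f] and [g] differ, the same state [s] has been
    reached. One of the branches realises a type over [A] that the other
    excludes, so that no isomorphism fixes [A]. *)
Lemma many_models_split (V : set (state G)) s0 A : weak_diamond_star W ->
  state_class W1 V -> V s0 -> countable A -> A `<=` bas s0 ->
  (forall s, V s -> sle s0 s -> exists x t1 t0,
     [/\ V t1 /\ sle s t1, V t0 /\ sle s t0, realised_in t1 A x &
         forall u, V u -> sle t0 u -> ~ realised_in u A x]) ->
  many_models.
Proof.
move=> Phi VP V0 Ac A0 sp.
have /choice_rel[ch chP] : forall s, exists r : seq pt * (state G * state G), V s -> sle s0 s ->
   [/\ V r.2.1 /\ sle s r.2.1, V r.2.2 /\ sle s r.2.2, realised_in r.2.1 A r.1 &
         forall u, V u -> sle r.2.2 u -> ~ realised_in u A r.1].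
  move=> s; have [Vs|?] := pselect (V s); last by exists ([::], (s, s)).
  have [ss|?] := pselect (sle s0 s); last by exists ([::], (s, s)).
  by have [x [t1 [t0 h]]] := sp s Vs ss; exists (x, (t1, t0)).
pose step (b : W) (h : W -> state G) s (i : bool) := if i then (ch s).2.1 else (ch s).2.2.
have stepP b h s i : V s -> sle s0 s -> V (step b h s i) /\ sle s (step b h s i).
  by move=> Vs ss; have [h1 h2 _ _] := chP s Vs ss; case: i.
pose nd := node W1 V s0 step; pose M := model W1 V s0 step.
have AM f : A `<=` M f.
  move=> z /A0 z0; exists (w0 W1) => //.
  have [_ h _] := sle_trans (trunk0 W1 V s0 step f (w0 W1)) (sle_trans
    (trunk_step VP V0 stepP f (w0 W1)) (step_node VP V0 stepP f (w0 W1))).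
  exact: h.
apply: (many_models_over Phi Ac AM); first by move=> f; exact: rich_node.
suff key f g h k b : tp_iso (M f) (M g) h k -> (forall z, A z -> h z = z) ->
    (forall a, a < b -> f a = g a) -> f b = true -> g b = false -> False.
  move=> f g h k iso hA; apply: contrapT => fg.
  have [|b bfg bmin] := @W_min _ _ W1 [set b | f b <> g b].
    apply: contrapT => H; apply: fg; apply/funext => b.
    by apply: contrapT => nb; apply: H; exists b.
  have lo a : a < b -> f a = g a.
    by move=> ab; apply: contrapT => /bmin; rewrite leNgt ab.
  case fb: (f b); case gb: (g b); try by [move: bfg => /=; rewrite fb gb].
    exact: (key f g h k b).
  apply: (key g f k h b) => //; first exact: tp_iso_sym.
    move=> z Az; have [_ _ h3 _ _] := iso; rewrite -{1}(hA z Az) h3 // inE; exact: AM.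
  by move=> a /lo.
move=> iso hA lo fb gb.
pose s := trunk W1 V s0 step f b.
have [_ _ r1 r0] := chP s (V_trunk VP V0 stepP f b) (trunk0 _ _ _ _ _ _).
have sf := step_node VP V0 stepP f b; rewrite /step fb -/s in sf.
have sg := step_node VP V0 stepP g b.
rewrite /step gb -(trunk_loc W1 V s0 step lo) -/s in sg.
have [y yf yx] : exists2 y, inside y (M f) & eqs A y (ch s).1.
  by apply/(realised_model VP V0 stepP); exists b; apply: realised_le sf r1.
have [c [y' y'g y'x]] : exists c, realised_in (nd g c) A (ch s).1.
  apply/(realised_model VP V0 stepP); exists (map h y).
    by move=> _ /mapP[z /yf Mz ->]; have [h1 _ _ _ _] := iso; exact: h1.
  apply: eqs_trans yx; apply: eqs_sym => e eA; apply/eqo_cat.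
  have -> : e ++ map h y = map h (e ++ y).
    rewrite map_cat; congr cat; rewrite -[LHS]map_id; apply/eq_in_map => z /eA Az.
    by rewrite hA.
  have [_ _ _ _ H] := iso; apply: H; apply/inside_cat; split=> // z /eA; exact: AM.
have [m [bm cm]] : exists m, b <= m /\ c <= m.
  by exists (Order.max b c); rewrite !le_max !lexx orbT.
apply: (r0 (nd g m)); first exact: V_node.
  by apply: sle_trans sg _; apply: node_le.
apply: realised_le (node_le VP V0 stepP g cm) _; by exists y'.
Qed.
End Counting.

(** * Branches kept nonisomorphic by weak diamond *)

Section Diamond.
Context {d : Order.disp_t} {W : orderType d} (W1 : is_omega1 W) (G : frame W).
Notation pt := (pt G).
Notation aut := (aut G).
Implicit Types (f g : W -> bool) (A M : set pt).

(** Suppose that an isomorphism invariant [I (M f) A] of models over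
    countable sets, evaluated at the part [B f a] built before stage [a],
    depends on [f] only up to stage [a] and tells the two values of [f a]
    apart, for [a] in the stationary set [S]. Divide [S] into disjoint
    stationary sets [U i]. For [X : W -> bool] let [fX X] follow, on the [U
    i] with [X i], a function [gg i] given by weak diamond, and be
    constantly false elsewhere. Suppose that [X i] but not [Y i], and that
    [h] is an isomorphism from [M (fX X)] to [M (fX Y)]. All three are coded
    by a subset of [W]. The function that weak diamond guesses asks, at
    stage [a], whether the restriction of [h] matches the invariants of the
    models that take the value false at [a] on both sides. At a stage in [U
    i] where the guess is right, [fX Y] is false. If the answer is yes, then
    [fX X] is true, and the invariant of [M (fX X)] is not matched with that
    of [M (fX Y)]. If it is no, then [fX X] is false, and again the
    invariants do not match. *)
Lemma many_models_diamond (M : (W -> bool) -> set pt) (nb : (W -> bool) -> W -> set pt)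
    (I : set pt -> set pt -> set (seq pt)) (S : set W) :
  let B f a := \bigcup_(b in [set b | b < a]) nb f b in
  weak_diamond_star W -> stationary S ->
  (forall f, rich_model (M f)) ->
  (forall f b, countable (nb f b)) -> (forall f b, nb f b !=set0) ->
  (forall f, M f = \bigcup_b nb f b) ->
  (forall f g b, (forall a, a <= b -> f a = g a) -> nb f b = nb g b) ->
  (forall f, exists2 D, club D & forall a, D a -> S a -> forall g, (forall b, b < a -> f b = g b) ->
     (f a = g a <-> I (M f) (B f a) = I (M g) (B f a))) ->
  (forall f g h k t A, tp_iso (M f) (M g) h k -> countable A -> A `<=` M f ->
     aut t -> (forall z, A z -> t z = h z) ->
     forall x, I (M f) A x -> I (M g) (h @` A) (map t x)) ->
  many_models G.
Proof.
move=> B Phi SS Mr nbc nb0 MB loc split inv1.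
have inv f g h k t A : tp_iso (M f) (M g) h k -> countable A -> A `<=` M f -> aut t ->
    (forall z, A z -> t z = h z) -> forall x, I (M f) A x <-> I (M g) (h @` A) (map t x).
  move=> iso Ac AM ta tA x; split; first exact: inv1 iso Ac AM ta tA x.
  have [v [va tv _]] := aut_inv ta; have [i1 i2 i3 i4 _] := iso.
  have kh z : A z -> k (h z) = z by move=> /AM Mz; rewrite i3 ?inE.
  have E : k @` (h @` A) = A.
    apply/seteqP; split=> [_ [_ [z Az <-] <-]|z Az]; first by rewrite kh.
    by exists (h z); [exists z|exact: kh].
  move=> /(inv1 _ _ _ _ v _ (tp_iso_sym iso)); rewrite E (mapK tv); apply=> //.
  - exact: countable_image.
  - by move=> _ [z /AM/i1 ? <-].
  - by move=> _ [z Az <-]; rewrite -tA // tv tA // kh.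
have /choice_rel[U0 U0P] : forall X : set pt, exists e : nat -> pt, countable X -> X !=set0 ->
    (forall n, X (e n)) /\ forall z, X z -> exists n, e n = z.
  move=> X; have [[Xc X0]|h] := pselect (countable X /\ X !=set0).
    by have [e ? ?] := countable_surj Xc X0; exists e.
  by have [z0 _] := nb0 (fun=> true) (w0 W1); exists (fun=> z0) => h1 h2; case: h.
pose item f (i : W * nat) := U0 (nb f i.1) i.2.
have itemP f b z : nb f b z -> exists n, item f (b, n) = z.
  by have [_] := U0P _ (nbc f b) (nb0 f b); apply.
have item_nb f b n : nb f b (item f (b, n)).
  by have [+ _] := U0P _ (nbc f b) (nb0 f b); apply.
have [j jI] := embeds_prod_nat W1.
have [J JI] : embeds (nat * (W * W)) W.
  apply: (embeds_pair W1); [exact: (embeds_count W1)|exact: (embeds_prodW W1)].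
have [U [Us US Ud]] := ulam W1 SS.
(* The functions coded under the tags 0 and 1, cut off at [a]: in particular
   they take the value false at [a]. *)
pose dec (k : nat) (a : W) (p : W -> bool) : W -> bool := fun x => (x < a) && p (J (k, (x, x))).
pose P a (p : W -> bool) := exists2 t, aut t &
   (forall b n c m, b < a -> c < a -> p (J (2%N, (j (b, n), j (c, m)))) ->
      t (item (dec 0%N a p) (b, n)) = item (dec 1%N a p) (c, m)) /\
   forall x, I (M (dec 0%N a p)) (B (dec 0%N a p) a) x <->
             I (M (dec 1%N a p)) (B (dec 1%N a p) a) (map t x).
pose F (a : W) (r : below a -> bool) : bool :=
  `[< P a (fun x => if pselect (x < a) is left h then r (exist _ x h) else false) >].
have Frestr p a : F a (restrict_below p (a := a)) = `[< P a (fun x => (x < a) && p x) >].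
  rewrite /F; congr (`[< P a _ >]); apply/funext => x.
  by case: pselect => [h|/negP/negbTE->] //=; rewrite h.
pose g0 i := projT1 (cid (Phi (U i) (Us i) F)).
have g0P i f : stationary [set \val s | s in
    [set s : U i | F (\val s) (restrict_below f (a := \val s)) = g0 i s]].
  by rewrite /g0; case: cid.
pose gg i a : bool := if pselect (a \in U i) is left h then g0 i (exist _ a h) else false.
pose fX (X : W -> bool) a : bool := `[< exists i, [/\ X i, U i a & gg i a] >].
have fXU X i a : U i a -> fX X a = X i && gg i a.
  move=> Ua; apply/asboolP/andP => [[i' [Xi' Ua' ga]]|[Xi ga]]; last by exists i.
  by rewrite (Ud i i' a Ua Ua').
suff key X Y i h k : tp_iso (M (fX X)) (M (fX Y)) h k -> X i = true -> Y i = false -> False.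
  exists (fun X => M (fX X)); split=> // X Y XY h k iso.
  apply: XY; apply/funext => i; case Xi: (X i); case Yi: (Y i) => //; exfalso.
    exact: (key X Y i h k).
  exact: (key Y X i k h (tp_iso_sym iso)).
move=> iso Xi Yi.
set eta := fX X in iso; set nu := fX Y in iso.
(* Tags 0 and 1 code the two functions, and tag 2 codes the graph of [h]. *)
pose code w := `[< exists x, w = J (0%N, (x, x)) /\ eta x >] || `[< exists x, w = J (1%N, (x, x)) /\ nu x >]
  || `[< exists b n c m, w = J (2%N, (j (b, n), j (c, m))) /\ h (item eta (b, n)) = item nu (c, m) >].
have code0 x : code (J (0%N, (x, x))) = eta x.
  apply/idP/idP => [|ex]; last by rewrite /code; case: asboolP => // -[]; exists x.
  rewrite /code => /orP[/orP[]|] /asboolP; first by case=> y [/JI[->]].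
    by case=> y [/JI].
  by case=> b [n [c [m [/JI]]]].
have code1 x : code (J (1%N, (x, x))) = nu x.
  apply/idP/idP => [|ex]; last by rewrite /code; case: asboolP => // _; case: asboolP => // -[]; exists x.
  rewrite /code => /orP[/orP[]|] /asboolP; first by case=> y [/JI].
    by case=> y [/JI[->]].
  by case=> b [n [c [m [/JI]]]].
have code2 b n c m : code (J (2%N, (j (b, n), j (c, m)))) <-> h (item eta (b, n)) = item nu (c, m).
  split=> [|E]; last first.
    by rewrite /code; apply/orP; right; apply/asboolP; exists b, n, c, m.
  rewrite /code => /orP[/orP[]|] /asboolP; first by case=> y [/JI].
    by case=> y [/JI].
  by case=> b' [n' [c' [m' [/JI[/jI[-> ->] /jI[-> ->]] E]]]].
have [D1 D1c D1P] := split eta; have [D2 D2c D2P] := split nu.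
have [i1 i2 i3 i4 i5] := iso.
have /choice_rel[l1 l1P] : forall z, exists b, M eta z -> nb eta b z.
  move=> z; have [|] := pselect (M eta z); last by exists (w0 W1).
  by rewrite {1}MB => -[b _ ?]; exists b.
have /choice_rel[l2 l2P] : forall z, exists b, M nu z -> nb nu b z.
  move=> z; have [|] := pselect (M nu z); last by exists (w0 W1).
  by rewrite {1}MB => -[b _ ?]; exists b.
(* Below a closure point [a], the codes of pairs from below [a] are below
   [a], and [h] maps what is built before [a] on one side onto what is built
   before [a] on the other. *)
pose T x := [set y | y <= x] `|` (j @` ([set y | y <= x] `*` [set: nat])).
have lec (x : W) : countable [set y | y <= x].
  have [y xy] := ex_gt W1 x; apply: countable_sub (below_countable W1 y) => z /= zx.
  exact: le_lt_trans xy.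
have Tc x : countable (T x).
  apply: countable_setU => //; apply: countable_image; apply: countableX => //.
have D3c := @cl_pts_club _ _ W1 (fun x => J @` ([set: nat] `*` (T x `*` T x)))
  (fun x => countable_image _ (countableX (countableP _) (countableX (Tc x) (Tc x)))).
have D4c := @cl_pts_club _ _ W1 (fun b => ((l2 \o h) @` nb eta b) `|` ((l1 \o k) @` nb nu b))
  (fun b => countable_setU (countable_image _ (nbc _ _)) (countable_image _ (nbc _ _))).
have [a [[[a' aU] /= Ea aa] [[[D1a D2a] [_ D3a]] [_ D4a]]]] :=
  g0P i code _ (clubI W1 (clubI W1 (clubI W1 D1c D2c) D3c) D4c).
move: aU Ea; rewrite aa => aU Ea {a' aa}.
have Ua : U i a by rewrite -inE.
have Sa : S a := US i a Ua.
have J0 x : x < a -> J (0%N, (x, x)) < a.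
  by move=> xa; apply: (D3a x xa); exists (0%N, (x, x)) => //; do 2?split=> //; left=> /=.
have J1 x : x < a -> J (1%N, (x, x)) < a.
  by move=> xa; apply: (D3a x xa); exists (1%N, (x, x)) => //; do 2?split=> //; left=> /=.
have J2 b n c m : b < a -> c < a -> J (2%N, (j (b, n), j (c, m))) < a.
  move=> ba ca; apply: (D3a (Order.max b c)); first by rewrite gt_max ba.
  exists (2%N, (j (b, n), j (c, m))) => //; split=> //; split; right.
    by exists (b, n) => //; split=> //=; rewrite le_max lexx.
  by exists (c, m) => //; split=> //=; rewrite le_max lexx orbT.
pose p x := (x < a) && code x.
have pE0 x : dec 0%N a p x = (x < a) && eta x.
  by rewrite /dec /p; case xa: (x < a) => //=; rewrite J0 ?code0.
have pE1 x : dec 1%N a p x = (x < a) && nu x.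
  by rewrite /dec /p; case xa: (x < a) => //=; rewrite J1 ?code1.
set e0 := dec 0%N a p in pE0; set n0 := dec 1%N a p in pE1.
have eta0 b : b < a -> eta b = e0 b by move=> ba; rewrite pE0 ba.
have nu0 b : b < a -> nu b = n0 b by move=> ba; rewrite pE1 ba.
have e0a : e0 a = false by rewrite pE0 ltxx.
have n0a : n0 a = false by rewrite pE1 ltxx.
have nbe b : b < a -> nb e0 b = nb eta b.
  by move=> ba; apply: loc => c cb; rewrite eta0 //; exact: le_lt_trans ba.
have nbn b : b < a -> nb n0 b = nb nu b.
  by move=> ba; apply: loc => c cb; rewrite nu0 //; exact: le_lt_trans ba.
have Be : B e0 a = B eta a by apply: eq_bigcupr => b; exact: nbe.
have Bn : B n0 a = B nu a by apply: eq_bigcupr => b; exact: nbn.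
have hB : h @` (B eta a) = B nu a.
  apply/seteqP; split=> [_ [z [b ba bz] <-]|z [b ba bz]].
    have Mz : M eta z by rewrite MB; exists b.
    exists (l2 (h z)); last exact: l2P (i1 z Mz).
    by apply: (D4a b ba); left; exists z.
  have Mz : M nu z by rewrite MB; exists b.
  exists (k z); last by rewrite i4 ?inE.
  exists (l1 (k z)); last exact: l1P (i2 z Mz).
  by apply: (D4a b ba); right; exists z.
have BM : B eta a `<=` M eta by move=> z [b _ bz]; rewrite MB; exists b.
have Bc : countable (B eta a).
  by apply: bigcup_countable => //; exact: below_countable.
have etaa : eta a = gg i a by rewrite /eta (fXU X i a Ua) Xi.
have nua : nu a = n0 a by rewrite /nu (fXU Y i a Ua) Yi n0a.
have ga : `[< P a p >] = gg i a.
  rewrite -Frestr Ea /gg; case: pselect => // h'; congr (g0 i _); exact: eq_exist.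
have In : I (M nu) (B nu a) = I (M n0) (B nu a) by apply/(D2P a D2a Sa n0 nu0).
have Ie := D1P a D1a Sa e0 eta0.
have [t0 ta0 t0P] := tp_map_aut Bc (tp_iso_on BM iso).
case Ega : (gg i a).
  have : `[< P a p >] by rewrite ga.
  move=> /asboolP[t ta [th tI]].
  have tB z : B eta a z -> t z = h z.
    move=> Bz; have [b ba bz] := Bz.
    have : B nu a (h z) by rewrite -hB; exists z.
    case=> c ca cz; have [n zn] := itemP _ _ _ bz; have [m zm] := itemP _ _ _ cz.
    have := th b n c m ba ca; rewrite /item /= -/e0 -/n0 nbe // nbn // -/(item eta (b, n)) -/(item nu (c, m)) zn zm; apply.
    by rewrite /p J2 //=; apply/code2; rewrite zn zm.
  suff : eta a = e0 a by rewrite etaa Ega e0a.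
  apply/Ie; apply/seteqP; split=> x.
    move=> /(inv _ _ _ _ t _ iso Bc BM ta tB x).1; rewrite hB In -Bn => /(tI x).2.
    by rewrite -/e0 Be.
  rewrite -{1}Be => /(tI x).1; rewrite -/n0 Bn -In -hB.
  by move=> /(inv _ _ _ _ t _ iso Bc BM ta tB x).2.
have : ~ P a p by move=> Pp; move: ga; rewrite Ega; case: asboolP.
apply; exists t0 => //; rewrite -/e0 -/n0; split=> [b n c m ba ca|x].
  rewrite /p J2 //= => /code2 E; rewrite /item /= nbe // nbn // -/(item eta (b, n)) -/(item nu (c, m)).
  by rewrite -E; apply: t0P; exists b => //; exact: item_nb.
have <- : I (M eta) (B eta a) = I (M e0) (B e0 a) by rewrite Be; apply/Ie; rewrite etaa Ega e0a.
by rewrite Bn -In -hB; apply: inv iso Bc BM ta0 t0P x.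
Qed.
End Diamond.

(** * Stable states and splitting types *)

Section Stable.
Context {d : Order.disp_t} {W : orderType d} (W1 : is_omega1 W)
  (Phi : weak_diamond_star W) (G : frame W).
Notation pt := (pt G).
Notation aut := (aut G).
Implicit Types (s t u : state G) (f g : W -> bool) (A D M : set pt) (x y : seq pt) (V : set (state G)).

Definition pts (x : seq pt) : set pt := [set z | z \in x].

Definition reach V s A x := exists u, [/\ V u, sle s u & realised_in u A x].

(** The types over [A] that can still be realised are the same at all later
    states. *)
Definition stable V s A := forall t, V t -> sle s t -> forall x, reach V s A x -> reach V t A x.

Lemma reach_le V s t A x : sle s t -> reach V t A x -> reach V s A x.
Proof. by move=> st [u [Vu tu ux]]; exists u; split=> //; exact: sle_trans tu. Qed.

Lemma stable_le V s t A : V t -> sle s t -> stable V s A -> stable V t A.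
Proof.
move=> Vt st H u Vu tu x xc; apply: H => //; first exact: sle_trans tu.
exact: reach_le xc.
Qed.

Lemma stable_reach V s t A x : stable V s A -> V t -> sle s t -> reach V s A x <-> reach V t A x.
Proof. by move=> H Vt st; split; [exact: H|exact: reach_le]. Qed.

(** If a realisable type stops being so at an extension [u] of [t],
    realising it and passing to [u] are two extensions of [t] as required by
    [many_models_split]. *)
Lemma stable_or_many V : state_class W1 V -> many_models G \/
  forall s A, V s -> countable A -> A `<=` bas s -> exists t, [/\ V t, sle s t & stable V t A].
Proof.
move=> VP; apply: contrapT => /not_orP[nm H]; apply: H => s A Vs Ac As.
apply: contrapT => H; apply: nm.
apply: (many_models_split Phi VP Vs Ac As) => t Vt st.
have [u [x [Vu tu tx nux]]] : exists u x, [/\ V u, sle t u, reach V t A x & ~ reach V u A x].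
  apply: contrapT => nu; apply: H; exists t; split=> // u Vu tu x tx.
  by apply: contrapT => nx; apply: nu; exists u, x.
have [t1 [V1 tt1 r1]] := tx.
exists x, t1, u; split=> // v Vv uv r; apply: nux; by exists v.
Qed.

Lemma lubW_club (E : set W) (A : set W) : club E -> A !=set0 -> countable A -> A `<=` E -> E (lubW W1 A).
Proof.
move=> [_ Ec] [a Aa] Ac AE; have [|nA] := pselect (A (lubW W1 A)); first exact: AE.
have lt b : A b -> b < lubW W1 A.
  move=> Ab; rewrite lt_neqAle (lubW_ub W1 Ac Ab) andbT; apply/eqP => E'.
  by rewrite E' in Ab.
apply: Ec; first by exists a; exact: lt.
move=> b /lubW_lt[c Cc bc]; exists c; first exact: AE.
by rewrite bc lt.
Qed.

Lemma chain_fin (F : set (state G)) x : total_on F (@sle _ _ G) -> F !=set0 ->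
  inside x (\bigcup_(s in F) bas s) -> exists2 s, F s & inside x (bas s).
Proof.
move=> Ft [s0 F0]; elim: x => [|z x IH] xF; first by exists s0.
have [|s Fs xs] := IH; first by move=> y yx; apply: xF; rewrite inE yx orbT.
have [t Ft_ zt] := xF z (mem_head _ _).
have [[_ st _]|[_ ts _]] := Ft s t Fs Ft_.
  by exists t => // y; rewrite inE => /orP[/eqP->//|/xs]; exact: st.
by exists s => // y; rewrite inE => /orP[/eqP->|/xs//]; exact: ts.
Qed.

(** A finite tuple isolated at a limit level is isolated at an earlier one,
    hence at the level of some member of the chain that contains it. *)
Lemma sup_base (F : set (state G)) : total_on F (@sle _ _ G) -> F !=set0 -> countable F ->
  (forall s, F s -> is_limit (lv s) /\ base (lv s) (bas s)) ->
  base (lv (ssup W1 F)) (bas (ssup W1 F)).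
Proof.
move=> Ft F0 Fc Fb.
have lim : is_limit (lv (ssup W1 F)).
  apply: (@lubW_club [set a | is_limit a]); first exact: club_limit.
  - by have [s Fs] := F0; exists (lv s), s.
  - exact: countable_image.
  - by move=> _ [s Fs <-]; case: (Fb s Fs).
apply: base_union.
- by apply: bigcup_countable => // s /Fb[_ [[]]].
- move=> x /(chain_fin Ft F0)[s Fs xs]; have [h _ _] := ssup_ub W1 Fc Fs.
  by apply: At_le h _; have [_ [[_ H] _]] := Fb s Fs; exact: H.
- move=> x z /(chain_fin Ft F0)[s Fs xs] /(At_limit lim)[b bl Ab].
  have [_ [t Ft_ <-] bt] := lubW_lt bl.
  have [u [Fu su tu]] : exists u, [/\ F u, sle s u & sle t u].
    by have [h|h] := Ft s t Fs Ft_; [exists t|exists s]; split=> //; exact: sle_refl.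
  have [_ h2 _] := su; have [h1 _ _] := tu; have [_ h3 _] := ssup_ub W1 Fc Fu.
  exists (lv u), (bas u); split=> //; first by case: (Fb u Fu).
    by move=> y /xs/h2.
  by apply: At_le Ab; apply: le_trans (ltW bt) h1.
Qed.

Lemma image_pts (t : pt -> pt) x : t @` pts x = pts (map t x).
Proof.
apply/seteqP; split=> [_ [z zx <-]|_ /mapP[z zx ->]]; [exact: map_f|by exists z].
Qed.

Lemma atomic_aut (t : pt -> pt) A : aut t -> atomic A -> atomic (t @` A).
Proof.
move=> ta [Ac AA]; have [v [va tv vt]] := aut_inv ta; split; first exact: countable_image.
move=> x xA; have [|a la Ax] := AA (map v x).
  by move=> _ /mapP[z /xA[y Ay <-] ->]; rewrite tv.
by exists a => //; rewrite -(mapK vt x); apply: At_aut.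
Qed.

Lemma atomic_autU (t : pt -> pt) A x : aut t -> atomic (t @` A `|` pts (map t x)) <-> atomic (A `|` pts x).
Proof.
move=> ta; rewrite -image_pts -image_setU; split=> [|]; last exact: atomic_aut.
have [v [va tv vt]] := aut_inv ta; move=> /(atomic_aut va).
by rewrite image_comp (_ : v \o t = id) ?image_id //; apply/funext => z /=; rewrite tv.
Qed.

(** Some atomic type over [D] does not extend to an atomic type over some
    atomic superset. *)
Definition splits D := exists x D', [/\ atomic (D `|` pts x), D `<=` D', atomic D' &
  forall y, eqs D y x -> ~ atomic (D' `|` pts y)].

(** Bases of one level are conjugate, so that splitting is a property of the
    level. *)
Lemma splits_conj a D E : base a D -> base a E -> splits D -> splits E.
Proof.
move=> bD bE [x [D' [h1 h2 h3 h4]]].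
have [t ta [<- _]] := base_conj bD bE (@inside_nil _ _ _ D) (@inside_nil _ _ _ E) (eqo_refl _ _).
have [v [va tv vt]] := aut_inv ta.
exists (map t x), (t @` D'); split; [exact/atomic_autU|exact: image_subset|exact: atomic_aut|].
move=> y; rewrite -(mapK vt y) => /(eqs_autE _ _ _ ta).1 /h4 h /(atomic_autU _ _ ta) //.
Qed.

Definition split_level a := exists2 D, base a D & splits D.

Lemma trunk_bas V s0 step f b : state_class W1 V -> V s0 ->
  (forall b h s i, V s -> sle s0 s -> V (step b h s i) /\ sle s (step b h s i)) ->
  (exists a, a < b) ->
  bas (trunk W1 V s0 step f b) = \bigcup_(a in [set a | a < b]) bas (node W1 V s0 step f a).
Proof.
move=> VP V0 stepP [a0 a0b]; apply/seteqP; split=> [z [_ [->|[a ab <-]] zb]|z [a ab zb]].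
- exists a0 => //; have [_ h _] := sle_trans (trunk0 W1 V s0 step f a0) (sle_trans
    (trunk_step VP V0 stepP f a0) (step_node VP V0 stepP f a0)); exact: h.
- by exists a.
- by exists (node W1 V s0 step f a) => //; right; exists a.
Qed.

End Stable.

(** * Stationarily many split levels *)

Section SplitCase.
Context {d : Order.disp_t} {W : orderType d} (W1 : is_omega1 W)
  (cov : cov_meager_ge_succ W) (Phi : weak_diamond_star W) (G : frame W).
Notation pt := (pt G).
Notation aut := (aut G).
Implicit Types (s : state G) (f g : W -> bool) (A D M : set pt) (x y : seq pt) (V : set (state G)).

Definition limit_level : set W := lev G `&` [set a | is_limit a].

Lemma limit_level_club : club limit_level.
Proof. by apply: clubI => //; [exact: lev_club|exact: club_limit]. Qed.

Definition base_state : set (state G) :=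
  [set s | [/\ limit_level (lv s), base (lv s) (bas s) & prm s = set0]].

Lemma split_level_splits a D : split_level G a -> base a D -> splits D.
Proof. by move=> [E bE sE] bD; exact: splits_conj bE bD sE. Qed.

Lemma splits_new a D x D' : base a D -> atomic (D `|` pts x) -> D `<=` D' -> atomic D' ->
  (forall y, eqs D y x -> ~ atomic (D' `|` pts y)) -> exists2 z, z \in x & ~ D z.
Proof.
move=> bD h1 h2 h3 h4; apply: contrapT => H; apply: (h4 x (@eqs_refl _ _ _ _ _)).
apply: atomic_sub h3 => z [//|zx]; apply: h2; apply: contrapT => nD; apply: H.
by exists z.
Qed.

Lemma atomic_state a A : atomic A -> exists s, [/\ base_state s, a < lv s & A `<=` bas s].
Proof.
move=> /(atomic_lev W1)[b lb Ab].
have [c [lc kc] mc] := limit_level_club.1 (Order.max a b).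
move: mc; rewrite gt_max => /andP[ac bc].
have [D bD AD] := base_ext W1 cov lc (atomicAt_le (ltW bc) Ab).
by exists (State c D set0).
Qed.

(** The class grows at split levels: a type over [D] that splits is not
    realised in [D]. *)
Lemma base_state_class : stationary (split_level G `&` limit_level) -> state_class W1 base_state.
Proof.
move=> SS; split.
- by move=> s [[? ?] ? _].
- move=> F F0 Fc FV Ft; have [s Fs] := F0; split.
  + apply: lubW_club; [exact: limit_level_club|by exists (lv s), s|exact: countable_image|].
    by move=> _ [t /FV[]? _ _ <-].
  + by apply: sup_base => // t /FV[[]].
  + by apply/seteqP; split=> // z [t /FV[_ _ ->]].
- move=> s a [ls bs ps].
  have [b [[sb lb] /= mb]] := SS _ (club_gt W1 (Order.max a (lv s))).
  move: mb; rewrite gt_max => /andP[ab sb'].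
  have [D bD sD] := base_ext W1 cov lb.1 (atomicAt_le (ltW sb') bs.1).
  have [x [D' [h1 h2 h3 h4]]] := split_level_splits sb bD.
  have [z zx nz] := splits_new bD h1 h2 h3 h4.
  have [t [Vt bt Dt]] := atomic_state b h1.
  exists t; split=> //.
  + split; [exact: ltW (lt_trans sb' bt)|by move=> y /sD ?; apply: Dt; left|].
    by rewrite ps.
  + exact: lt_trans bt.
  + by exists z; [apply: Dt; right|move=> /sD].
Qed.

(** The types over [A] that extend atomically to each countable part of [M].
    In a union of stable states they are the types over [A] that can be
    realised, and no bookkeeping is needed to realise them. *)
Definition survives M A : set (seq pt) := [set x | forall D, countable D -> A `<=` D -> D `<=` M ->
  exists2 y, eqs A y x & atomic (D `|` pts y)].

Lemma survives_iso (M1 M2 : set pt) h k t A x : tp_iso M1 M2 h k -> countable A -> A `<=` M1 -> aut t ->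
  (forall z, A z -> t z = h z) -> survives M1 A x -> survives M2 (h @` A) (map t x).
Proof.
move=> iso Ac AM ta tA sx D Dc AD DM; have [i1 i2 i3 i4 _] := iso.
have D1c : countable (k @` D) by exact: countable_image.
have D1M : k @` D `<=` M1 by move=> _ [z /DM/i2 ? <-].
have AD1 : A `<=` k @` D.
  by move=> z Az; exists (h z); [apply: AD; exists z|rewrite i3 ?inE //; exact: AM].
have [y yx yD] := sx _ D1c AD1 D1M.
have [u ua uh] := tp_map_aut D1c (tp_iso_on D1M iso).
have [v [va uv vu]] := aut_inv ua.
exists (map u y).
  have -> : h @` A = u @` A.
    by apply/seteqP; split=> _ [z Az <-]; exists z => //; rewrite uh //; exact: AD1.
  apply: (@eqs_trans _ _ _ _ _ (map u x)); first exact/(eqs_autE _ _ _ ua).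
  move=> e eA; exists (t \o v); first exact: aut_comp.
  split; last by rewrite map_comp (mapK uv).
  by move=> _ /eA[z Az <-] /=; rewrite uv tA // uh //; exact: AD1.
have uk z : D z -> u (k z) = z.
  by move=> Dz; rewrite uh; [rewrite i4 // inE; exact: DM|exists z].
have -> : D = u @` (k @` D).
  apply/seteqP; split=> [z Dz|_ [_ [z Dz <-] <-]]; last by rewrite uk.
  by exists (k z); [exists z|exact: uk].
exact/(atomic_autU _ _ ua).
Qed.

(** At a split level the state is extended by a realisation of the splitting
    type, or by a set [D'] over which it has no atomic extension, and then
    made stable. On a club, the trunk at [a] has level [a]; so for
    stationarily many [a] this level is split and the choice is made at
    stage [a]. *)
Lemma many_models_splitting : stationary (split_level G `&` limit_level) -> many_models G.
Proof.
move=> SS; have VP := base_state_class SS.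
have [//|stab] := stable_or_many Phi VP.
have [a0 la0 _] := limit_level_club.1 (w0 W1).
have [|s0 [V0 _ _]] := @atomic_state a0 set0.
  apply: (atomicAt_atomic la0.1); split; first exact: countable0.
  move=> [|z x] h; first exact: At_nil la0.1.
  by have := h z (mem_head _ _).
have bc s : base_state s -> countable (bas s) by case=> _ [[]].
have /choice_rel[ch chP] : forall s, exists r : state G * state G,
    base_state s -> split_level G (lv s) ->
    [/\ base_state r.1 /\ sle s r.1, base_state r.2 /\ sle s r.2, stable base_state r.1 (bas s), stable base_state r.2 (bas s) &
      exists2 x, reach base_state r.1 (bas s) x & ~ reach base_state r.2 (bas s) x].
  move=> s; have [Vs|?] := pselect (base_state s); last by exists (s, s).
  have [ss|?] := pselect (split_level G (lv s)); last by exists (s, s).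
  have [ls bs ps] := Vs.
  have [x [D' [h1 h2 h3 h4]]] := split_level_splits ss bs.
  have ext A : atomic A -> bas s `<=` A -> exists t, [/\ base_state t, sle s t, A `<=` bas t & stable base_state t (bas s)].
    move=> /(atomic_state (lv s))[t [Vt lt At_]] sA.
    have st : sle s t by split; [exact: ltW|exact: subset_trans At_|rewrite ps].
    have [u [Vu tu us]] := stab t (bas s) Vt (bc s Vs) (subset_trans sA At_).
    exists u; split=> //; first exact: sle_trans tu.
    by apply: subset_trans At_ _; case: tu.
  have [|t1 [Vt1 st1 xt1 tt1]] := ext _ h1; first by move=> z; left.
  have [t0 [Vt0 st0 xt0 tt0]] := ext _ h3 h2.
  exists (t1, t0) => _ _; split=> //=; exists x.
    by exists t1; split=> //; [exact: sle_refl|exists x; [move=> z zx; apply: xt1; right|exact: eqs_refl]].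
  move=> [u [[lu bu _] tu [y yu yx]]]; apply: (h4 y yx).
  apply: (atomicAt_atomic lu.1); apply: atomicAt_sub bu.1 => z [/xt0|/yu //].
  by have [_ h _] := tu; exact: h.
pose step (b : W) (h : W -> state G) s (i : bool) :=
  if pselect (split_level G (lv s)) then if i then (ch s).1 else (ch s).2 else s.
have stepP b h s i : base_state s -> sle s0 s -> base_state (step b h s i) /\ sle s (step b h s i).
  move=> Vs _; rewrite /step; case: pselect => ss /=; last by split=> //; exact: sle_refl.
  by have [h1 h2 _ _ _] := chP s Vs ss; case: i.
pose nd := node W1 base_state s0 step; pose tr := trunk W1 base_state s0 step; pose M := model W1 base_state s0 step.
have Vn f b : base_state (nd f b) by exact: V_node.
have Vt f b : base_state (tr f b) by exact: V_trunk.
have bM f b : bas (nd f b) `<=` M f by move=> z ?; exists b.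
have key f b t : base_state t -> sle t (nd f b) -> sle (tr f b) t -> stable base_state t (bas (tr f b)) ->
    survives (M f) (bas (tr f b)) = reach base_state t (bas (tr f b)).
  move=> Vt1 tn st ts; apply/seteqP; split=> x.
    move=> sx; have [||y yx /(atomic_state (lv t))[u [Vu tu Du]]] := sx (bas t) (bc t Vt1).
    - by case: st.
    - by apply: subset_trans (bM f b); case: tn.
    exists u; split=> //; first split; first exact: ltW.
    - by move=> z ?; apply: Du; left.
    - by case: Vt1 => _ _ ->.
    - by exists y => // z zy; apply: Du; right.
  move=> xc D Dc AD DM; have [c bc' Dn] := model_bounded VP V0 stepP Dc DM b.
  have [u [Vu nu [y yu yx]]] := ts (nd f c) (Vn f c) (sle_trans tn (node_le VP V0 stepP f (ltW bc'))) x xc.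
  exists y => //; have [[lu _] bu _] := Vu.
  apply: (atomicAt_atomic lu); apply: atomicAt_sub bu.1 => z [/Dn|/yu //].
  by have [_ h _] := nu; exact: h.
apply: (@many_models_diamond _ _ W1 G M (fun f b => bas (nd f b)) survives (split_level G `&` limit_level)) => //.
- by move=> f; exact: rich_node.
- by move=> f b; apply: bc.
- by move=> f b; have [z ? _] := node_new VP V0 stepP f b; exists z.
- by move=> f g b fg; rewrite /nd (node_loc W1 base_state s0 step fg).
- move=> f.
  exists (cl_pts (fun b => [set lv (nd f b); lv s0])).
    by apply: cl_pts_club => // b; apply: countable_setU; exact: countable1.
  move=> a [[a' a'a] acl] [asp al] g fg.
  have ta : tr f a = tr g a by exact: trunk_loc.
  have Ba : \bigcup_(b in [set b | b < a]) bas (nd f b) = bas (tr f a).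
    by rewrite /tr (trunk_bas f VP V0 stepP) //; exists a'.
  have la : lv (tr f a) = a.
    apply/le_anti/andP; split.
      apply: lubW_least => _ [_ [->|[b ba <-]] <-]; apply: ltW.
        by apply: (acl a' a'a); right.
      by apply: (acl b ba); left.
    rewrite leNgt; apply/negP => h.
    have [h1 _ _] := node_trunk W1 base_state s0 step f h.
    by have := lt_le_trans (node_lv VP V0 stepP f (lv (tr f a))) h1; rewrite ltxx.
  have sa : split_level G (lv (tr f a)) by rewrite la.
  have [[V1' s1] [V2 s2] t1 t2 [x x1 x2]] := chP (tr f a) (Vt f a) sa.
  have stf : survives (M f) (bas (tr f a)) =
      reach base_state (if f a then (ch (tr f a)).1 else (ch (tr f a)).2) (bas (tr f a)).
    apply: key; try by case: (f a).
    have := step_node VP V0 stepP f a; rewrite /step -/tr.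
    by case: pselect.
  have stg : survives (M g) (bas (tr f a)) =
      reach base_state (if g a then (ch (tr f a)).1 else (ch (tr f a)).2) (bas (tr f a)).
    rewrite ta; apply: key; rewrite -ta; try by case: (g a).
    have := step_node VP V0 stepP g a; rewrite /step -/tr -ta.
    by case: pselect.
  rewrite Ba stf stg; split=> [->//|].
  case: (f a); case: (g a) => // E; exfalso; apply: x2; first by rewrite -E.
  by rewrite E.
- by move=> f g h k t A iso Ac AM ta tA x; exact: survives_iso iso Ac AM ta tA.
Qed.
End SplitCase.

(** * Types with many extensions *)

Section Large.
Context {d : Order.disp_t} {W : orderType d} (W1 : is_omega1 W)
  (cov : cov_meager_ge_succ W) (G : frame W).
Notation pt := (pt G).
Notation aut := (aut G).
Implicit Types (A D : set pt) (x y e : seq pt).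

Context (F : set W) (Fc : club F) (F1 : F `<=` limit_level G)
  (Fns : forall a, F a -> ~ split_level G a) (m : nat).

Definition AtS x := exists2 a, lev G a & At a x.

(** More than aleph_1 types over [D] extend the type of [x] over [e]
    atomically, even if only the root [take m y] of an extension counts. The
    entries after the root make room for the points that conditions add. *)
Definition large D x e := (m <= size x)%N /\ forall b : W -> seq pt, exists y,
  [/\ eqo e x y, atomic (D `|` pts y) & forall w, ~ eqs D (b w) (take m y)].

Definition ample x e := exists a D, [/\ F a, base a D, inside e D & large D x e].

Lemma F_lev a : F a -> lev G a. Proof. by move=> /F1[]. Qed.

Lemma AtS_F x a : AtS x -> exists b, [/\ F b, a < b & At b x].
Proof.
move=> [c lc Ax]; have [b Fb] := Fc.1 (Order.max a c).
by rewrite gt_max => /andP[ab cb]; exists b; split=> //; apply: At_le Ax; exact: ltW.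
Qed.

Lemma AtS_sub x y : {subset y <= x} -> AtS x -> AtS y.
Proof. by move=> yx [a la Ax]; exists a => //; exact: At_sub Ax yx. Qed.

Lemma AtS_aut t x : aut t -> AtS x -> AtS (map t x).
Proof. by move=> ta [a la Ax]; exists a => //; exact: At_aut. Qed.

Lemma AtS_eqo e x y : eqo e x y -> AtS (e ++ x) -> AtS (e ++ y).
Proof. by move=> [t ta [te <-]] /(AtS_aut ta); rewrite map_cat ((fixes_map t e).1 te). Qed.

Lemma base_aut t a D : aut t -> base a D -> base a (t @` D).
Proof.
move=> ta [[Dc DA] DH]; have [v [va tv vt]] := aut_inv ta.
have inD s : inside s (t @` D) -> inside (map v s) D.
  by move=> sD _ /mapP[z /sD[y Dy <-] ->]; rewrite tv.
split; first split; first exact: countable_image.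
  by move=> s /inD/DA/(At_aut ta); rewrite (mapK vt).
move=> s z sD Az; have [|z' Dz' ez] := DH (map v s) (v z) (inD s sD).
  by have := At_aut va Az; rewrite map_cat.
exists (t z'); first by exists z'.
by have := eqo_aut ta ez; rewrite (mapK vt) /= vt.
Qed.

Lemma large_aut t D x e : aut t -> large D x e -> large (t @` D) (map t x) (map t e).
Proof.
move=> ta [mx H]; have [v [va tv vt]] := aut_inv ta.
split=> [|b]; first by rewrite size_map.
have [y [xy Dy ny]] := H (fun w => map v (b w)).
exists (map t y); split; [exact: eqo_aut|exact/atomic_autU|move=> w h].
apply: (ny w); apply/(eqs_autE _ _ _ ta); by rewrite (mapK vt) map_take.
Qed.

Lemma ample_aut t x e : aut t -> ample x e -> ample (map t x) (map t e).
Proof.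
move=> ta [a [D [Fa bD eD xD]]]; exists a, (t @` D); split=> //.
- exact: base_aut.
- by move=> _ /mapP[z /eD Dz ->]; exists z.
- exact: large_aut.
Qed.

Lemma ample_perm x e e' : e =i e' -> ample x e -> ample x e'.
Proof.
move=> ee [a [D [Fa bD eD [mx xD]]]]; exists a, D; split=> //.
  by move=> z; rewrite -ee; exact: eD.
split=> // b; have [y [xy Dy ny]] := xD b; exists y; split=> //.
by apply: eqo_sub xy => z; rewrite -ee.
Qed.

Lemma large_At D x e : inside e D -> large D x e -> AtS (e ++ x).
Proof.
move=> eD [mx H]; have [y [xy [_ DA] _]] := H (fun=> [::]).
apply: (AtS_eqo (eqo_sym xy)); apply: DA; apply/inside_cat; split; last by move=> z; right.
by move=> z /eD; left.
Qed.

Lemma ample_At x e : ample x e -> AtS (e ++ x).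
Proof. by move=> [a [D [_ _ eD]]]; exact: large_At. Qed.

Lemma ample_size x e : ample x e -> (m <= size x)%N.
Proof. by move=> [a [D [_ _ _ []]]]. Qed.

Lemma large_index (I : Type) D x e (b : I -> seq pt) : embeds I W -> large D x e ->
  exists y, [/\ eqo e x y, atomic (D `|` pts y) & forall i, ~ eqs D (b i) (take m y)].
Proof.
move=> [c cI] [_ H].
have /choice_rel[b' b'P] : forall w, exists s, forall i, c i = w -> s = b i.
  move=> w; have [[i iw]|h] := pselect (exists i, c i = w).
    by exists (b i) => i'; rewrite -iw => /cI->.
  by exists [::] => i iw; case: h; exists i.
have [y [xy Dy ny]] := H b'; exists y; split=> // i.
by rewrite -(b'P (c i) i erefl).
Qed.

(** As the level of [D] does not split, the atomic types over [D] extend to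
    [D'], and roots with different types over [D] have different types over
    [D']. *)
Lemma large_push a D D' x e : F a -> base a D -> D `<=` D' -> atomic D' -> inside e D ->
  large D x e -> large D' x e.
Proof.
move=> Fa bD DD' D'A eD [mx H]; split=> // b.
have [y [xy Dy ny]] := H b.
have [y' y'y D'y'] : exists2 y', eqs D y' y & atomic (D' `|` pts y').
  apply: contrapT => nsp; apply: (Fns Fa); exists D => //.
  by exists y, D'; split=> // z zy Dz; apply: nsp; exists z.
exists y'; split=> //; first by apply: eqo_trans xy _; apply: eqo_sym; exact: y'y.
move=> w h; apply: (ny w); apply: eqs_trans (eqs_sub DD' h) _; exact: eqs_take.
Qed.

(** If [y] is not large over [e ++ a k], its roots over [D] are listed by
    aleph_1 tuples, and such a list depends only on [k] and on the orbit
    code of [(e ++ a k) ++ y] at some level. All the lists together still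
    have aleph_1 entries, and largeness of [x] provides a [y] that avoids
    them and [b0]. *)
Lemma large_refine D x e (a : nat -> seq pt) b0 : inside e D -> (forall k, inside (a k) D) ->
  large D x e -> exists y, [/\ eqo e x y, atomic (D `|` pts y),
    forall k, large D y (e ++ a k) & ~ eqs D b0 (take m y)].
Proof.
move=> eD aD xL; have [mx _] := xL.
pose bad (i : nat * W * nat) y := [/\ eqo e x y, At i.1.2 ((e ++ a i.1.1) ++ y),
  orb i.1.2 ((e ++ a i.1.1) ++ y) = i.2 & ~ large D y (e ++ a i.1.1)].
have /choice_rel[b bP] : forall i, exists b : W -> seq pt, forall y, bad i y ->
    atomic (D `|` pts y) -> exists w, eqs D (b w) (take m y).
  move=> [[k dl] n]; have [[y0 [/= xy0 A0 o0 nl]]|h] := pselect (exists y, bad (k, dl, n) y); last first.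
    by exists (fun=> [::]) => y yb; case: h; exists y.
  have [b bP] : exists b : W -> seq pt, ~ exists y, [/\ eqo (e ++ a k) y0 y, atomic (D `|` pts y) & forall w, ~ eqs D (b w) (take m y)].
    apply: contrapT => H; apply: nl; split; first by rewrite -(eqo_size xy0).
    by move=> b; apply: contrapT => nb; apply: H; exists b.
  exists b => y [/= xy Ay oy _] Dy; apply: contrapT => nw; apply: bP; exists y; split=> //.
    apply/eqo_cat; have [|u ua uE] := orb_inj A0 Ay _ (etrans o0 (esym oy)).
      by rewrite !size_cat -(eqo_size xy0) -(eqo_size xy).
    by exists u.
  by move=> w h; apply: nw; exists w.
have IW : embeds (option ((nat * W * nat) * W)) W.
  have [c cI] : embeds ((nat * W * nat) * W) W.
    apply: (embeds_pair W1); last by exists id.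
    apply: (embeds_pair W1); last exact: embeds_nat.
    by apply: (embeds_pair W1); [exact: embeds_nat|exists id].
  by apply: embeds_trans (embeds_option W1); exists (omap c); exact: inj_omap.
have [y [xy Dy ny]] := @large_index _ D x e (fun i => if i is Some i then b i.1 i.2 else b0) IW xL.
exists y; split=> //; last exact: (ny None).
move=> k; apply: contrapT => nl.
have [dl ldl Ay] : AtS ((e ++ a k) ++ y).
  have [_ DA] := Dy; apply: DA; apply/inside_cat; split; last by move=> z; right.
  by apply/inside_cat; split=> z h; left; [exact: eD|exact: (aD k)].
have [|w h] := bP (k, dl, orb dl ((e ++ a k) ++ y)) y _ Dy; first by split.
exact: (ny (Some ((k, dl, orb dl ((e ++ a k) ++ y)), w)) h).
Qed.

(** Extend the base so that it contains a copy [e2] of [e'] over [e].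
    Largeness passes to the bigger base, and [large_refine] finds an
    extension that is large over [e ++ e2]; then move [e2] to [e']. *)
Lemma ample_extend x e e' : ample x e -> AtS (e ++ e') -> exists x', eqo e x x' /\ ample x' (e ++ e').
Proof.
move=> [a [D [Fa bD eD xL]]] /(AtS_F a)[b [Fb ab Ae]].
have [e2 [D' [ee2 bD' DD' eD']]] := base_embed W1 cov (F_lev Fb) (atomicAt_le (ltW ab) bD.1) eD Ae.
have D'A : atomic D' := atomicAt_atomic (F_lev Fb) bD'.1.
have eD2 : inside e D' by exact: inside_sub eD.
have [y [xy _ yL _]] := @large_refine D' x e (fun=> e2) [::] eD2 (fun=> eD')
  (large_push Fa bD DD' D'A eD xL).
have [t ta [te tE]] := ee2; have [v [va tv vt]] := aut_inv ta.
have ve : fixes v e := fixes_inv tv te.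
exists (map v y); split.
  by apply: eqo_trans xy _; exists v.
have -> : e ++ e' = map v (e ++ e2) by rewrite map_cat ((fixes_map v e).1 ve) -tE (mapK tv).
apply: ample_aut => //; exists b, D'; split=> //; [exact/inside_cat|exact: (yL 0%N)].
Qed.

(** Of two refinements, the second avoids the type of the first over [D];
    the difference is seen over a finite tuple of [D]. *)
Lemma ample_split x e : ample x e -> exists e' x0 x1,
  [/\ eqo e x x0 /\ eqo e x x1, ample x0 (e ++ e'), ample x1 (e ++ e') &
      ~ eqo (e ++ e') (take m x0) (take m x1)].
Proof.
move=> [a [D [Fa bD eD xL]]]; have [l [lD lE]] := lists_enum bD.1.1.
have [y0 [xy0 _ L0 _]] := large_refine [::] eD lD xL.
have [y1 [xy1 _ L1 n1]] := large_refine (take m y0) eD lD xL.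
have [e' [e'D ne]] : exists e', inside e' D /\ ~ eqo e' (take m y0) (take m y1).
  by apply: contrapT => H; apply: n1 => e' e'D; apply: contrapT => ne; apply: H; exists e'.
have [k kE] := lE e' e'D.
exists e', y0, y1; split=> //.
- by exists a, D; split=> //; [exact/inside_cat|rewrite -kE].
- by exists a, D; split=> //; [exact/inside_cat|rewrite -kE].
- by move=> h; apply: ne; apply: eqo_sub h => z ze; rewrite mem_cat ze orbT.
Qed.

Lemma ample_rcons x y e : ample x e -> AtS (x ++ y ++ e) -> ample (x ++ y) e.
Proof.
move=> [a [D [Fa bD eD [mx xL]]]] Axy; exists a, D; split=> //.
split=> [|b]; first by rewrite size_cat (leq_trans mx) ?leq_addr.
have [x' [xx' Dx' nx']] := xL b; have [t ta [te tx]] := xx'.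
have [||y' [yy' Dy']] := @atomic_ext _ _ W1 cov _ (D `|` pts x') (x' ++ e) (map t y) Dx'.
- by apply/inside_cat; split=> z; [right|left; exact: eD].
- apply: AtS_sub (AtS_aut ta Axy) => z; rewrite !map_cat !mem_cat tx ((fixes_map t e).1 te).
  by case/orP=> [/orP[->//|->]|->]; rewrite !orbT.
have [u ua [ue uy]] := yy'; have [ux ue'] := (fixes_cat _ _ _).1 ue.
exists (x' ++ y'); split.
- exists (u \o t); first exact: aut_comp.
  by split; [exact: fixes_comp|rewrite map_comp !map_cat tx ((fixes_map u x').1 ux) uy].
- apply: atomic_sub Dy' => z [Dz|]; first by left; left.
  by rewrite /pts /= mem_cat => /orP[zx|zy]; [left; right|right].
- by move=> w; rewrite takel_cat -?(eqo_size xx') //; exact: nx'.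
Qed.

(** The levels where [ample_extend] and [ample_split] find witnesses
    isolated at the same level. *)
Record witness_level (a : W) : Prop := WitnessLevel {
  wl_F : F a;
  wl_extend : forall x e e', At a (x ++ e) -> At a (e ++ e') -> ample x e ->
    exists x', [/\ eqo e x x', ample x' (e ++ e') & At a (x' ++ e ++ e')];
  wl_split : forall x e, At a (x ++ e) -> ample x e -> exists e' x0 x1,
    [/\ eqo e x x0 /\ eqo e x x1, ample x0 (e ++ e') /\ At a (x0 ++ e ++ e'),
        ample x1 (e ++ e') /\ At a (x1 ++ e ++ e') & ~ eqo (e ++ e') (take m x0) (take m x1)] }.

Lemma AtS2 x y : AtS x -> AtS y -> exists a, At a x /\ At a y.
Proof.
move=> [a _ Ax] [b _ By]; exists (Order.max a b).
by split; [apply: At_le Ax|apply: At_le By]; rewrite le_max lexx ?orbT.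
Qed.

(** Up to conjugacy, instances at level [b] are described by sizes and orbit
    codes, so that countably many bounds serve for all of them. Closure
    points of these bounds are witness levels, as tuples isolated at a limit
    level are isolated below it. *)
Lemma witness_club : exists2 E, club E & forall a, E a -> witness_level a.
Proof.
pose data b (i : nat * nat * nat * nat * nat) x e e' :=
  [/\ (size x, size e, size e', orb b (x ++ e), orb b (e ++ e')) = i, At b (x ++ e),
      At b (e ++ e') & ample x e].
have tr b i x e e' y f f' x' : data b i x e e' -> data b i y f f' -> eqo f y x' ->
    exists2 t, aut t & [/\ map t f = e, map t f' = e' & eqo e x (map t x')].
  move=> [<- Ax Ae xb] [[s1 s2 s3 o1 o2] Ay Af yb] yx'.
  have [|u ua uE] := orb_inj Ay Ax _ o1; first by rewrite !size_cat s1 s2.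
  have [|t ta tE] := orb_inj Af Ae _ o2; first by rewrite !size_cat s3 s2.
  move/eqP: uE; rewrite map_cat eqseq_cat ?size_map // => /andP[/eqP ux /eqP ue].
  move/eqP: tE; rewrite map_cat eqseq_cat ?size_map // => /andP[/eqP te /eqP te'].
  exists t => //; split=> //.
  apply: (@eqo_trans _ _ _ _ _ (map t y)); last by rewrite -te; exact: eqo_aut.
  have [v [va uv vu]] := aut_inv ua.
  exists (t \o v); first exact: aut_comp.
  split; last by rewrite -ux map_comp (mapK uv).
  by apply/fixes_map; rewrite -[in LHS]ue map_comp (mapK uv).
have /choice_rel[l lP] : forall bi : W * (nat * nat * nat * nat * nat), exists c, forall x e e',
    data bi.1 bi.2 x e e' -> exists x', [/\ eqo e x x', ample x' (e ++ e') & At c (x' ++ e ++ e')].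
  move=> [b i] /=; have [[y [f [f' h]]]|h] := pselect (exists y f f', data b i y f f'); last first.
    by exists b => x e e' h'; case: h; exists x, e, e'.
  have [_ _ Af yb] := h.
  have [|x' [yx' x'b]] := @ample_extend y f f' yb.
    have [c lc bc] := lev_gt G b; exists c => //; apply: At_le Af; exact: ltW.
  have [c _ Ac] := ample_At x'b; exists c => x e e' h'.
  have [t ta [te te' ex]] := tr _ _ _ _ _ _ _ _ _ h' h yx'.
  exists (map t x'); split=> //; first by rewrite -te -te' -map_cat; exact: ample_aut.
  rewrite -te -te' -!map_cat; apply: At_aut => //; apply: At_sub Ac _ => z.
  by rewrite !mem_cat => /orP[->|/orP[->|->]]; rewrite ?orbT.
have /choice_rel[k kP] : forall bi : W * (nat * nat * nat * nat * nat), exists c, forall x e,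
    data bi.1 bi.2 x e [::] -> exists e' x0 x1,
    [/\ eqo e x x0 /\ eqo e x x1, ample x0 (e ++ e') /\ At c (x0 ++ e ++ e'),
        ample x1 (e ++ e') /\ At c (x1 ++ e ++ e') & ~ eqo (e ++ e') (take m x0) (take m x1)].
  move=> [b i] /=; have [[y [f h]]|h] := pselect (exists y f, data b i y f [::]); last first.
    by exists b => x e h'; case: h; exists x, e.
  have [_ _ Af yb] := h.
  have [f' [y0 [y1 [[yy0 yy1] b0 b1 n01]]]] := ample_split yb.
  have [c [A0 A1]] := AtS2 (ample_At b0) (ample_At b1); exists c => x e h'.
  have [t ta [te _ ex0]] := tr _ _ _ _ _ _ _ _ _ h' h yy0.
  have ex1 : eqo e x (map t y1).
    apply: eqo_trans ex0 _; rewrite -te; apply: eqo_aut => //.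
    exact: eqo_trans (eqo_sym yy0) yy1.
  exists (map t f'), (map t y0), (map t y1); rewrite -te -!map_cat -!map_take.
  split=> //; rewrite ?te //.
  - split; first exact: ample_aut.
    apply: At_aut => //; apply: At_sub A0 _ => z.
    by rewrite !mem_cat => /orP[->|/orP[->|->]]; rewrite ?orbT.
  - split; first exact: ample_aut.
    apply: At_aut => //; apply: At_sub A1 _ => z.
    by rewrite !mem_cat => /orP[->|/orP[->|->]]; rewrite ?orbT.
  - by move/(eqo_autE _ _ _ ta).
exists (F `&` cl_pts (fun b => range (fun i => l (b, i)) `|` range (fun i => k (b, i)))).
  apply: clubI => //; apply: cl_pts_club => // b.
  by apply: countable_setU; exact: countable_range.
move=> a [Fa [_ acl]]; have lim : is_limit a by case: (F1 Fa).
split=> // [x e e' Ax Ae xb|x e Ax xb].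
  have [b1 b1a A1] := At_limit lim Ax; have [b2 b2a A2] := At_limit lim Ae.
  pose b := Order.max b1 b2; have ba : b < a by rewrite gt_max b1a.
  have [|x' [h1 h2 h3]] := lP (b, (size x, size e, size e', orb b (x ++ e), orb b (e ++ e'))) x e e'.
    by split=> //; [apply: At_le A1|apply: At_le A2]; rewrite le_max lexx ?orbT.
  exists x'; split=> //; apply: At_le h3; apply: ltW; apply: (acl b ba); left; by eexists.
have [b ba A1] := At_limit lim Ax.
have [|e' [x0 [x1 [h1 [h2 h2'] [h3 h3'] h4]]]] := kP (b, (size x, size e, 0%N, orb b (x ++ e), orb b (e ++ [::]))) x e.
  by split=> //; rewrite cats0; apply: At_sub A1 _ => z ze; rewrite mem_cat ze orbT.
have la : k (b, (size x, size e, 0%N, orb b (x ++ e), orb b (e ++ [::]))) <= a.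
  by apply: ltW; apply: (acl b ba); right; eexists.
by exists e', x0, x1; split=> //; split=> //; [apply: At_le h2'|apply: At_le h3'].
Qed.
End Large.

(** * Iterated generic extensions *)

Section Iterated.
Context {d : Order.disp_t} {W : orderType d} (W1 : is_omega1 W)
  (cov : cov_meager_ge_succ W) (G : frame W).
Notation pt := (pt G).
Notation aut := (aut G).
Implicit Types (A B D : set pt) (x y e : seq pt) (w p q f : seq (pt * nat)) (sg : seq W).

Context (F : set W) (F1 : F `<=` limit_level G) (m : nat) (E : set W)
  (Ewl : forall a, E a -> witness_level G F m a).

Local Notation ample := (@ample _ _ G F m).
Local Notation "sg `_ k" := (nth (w0 W1) sg k).

(** The levels of the steps of an iterated extension of a base of level [a].
    In a [valid] condition the points of tag [k.+1] are added at level
    [sg`_k] and are ample over the points of smaller tags. *)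
Definition levels (a : W) sg := path (fun b c => b <= c) a sg /\ forall b, b \in sg -> E b.

Definition stage sg k w := At (sg`_k) (up k.+1 w) /\ ample (bk k.+1 w) (up k w).

Definition valid B sg w := [/\ all (fun n => (n <= size sg)%N) (tags w), inside (bk 0 w) B &
  forall k, (k < size sg)%N -> stage sg k w].

Lemma stage_act t sg k w : aut t -> stage sg k w -> stage sg k (act t w).
Proof.
by move=> ta [h1 h2]; rewrite /stage !up_act bk_act; split; [exact: At_aut|exact: ample_aut].
Qed.

Lemma valid_act B t sg w : aut t -> fixes t (bk 0 w) -> valid B sg w -> valid B sg (act t w).
Proof.
move=> ta tw [h1 h2 h3]; split; first by rewrite tags_act.
  exact: inside_act_bk0.
by move=> k ks; apply: stage_act => //; exact: h3.
Qed.

Lemma valid_cjg B sg w w' : cjg w w' -> valid B sg w -> valid B sg w'.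
Proof. by move=> [t ta [tw <-]]; exact: valid_act. Qed.

Lemma up0 w : up 0 w = bk 0 w.
Proof. by rewrite /up /bk; congr map; apply: eq_filter => z; rewrite leqn0. Qed.

Lemma up_S k w : up k.+1 w =i up k w ++ bk k.+1 w.
Proof.
move=> z; rewrite mem_cat; apply/idP/orP => [/mapP[[c n] + ->]|[|]].
- rewrite mem_filter /= => /andP[]; rewrite leq_eqVlt => /orP[/eqP-> cw|nk cw].
    by right; apply/mapP; exists (c, k.+1); rewrite ?mem_filter ?eqxx.
  by left; apply/mapP; exists (c, n); rewrite // mem_filter cw andbT; exact: nk.
- exact: up_up.
- exact: bk_up.
Qed.

Lemma levels_le a sg k : levels a sg -> (k < size sg)%N -> a <= sg`_k.
Proof.
move=> [+ _]; elim: sg a k => // b sg IH a [|k] /= /andP[ab h] ks //.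
by apply: le_trans ab _; exact: IH.
Qed.

Lemma levels_mono a sg k : levels a sg -> (k.+1 < size sg)%N -> sg`_k <= sg`_k.+1.
Proof.
move=> [+ _]; elim: sg a k => // b [|c sg] IH a [|k] /= /andP[ab h] ks //.
  by case/andP: h.
exact: (IH b k).
Qed.

Lemma levels_E a sg k : levels a sg -> (k < size sg)%N -> E (sg`_k).
Proof. by move=> [_ H] ks; apply: H; exact: mem_nth. Qed.

Lemma levels_weak a b sg : a <= b -> levels b sg -> levels a sg.
Proof.
move=> ab [h H]; split=> //; case: sg h {H} => //= c sg /andP[bc ->].
by rewrite (le_trans ab bc).
Qed.

(** The points of tag [k.+1] are moved, for each [k] in turn, so as to stay
    ample over the smaller tags and the new points; this is [wl_extend]. *)
Lemma valid_add B a sg w e : levels a sg -> atomicAt a B -> valid B sg w -> inside e B ->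
  exists t, [/\ aut t, fixes t (bk 0 w) & valid B sg (act t w ++ put 0 e)].
Proof.
move=> ls [_ BA] [tw bw sw] eB.
suff key k : (k <= size sg)%N -> exists t, [/\ aut t, fixes t (bk 0 w) &
    forall j, (j < k)%N -> stage sg j (act t w ++ put 0 e)].
  have [t [ta tf st]] := key _ (leqnn _); exists t; split=> //; split=> //.
    by rewrite /tags map_cat all_cat -/(tags _) tags_act tw /=; apply/allP => n /mapP[_ /mapP[z _ ->] ->].
  by rewrite bk_cat bk_put /=; apply/inside_cat; split=> //; exact: inside_act_bk0.
elim: k => [|k IH] ks; first by exists id; split=> //; exact: aut_id.
have [t [ta tf st]] := IH (ltnW ks).
have tfm := (fixes_map _ _).1 tf.
set w' := act t w in st.
have bw' : bk 0 w' = bk 0 w by rewrite bk_act tfm.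
have [Aw' Bw'] : stage sg k w' by apply: stage_act => //; exact: sw.
have Ax : At (sg`_k) (bk k.+1 w' ++ up k w').
  by apply: At_sub Aw' _ => z; rewrite mem_cat up_S mem_cat orbC.
have Ae : At (sg`_k) (up k w' ++ e).
  case: k ks st Aw' Bw' Ax {IH} => [|k] ks st Aw' Bw' Ax.
    apply: At_le (levels_le ls ks) _; apply: BA; apply/inside_cat; split=> //.
    by rewrite up0 bw'.
  have [h _] := st k (ltnSn _); apply: At_le (levels_mono ls ks) _.
  by rewrite up_cat up_put /= in h.
have [x' [xx' x'b x'A]] := wl_extend (Ewl (levels_E ls ks)) Ax Ae Bw'.
have [u ua [ue ux]] := xx'.
exists (u \o t); rewrite (act_comp u t) -/w'.
have ubk : fixes u (bk 0 w').
  by apply: fixes_sub ue; rewrite -up0; exact: up_up.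
split; first exact: aut_comp.
  by apply: (fixes_comp _ tf); rewrite -bw'.
have uup j : (j <= k)%N -> up j (act u w') = up j w'.
  by move=> jk; rewrite up_act; apply/fixes_map; apply: fixes_sub ue; exact: up_up.
move=> j; rewrite ltnS leq_eqVlt => /orP[/eqP->|jk].
  rewrite /stage !up_cat !up_put bk_cat bk_put /= cats0 bk_act ux (uup k) //.
  split=> //. apply: At_sub x'A _ => z.
  rewrite mem_cat up_S !mem_cat (uup k) // bk_act ux.
  by case/orP=> [/orP[->|->]|->]; rewrite ?orbT.
have := st j jk; rewrite /stage !up_cat !bk_cat !uup ?(ltnW jk) //.
suff -> : bk j.+1 (act u w') = bk j.+1 w' by [].
by rewrite bk_act; apply/fixes_map; apply: fixes_sub ue; exact: bk_up.
Qed.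

Lemma valid_At B a sg w : levels a sg -> atomicAt a B -> valid B sg w -> At (last a sg) (els w).
Proof.
move=> ls [_ BA] [tw bw sw]; rewrite -(up_all tw).
case: (lastP sg) ls sw => [|sg' b] ls sw; first by rewrite up0; exact: BA.
rewrite last_rcons size_rcons; have [|h _] := sw (size sg'); first by rewrite size_rcons.
by rewrite nth_rcons ltnn eqxx in h.
Qed.

(** No condition for an iterated extension of [B] forces its tuple [y] to
    realise the type of [x] over [A]: some stronger condition has points [e]
    of tag 0 where the types differ. Iterations are allowed so that the
    property passes from [B] to its generic extensions ([good_union]). *)
Definition good a B (A : set pt) x := forall sg, levels a sg -> forall w, valid B sg w ->
  forall y, {subset y <= els w} -> exists t f e,
    [/\ aut t, fixes t (bk 0 w), valid B sg (act t w ++ f),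
        inside e A /\ {subset e <= bk 0 (act t w ++ f)} & ~ eqo e (map t y) x].

Lemma index_map_aut s y y' (t : pt -> pt) : injective t -> {subset y <= s} ->
  {subset y' <= map t s} ->
  map (index^~ s) y = map (index^~ (map t s)) y' -> y' = map t y.
Proof.
move=> tI; elim: y y' => [|z y IH] [|z' y'] //= ys ys' [h h']; congr cons.
  have zs : z \in s by apply: ys; rewrite mem_head.
  have zs' : z' \in map t s by apply: ys'; rewrite mem_head.
  by rewrite -(nth_index z zs) h -(nth_map _ z') ?nth_index // -(size_map t) index_mem.
by apply: IH h' => c ce; [apply: ys|apply: ys']; rewrite inE ce orbT.
Qed.

Lemma aut_inj (t : pt -> pt) : aut t -> injective t.
Proof. by move=> ta; have [v [_ tv _]] := aut_inv ta; exact: can_inj tv. Qed.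

(** If [x] is not good, a condition forces its tuple [y] to realise the type
    of [x]. This type over [A] depends only on the condition up to conjugacy
    and on the positions of [y] in it, since all of [A] can be added at tag
    0; and there are aleph_1 many such descriptions. *)
Lemma not_good_few a B A : atomicAt a B -> A `<=` B ->
  exists b : W -> seq pt, forall x, ~ good a B A x -> exists v, eqs A (b v) x.
Proof.
move=> aB AB; have [c cI] := countable_code aB.1.
pose data (i : seq W * (seq nat * seq nat * nat * seq nat)) x := exists w y,
  [/\ levels a i.1 /\ valid B i.1 w, {subset y <= els w},
      (tags w, map c (bk 0 w), orb (last a i.1) (els w), map (index^~ (els w)) y) = i.2 &
      forall t f e, aut t -> fixes t (bk 0 w) -> valid B i.1 (act t w ++ f) -> inside e A ->
        {subset e <= bk 0 (act t w ++ f)} -> eqo e (map t y) x].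
have dex x : ~ good a B A x -> exists i, data i x.
  move=> ng; apply: contrapT => nd; apply: ng => sg ls w vw y yw.
  apply: contrapT => H; apply: nd.
  exists (sg, (tags w, map c (bk 0 w), orb (last a sg) (els w), map (index^~ (els w)) y)).
  exists w, y; split=> // t f e ta tf vt eA ef; apply: contrapT => ne.
  by apply: H; exists t, f, e.
have dun i x x' : data i x -> data i x' -> eqs A x x'.
  case: i => sg i [w [y [/= [ls vw] yw Ei H]]] [w' [y' [/= [_ vw'] yw' Ei' H']]] e eA.
  move: Ei'; rewrite -Ei => -[Et Eb Eo Ey].
  have bE : bk 0 w = bk 0 w'.
    by have [_ h _] := vw; have [_ h' _] := vw'; exact: map_code_inj cI h h' (esym Eb).
  have [r ra [rf rE]] := cjg_orb (valid_At ls aB vw) (valid_At ls aB vw') (esym Et) bE (esym Eo).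
  have yE : y' = map r y.
    by apply: (index_map_aut (aut_inj ra) yw); rewrite -els_act rE //; rewrite Ey.
  have [t [ta tf tv]] := valid_add ls aB vw (inside_sub AB eA).
  have [v [va rv vr]] := aut_inv ra.
  have eb u : {subset e <= bk 0 (u ++ put 0 e)}.
    by move=> z ze; rewrite bk_cat bk_put mem_cat ze orbT.
  have e1 := H t (put 0 e) e ta tf tv eA (eb _).
  have aE : act (t \o v) w' = act t w by rewrite (act_comp t v) -rE (actK rv).
  have := H' (t \o v) (put 0 e) e; rewrite aE yE map_comp (mapK rv) => e2.
  apply: eqo_trans (eqo_sym e1) (e2 _ _ tv eA (eb _)); first exact: aut_comp.
  apply: fixes_comp; first by rewrite -bE.
  by rewrite -bE; apply: fixes_inv rv rf.
have [e eP] : exists e : W -> seq W * (seq nat * seq nat * nat * seq nat), forall i, exists v, e v = i.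
  apply: embeds_enum; first by constructor; exact: ([::], ([::], [::], 0%N, [::])).
  apply: (embeds_pair W1); [exact: (embeds_seq W1)|exact: (embeds_count W1)].
have /choice_rel[b bP] : forall v, exists x, forall x', data (e v) x' -> eqs A x x'.
  move=> w; have [[x dx]|h] := pselect (exists x, data (e w) x).
    by exists x => x'; exact: dun.
  by exists [::] => x' dx'; case: h; exists x'.
exists b => x /dex[i dx]; have [w wi] := eP i; exists w; apply: bP.
by rewrite wi.
Qed.

Lemma E_F a : E a -> F a. Proof. by move=> /Ewl[]. Qed.
Lemma E_lev a : E a -> lev G a. Proof. by move=> /E_F/F1[]. Qed.

Lemma stage_eq sg k w w' : bk k.+1 w = bk k.+1 w' -> up k w =i up k w' ->
  stage sg k w -> stage sg k w'.
Proof.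
move=> bE uE [h1 h2]; split; last by rewrite -bE; exact: ample_perm uE h2.
by apply: At_sub h1 _ => z; rewrite !up_S !mem_cat bE uE.
Qed.

(** A condition for an iteration [dl :: sg] over [B] becomes a condition for
    [sg] over the first extension by lowering tags: points of tag 1 turn
    into base points. Raising the tags of a condition over the extension
    goes back, without the base points. *)
Definition lower w := [seq (z.1, z.2.-1) | z <- w].
Definition raise w := [seq (z.1, z.2.+1) | z <- w & (0 < z.2)%N].

Lemma up_lower j w : up j (lower w) = up j.+1 w.
Proof.
rewrite /up /lower filter_map -map_comp; congr map; apply: eq_filter => -[z n] /=.
by case: n.
Qed.

Lemma bk_lower j w : bk j.+1 (lower w) = bk j.+2 w.
Proof.
rewrite /bk /lower filter_map -map_comp; congr map; apply: eq_filter => -[z n] /=.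
by case: n.
Qed.

Lemma stage_lower dl sg j w : stage (dl :: sg) j.+1 w <-> stage sg j (lower w).
Proof. by rewrite /stage !up_lower bk_lower. Qed.

Lemma act_lower t w : act t (lower w) = lower (act t w).
Proof. by rewrite /act /lower -!map_comp. Qed.

Lemma act_raise t w : act t (raise w) = raise (act t w).
Proof. by rewrite /act /raise filter_map -!map_comp. Qed.

Lemma bk_raise j w : bk j.+2 (raise w) = bk j.+1 w.
Proof.
rewrite /bk /raise filter_map -map_comp -filter_predI; congr map; apply: eq_filter => -[z n] /=.
by rewrite eqSS; case: n => //= n; rewrite andbT.
Qed.

Lemma up_raise j w : up j w =i bk 0 w ++ up j.+1 (raise w).
Proof.
move=> z; rewrite mem_cat; apply/idP/orP => [/mapP[[c n]]|[|/mapP[[c n]]]].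
- rewrite mem_filter /= => /andP[nj cw] ->; case: n => [|n] in nj cw *.
    by left; apply/mapP; exists (c, 0%N); rewrite // mem_filter.
  right; apply/mapP; exists (c, n.+2); rewrite // mem_filter /=; apply/andP; split=> //.
  by apply/mapP; exists (c, n.+1); rewrite // mem_filter.
- exact: bk_up.
- rewrite mem_filter /= => /andP[nj /mapP[[c' n'] + [-> E']]] ->.
  rewrite mem_filter /= => /andP[_ cw]; apply/mapP; exists (c', n') => //.
  by rewrite mem_filter cw andbT /= -ltnS -E'.
Qed.

Lemma tags_raise w : all (leq 2) (tags (raise w)).
Proof.
apply/allP => n /mapP[[c k] /mapP[[c' k'] + [_ ->]] ->] /=.
by rewrite mem_filter /= => /andP[].
Qed.

Lemma tags_raise_le w n : all (fun k => (k <= n)%N) (tags w) -> all (fun k => (k <= n.+1)%N) (tags (raise w)).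
Proof.
move=> /allP h; apply/allP => k /mapP[[c l] /mapP[[c' k'] + [_ ->]] ->] /=.
rewrite mem_filter /= ltnS => /andP[_ cw]; apply: h; by apply/mapP; exists (c', k').
Qed.

Lemma bk_high j w : all (leq 2) (tags w) -> (j < 2)%N -> bk j w = [::].
Proof.
move=> /allP h j2; rewrite /bk (_ : seq.filter _ _ = [::]) //.
apply/eqP; rewrite -(negbK (_ == _)) -has_filter; apply/hasPn => z zw.
by have := h z.2 (map_f _ zw); apply: contraTN => /eqP->; rewrite -ltnNge.
Qed.

Lemma up_high j w : all (leq 2) (tags w) -> (j < 2)%N -> up j w = [::].
Proof.
move=> /allP h j2; rewrite /up (_ : seq.filter _ _ = [::]) //.
apply/eqP; rewrite -(negbK (_ == _)) -has_filter; apply/hasPn => z zw.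
have := h z.2 (map_f _ zw); apply: contraTN => zj; rewrite -ltnNge.
exact: leq_ltn_trans zj _.
Qed.

Lemma bk_low j k w : all (fun n => (n <= k)%N) (tags w) -> (k < j)%N -> bk j w = [::].
Proof.
move=> /allP h j2; rewrite /bk (_ : seq.filter _ _ = [::]) //.
apply/eqP; rewrite -(negbK (_ == _)) -has_filter; apply/hasPn => z zw.
have := h z.2 (map_f _ zw); apply: contraTN => /eqP->; by rewrite -ltnNge.
Qed.

Lemma up_low j k w : all (fun n => (n <= k)%N) (tags w) -> (k <= j)%N -> up j w = els w.
Proof.
move=> /allP h kj; apply: up_all; apply/allP => n /h nk; exact: leq_trans kj.
Qed.

Lemma tags_cat w w' : tags (w ++ w') = tags w ++ tags w'.
Proof. exact: map_cat. Qed.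

Lemma valid_eq B sg w w' : (forall j, bk j w = bk j w') -> valid B sg w -> valid B sg w'.
Proof.
move=> bE [h1 h2 h3]; split; last 2 first.
- by rewrite -bE.
- move=> k ks; apply: stage_eq (h3 k ks) => //.
  elim: k {ks} => [|k IH] z; first by rewrite !up0 bE.
  by rewrite !up_S !mem_cat IH bE.
apply/allP => n /mapP[[c k] cw ->] /=.
have : c \in bk k w by rewrite bE; apply/mapP; exists (c, k); rewrite // mem_filter /= eqxx.
move=> /mapP[[c' k'] + _]; rewrite mem_filter /= => /andP[/eqP-> cw'].
by move/allP: h1; apply; apply/mapP; exists (c', k).
Qed.

Lemma base_realise a D s x : base a D -> inside s D -> At a (s ++ x) ->
  exists2 t, aut t & fixes t s /\ inside (map t x) D.
Proof.
move=> bD sD; elim/last_ind: x => [|x z IH] Ax; first by exists id; [exact: aut_id|].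
have [|t ta [ts tx]] := IH.
  by apply: At_sub Ax _ => c; rewrite !mem_cat mem_rcons inE => /orP[->//|->]; rewrite !orbT.
have [||z' Dz' [u ua [us [uz]]]] := bD.2 (s ++ map t x) (t z).
- exact/inside_cat.
- by have := At_aut ta Ax; rewrite map_cat map_rcons ((fixes_map t s).1 ts) -cats1 catA.
have [us1 us2] := (fixes_cat _ _ _).1 us.
exists (u \o t); first exact: aut_comp.
split; first exact: fixes_comp.
rewrite map_rcons -cats1; apply/inside_cat; split; last by rewrite /= uz; exact: inside1.
by rewrite map_comp (fixes_map u (map t x)).1.
Qed.

Section Density.
Context (a dl : W) (B : set pt) (Edl : E dl) (adl : a <= dl) (bB : base a B).

Definition cond p := valid B [:: dl] p.

(** A condition [p ++ z] for the iteration [dl :: sg], where [p] is a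
    condition for its first step and [z] consists of the points of later
    steps, together with a tuple [y]; the parameters describe [z] and [y] up
    to conjugacy, by aleph_1 many possibilities. *)
Definition data sg (tz : seq nat) (n : nat) (ps : seq nat) p z y :=
  [/\ tags z = tz /\ all (leq 2) (tags z), valid B (dl :: sg) (p ++ z),
      orb (last dl sg) (els (p ++ z)) = n &
      {subset y <= els (p ++ z)} /\ map (index^~ (els (p ++ z))) y = ps].

(** The task of a generic chain that keeps [x] good: some [z] and [y] of the
    given description over the first [k] entries are such that a stronger
    condition [p ++ z ++ f] distinguishes [y] from [x] over [A]. *)
Definition refuted sg k tz n ps A x : set (seq (pt * nat)) := [set p | (k <= size p)%N /\
  exists z y f e, [/\ data sg tz n ps (take k p) z y, all (leq 2) (tags f), valid B (dl :: sg) (p ++ z ++ f),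
    inside e A /\ {subset e <= bk 0 p} & ~ eqo e y x]].

Lemma condE p : cond p <-> [/\ all (fun n => (n <= 1)%N) (tags p), inside (bk 0 p) B,
  At dl (els p) & ample (bk 1 p) (bk 0 p)].
Proof.
split=> [[h1 h2 /(_ 0%N isT)[]]|[h1 h2 h3 h4]].
  by rewrite /= up0 up_all.
by split=> // -[|//] _; rewrite /stage /= up0 up_all.
Qed.

Lemma take_act t k p : take k (act t p) = act t (take k p).
Proof. by rewrite /act map_take. Qed.

Lemma bk_take k j p : {subset bk j (take k p) <= bk j p}.
Proof. by move=> z; rewrite -{2}(cat_take_drop k p) bk_cat mem_cat => ->. Qed.

Lemma data_act sg tz n ps p z y t : aut t -> fixes t (bk 0 p) -> data sg tz n ps p z y ->
  data sg tz n ps (act t p) (act t z) (map t y).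
Proof.
move=> ta tp [[h1 h2] h3 h4 [h5 h6]]; rewrite /data -act_cat els_act tags_act; split=> //.
- by apply: valid_act => //; rewrite bk_cat (bk_high h2) // cats0.
- by rewrite orb_aut.
- split; first by move=> _ /mapP[c /h5 cz ->]; exact: map_f.
  rewrite -h6 -map_comp; apply/eq_in_map => c /h5 cz /=.
  by rewrite index_map //; exact: aut_inj.
Qed.

Lemma refuted_cjg sg k tz n ps A x p q : cjg p q ->
  refuted sg k tz n ps A x p -> refuted sg k tz n ps A x q.
Proof.
move=> [t ta [tf <-]] [kp [z [y [f [e [h1 h2 h3 [h4 h5] h6]]]]]]; split; first by rewrite size_act.
have z2 : all (leq 2) (tags z) by case: h1 => -[].
exists (act t z), (map t y), (act t f), e; split.
- by rewrite take_act; apply: data_act => //; apply: fixes_sub tf; exact: bk_take.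
- by rewrite tags_act.
- rewrite -!act_cat; apply: valid_act => //.
  by rewrite !bk_cat (bk_high z2) // (bk_high h2) // !cats0.
- by split=> //; rewrite bk_act ((fixes_map _ _).1 tf).
- move=> h; apply: h6; apply: eqo_trans h; exists t => //; split=> //.
  exact: fixes_sub tf.
Qed.

(** The points [z], added over the first [k] entries of [p], are first moved
    to a condition over all of [p]; this is [valid_add] for the lowered
    iteration, with the points of [p] as base points. Goodness over [B] for
    the iteration [dl :: sg] then gives the refutation. *)
Lemma refuted_dense sg k tz n ps A x p z y : good a B A x -> levels dl sg -> cond p -> (k <= size p)%N ->
  data sg tz n ps (take k p) z y -> exists q, [/\ extendable p q, cond q & refuted sg k tz n ps A x q].
Proof.
move=> gA ls Cp kp dz; have [p1 pB pA pb] := (condE p).1 Cp.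
have [[tzE z2] zv zo [yz yi]] := dz; set p0 := take k p in zv zo yz yi.
have p0p : {subset p0 <= p} by move=> c; exact: mem_take.
have p01 : all (fun n => (n <= 1)%N) (tags p0).
  by apply/allP => j /mapP[c /p0p cp ->]; move/allP: p1; apply; exact: map_f.
have els0 : {subset els p0 <= els p} by move=> c /mapP[c' /p0p cp ->]; exact: map_f.
pose B' := pts (els p).
have B'A : atomicAt dl B'.
  split; first exact: countable_mem.
  by move=> s sB; apply: At_sub pA _ => c /sB.
have lowv : valid B' sg (lower (p0 ++ z)).
  have [v1 v2 v3] := zv; split.
  - apply/allP => j /mapP[c /mapP[c' cz ->] ->] /=.
    by move/allP: v1 => /(_ c'.2 (map_f _ cz)) /=; case: (c'.2).
  - rewrite -up0 up_lower up_cat (up_high z2) // cats0 (up_low p01) //.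
  - by move=> j js; apply/(stage_lower dl); exact: v3.
have [t [ta tf tv]] := valid_add ls B'A lowv (fun c cp => cp : B' c).
have tp0 : fixes t (els p0).
  by move: tf; rewrite -up0 up_lower up_cat (up_high z2) // cats0 (up_low p01).
have actp0 : act t p0 = p0.
  by apply: els_tags_eq; [rewrite els_act; exact/fixes_map|exact: tags_act].
have tz2 : all (leq 2) (tags (act t z)) by rewrite tags_act.
have v1 : valid B (dl :: sg) (p ++ act t z).
  split.
  - rewrite tags_cat all_cat tags_act; apply/andP; split.
      by apply: sub_all p1 => j j1; exact: leq_trans j1 _.
    by have [+ _ _] := zv; rewrite tags_cat all_cat => /andP[].
  - by rewrite bk_cat (bk_high tz2) // cats0.
  - move=> [_|j js].
      apply: (@stage_eq _ _ p); rewrite ?bk_cat ?up_cat ?(bk_high tz2) ?(up_high tz2) ?cats0 //.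
      by have [_ _ /(_ 0%N isT)] := Cp.
    apply/(stage_lower dl); have [_ _ /(_ j js)] := tv; apply: stage_eq.
      rewrite act_lower bk_cat bk_put /= cats0.
      by rewrite !bk_lower act_cat !bk_cat actp0 (bk_low p01) // (bk_low p1).
    move=> c; rewrite act_lower up_cat up_put /= !up_lower act_cat !up_cat actp0 !mem_cat.
    rewrite (up_low p01) // (up_low p1) //; case: (c \in els p) (els0 c) => h; rewrite ?orbT // orbF.
    by case: (c \in els p0) h => // /(_ isT).
have lv : levels a (dl :: sg).
  by have [h1 h2] := ls; split=> /=; [rewrite adl|move=> b; rewrite inE => /orP[/eqP->|/h2]].
have [|t2 [f [e [t2a t2f t2v [eA ef] ne]]]] := gA _ lv _ v1 (map t y).
  move=> _ /mapP[c /yz + ->]; rewrite !els_cat !mem_cat els_act => /orP[cp|cz].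
    by rewrite tp0 // els0.
  by rewrite map_f // orbT.
(* Points of tag at most 1 extend the condition for the first step, and the
   others extend its later part. *)
pose f1 := [seq c <- f | (c.2 <= 1)%N]; pose f2 := [seq c <- f | (1 < c.2)%N].
have bf1 j : bk j f1 = if (j <= 1)%N then bk j f else [::].
  rewrite /bk /f1 -filter_predI; case: ifP => j1.
    congr map; apply: eq_filter => c /=; by case: eqP => //= ->.
  rewrite (_ : seq.filter _ _ = [::]) // -(filter_pred0 f); apply: eq_filter => c /=.
  by case: eqP => //= ->.
have bf2 j : bk j f2 = if (j <= 1)%N then [::] else bk j f.
  rewrite /bk /f2 -filter_predI; case: ifP => j1.
    rewrite (_ : seq.filter _ _ = [::]) // -(filter_pred0 f); apply: eq_filter => c /=.
    by case: eqP => //= ->; rewrite ltnNge j1.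
  congr map; apply: eq_filter => c /=; by case: eqP => //= ->; rewrite ltnNge j1.
have f22 : all (leq 2) (tags f2).
  by apply/allP => j /mapP[c + ->]; rewrite mem_filter => /andP[].
have f11 : all (fun n => (n <= 1)%N) (tags f1).
  by apply/allP => j /mapP[c + ->]; rewrite mem_filter => /andP[].
have t2p : fixes t2 (bk 0 p) by move: t2f; rewrite bk_cat (bk_high tz2) // cats0.
pose q := act t2 p ++ f1; pose z' := act t2 (act t z).
have z'2 : all (leq 2) (tags z') by rewrite !tags_act.
have q1 : all (fun n => (n <= 1)%N) (tags q) by rewrite tags_cat all_cat tags_act p1.
have qv : valid B (dl :: sg) (q ++ z' ++ f2).
  apply: valid_eq t2v => j; rewrite act_cat /q /z' !bk_cat bf1 bf2 -!catA.
  by case: ifP => j1 //; rewrite (@bk_high j (act t2 (act t z)) z'2 j1) !cats0.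
have q0 : bk 0 q = bk 0 (act t2 (p ++ act t z) ++ f).
  by rewrite act_cat /q !bk_cat bf1 /= (bk_high z'2) // cats0.
exists q; split.
- by exists t2, f1.
- have [_ h2 h3] := qv; split=> //.
    by rewrite q0; case: t2v.
  move=> [|//] _; have := h3 0%N isT; apply: stage_eq; rewrite ?bk_cat ?up_cat.
    by rewrite (bk_high z'2) // (bk_high f22) // !cats0.
  by rewrite (up_high z'2) // (up_high f22) // !cats0.
- split; first by rewrite size_cat size_act (leq_trans kp) ?leq_addr.
  exists z', (map t2 (map t y)), f2, e; split=> //.
    have -> : take k q = act t2 (act t p0) by rewrite actp0 takel_cat ?size_act // take_act.
    apply: data_act => //; first by rewrite actp0; apply: fixes_sub t2p; exact: bk_take.
    by apply: data_act => //; apply: fixes_sub tp0; exact: bk_sub.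
  by split=> // c /ef; rewrite -q0.
Qed.
End Density.

Lemma els_up0 w : els w =i bk 0 w ++ els (raise w).
Proof.
move=> z; rewrite -(up_all (k := \max_(n <- tags w) n)); last first.
  by apply/allP => n nw; apply: leq_bigmax_seq.
rewrite (up_raise _ w) !mem_cat; congr (_ || _); congr (_ \in _).
apply: up_all; apply: tags_raise_le; by apply/allP => n nw; apply: leq_bigmax_seq.
Qed.

(** A condition over the union of the chain is, after the points of some [e
    k] have been added at tag 0, the lowered form of a condition [e k ++ z].
    The chain has performed the task of refuting a [z'] of the same
    description, and [z] and [z'] are conjugate over [e k]. *)
Lemma good_union dl B (e : nat -> seq (pt * nat)) A x : E dl -> atomicAt dl B ->
  (forall n, cond dl B (e n)) -> (forall n, prefix (e n) (e n.+1)) ->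
  base dl (union_els e) ->
  (forall sg k z y, levels dl sg ->
     data dl B sg (tags z) (orb (last dl sg) (els (e k ++ z))) (map (index^~ (els (e k ++ z))) y) (e k) z y ->
     exists n, refuted dl B sg (size (e k)) (tags z) (orb (last dl sg) (els (e k ++ z)))
       (map (index^~ (els (e k ++ z))) y) A x (e n)) ->
  good dl (union_els e) A x.
Proof.
move=> Edl BA eC eS bB' H sg ls w vw y yw.
have [w1 wB ws] := vw.
have [k kP] := union_els_fin eS wB.
have [e1 eB eA eb] := (condE dl B (e k)).1 (eC k).
have ekB' : inside (els (e k)) (union_els e) by move=> c ce; exists k.
have [t1 [t1a t1f t1v]] := valid_add ls bB'.1 vw ekB'.
(* The move [t1] lets all points of [e k] serve as base points; [z] is the part
   of the condition above [e k]. *)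
set w2 := act t1 w in t1v; pose z := raise w2.
have z2 : all (leq 2) (tags z) by exact: tags_raise.
have bw2 : bk 0 w2 = bk 0 w by rewrite bk_act; apply/fixes_map.
have zv : valid B (dl :: sg) (e k ++ z).
  split.
  - rewrite tags_cat all_cat; apply/andP; split.
      by apply: sub_all e1 => j j1; exact: leq_trans j1 _.
    by apply: tags_raise_le; rewrite tags_act.
  - by rewrite bk_cat (bk_high z2) // cats0.
  - move=> [_|j js].
      apply: (@stage_eq _ _ (e k)); rewrite ?bk_cat ?up_cat ?(bk_high z2) ?(up_high z2) ?cats0 //.
      by have [_ _ /(_ 0%N isT)] := eC k.
    apply/(stage_lower dl); have [_ _ /(_ j js)] := t1v; apply: stage_eq.
      by rewrite bk_cat bk_put /= cats0 bk_lower bk_cat bk_raise (bk_low e1).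
    move=> c; rewrite up_cat up_put /= up_lower up_cat !mem_cat (up_raise j w2) mem_cat bw2.
    rewrite (up_low e1) //; case: (boolP (c \in bk 0 w)) => [/kP ->|_]; rewrite ?orbT //=.
    by rewrite orbC.
pose y1 := map t1 y.
have y1z : {subset y1 <= els (e k ++ z)}.
  move=> _ /mapP[c /yw cw ->]; rewrite els_cat mem_cat.
  have : t1 c \in els w2 by rewrite els_act map_f.
  by rewrite (els_up0 w2) mem_cat bw2 => /orP[/kP->//|->]; exact: orbT.
have [|n [kn [z' [y' [f [e0 [[[tz _] zv' zo' [yz' yi']] f2 qv [e0A e0n] ne]]]]]]] := H sg k z y1 ls.
  by split.
rewrite take_chain // in zv' zo' yz' yi'.
have lv : levels dl (dl :: sg).
  by have [h1 h2] := ls; split=> /=; [rewrite lexx|move=> b; rewrite inE => /orP[/eqP->|/h2]].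
have [u ua [uf uE]] : cjg (e k ++ z) (e k ++ z').
  apply: cjg_orb (valid_At lv BA zv) (valid_At lv BA zv') _ _ _.
  - by rewrite !tags_cat tz.
  - by rewrite !bk_cat (bk_high z2) // (bk_high (w := z')) // tz.
  - by rewrite /= zo'.
have /eqP := uE; rewrite act_cat eqseq_cat ?size_act // => /andP[/eqP uek /eqP uz].
have ufe : fixes u (els (e k)) by apply/fixes_map; rewrite -els_act uek.
have y'E : y' = map u y1.
  by apply: (index_map_aut (aut_inj ua) y1z); rewrite -els_act uE.
have z'2 : all (leq 2) (tags z') by rewrite tz.
have utf : fixes (u \o t1) (bk 0 w).
  by apply: fixes_comp => //; apply: fixes_sub ufe => c /kP.
have ubw : map u (bk 0 w) = bk 0 w.
  by apply/fixes_map; apply: fixes_sub ufe => c /kP.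
have [en1 enB _ _] := (condE dl B (e n)).1 (eC n).
exists (u \o t1), (put 0 (els (e n)) ++ lower f), e0; split=> //.
- exact: aut_comp.
- rewrite (act_comp u t1) -/w2; split.
  + rewrite !tags_cat !all_cat !tags_act w1 /=; apply/andP; split.
      by apply/allP => j /mapP[_ /mapP[c _ ->] ->].
    apply/allP => j /mapP[c /mapP[c' cz ->] ->] /=.
    have [/allP h _ _] := qv; have := h c'.2; rewrite !tags_cat !mem_cat /=.
    by rewrite (map_f _ cz) !orbT => /(_ isT); case: (c'.2).
  + rewrite !bk_cat bk_act bw2; apply/inside_cat; split.
      by rewrite ubw.
    apply/inside_cat; split; first by rewrite bk_put /= => c ce; exists n.
    by rewrite -up0 up_lower (up_high f2).
  + move=> j js; have [_ _ /(_ j.+1 js)] := qv; move/(stage_lower dl); apply: stage_eq.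
      rewrite bk_lower !bk_cat bk_put /= bk_lower (bk_low en1) //= -uz bk_act bk_raise.
      by rewrite bk_act.
    move=> c; rewrite up_lower !up_cat up_put /= up_lower (up_low en1) // !mem_cat.
    rewrite (up_raise j (act u w2)) -act_raise -/z uz mem_cat bk_act bw2 ubw.
    case: (boolP (c \in bk 0 w)) => [/kP cek|_] /=; last by rewrite orbCA.
    have -> // : c \in els (e n).
    by rewrite -(cat_take_drop (size (e k)) (e n)) take_chain // els_cat mem_cat cek.
- by split=> // c ce; rewrite !bk_cat bk_put /= !mem_cat (bk_sub (e0n c ce)) orbT.
- by rewrite map_comp -/y1 -y'E.
Qed.

Definition separated (x : seq pt) : set (seq (pt * nat)) := [set p | exists2 c,
  {subset c <= bk 0 p} & ~ eqo c x (take m (bk 1 p))].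

Lemma separated_cjg x p q : cjg p q -> separated x p -> separated x q.
Proof.
move=> [t ta [tf <-]] [c cp nx]; exists c; first by rewrite bk_act ((fixes_map _ _).1 tf).
move=> h; apply: nx; apply: eqo_trans h _; apply: eqo_sym; exists t => //.
by rewrite bk_act map_take; split=> //; exact: fixes_sub tf.
Qed.

(** Two continuations of the root given by [wl_split] have different types
    over a tuple that can be moved into [B], so one of them differs from
    [x]. *)
Lemma separated_dense dl B x p : E dl -> base dl B -> cond dl B p ->
  exists q, [/\ extendable p q, cond dl B q & separated x q].
Proof.
move=> Edl bB /(condE dl B)[p1 pB pA pb].
have Ax : At dl (bk 1 p ++ bk 0 p).
  by apply: At_sub pA _ => c; rewrite els_bk01 // !mem_cat orbC.
have [e' [y0 [y1 [[e0 e1] [b0 A0] [b1 A1] ny]]]] := wl_split (Ewl Edl) Ax pb.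
have [|t ta [tp tB]] := base_realise bB pB (x := e').
  by apply: At_sub A0 _ => c; rewrite !mem_cat => ->; rewrite orbT.
have tpm : map t (bk 0 p) = bk 0 p by apply/fixes_map.
have [y [py yb Ay ny']] : exists y, [/\ eqo (bk 0 p) (bk 1 p) y, ample y (bk 0 p ++ map t e'),
    At dl (y ++ bk 0 p ++ map t e') & ~ eqo (bk 0 p ++ map t e') x (take m y)].
  have st y : eqo (bk 0 p) (bk 1 p) y -> ample y (bk 0 p ++ e') -> At dl (y ++ bk 0 p ++ e') ->
      [/\ eqo (bk 0 p) (bk 1 p) (map t y), ample (map t y) (bk 0 p ++ map t e') &
        At dl (map t y ++ bk 0 p ++ map t e')].
    move=> h1 h2 h3; split; first by apply: eqo_trans h1 _; exists t.
      by have := ample_aut ta h2; rewrite map_cat tpm.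
    by have := At_aut ta h3; rewrite !map_cat tpm.
  have [h1 h2 h3] := st y0 e0 b0 A0; have [k1 k2 k3] := st y1 e1 b1 A1.
  have [h|h] := pselect (eqo (bk 0 p ++ map t e') x (take m (map t y0))); last first.
    by exists (map t y0).
  exists (map t y1); split=> // h'; apply: ny; apply/(eqo_autE _ _ _ ta).
  rewrite map_cat tpm !map_take; exact: eqo_trans (eqo_sym h) h'.
have [u ua [uf uE]] := py.
have q0 : bk 0 (act u p ++ put 0 (map t e')) = bk 0 p ++ map t e'.
  by rewrite bk_cat bk_put bk_act /=; congr cat; apply/fixes_map.
have q1 : bk 1 (act u p ++ put 0 (map t e')) = y by rewrite bk_cat bk_put /= cats0 bk_act.
exists (act u p ++ put 0 (map t e')); split.
- by exists u, (put 0 (map t e')).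
- apply/condE; rewrite q0 q1; split=> //.
  + rewrite tags_cat all_cat tags_act p1 /=; by apply/allP => j /mapP[_ /mapP[c _ ->] ->].
  + exact/inside_cat.
  + apply: At_sub Ay _ => c; rewrite els_cat els_put !mem_cat els_act -uE.
    rewrite -{1}((fixes_map u (bk 0 p)).1 uf) => /orP[|->]; last by rewrite !orbT.
    move=> /mapP[c' + ->]; rewrite els_bk01 // mem_cat => /orP[h|h]; rewrite (map_f u h) ?orbT //.
- by exists (bk 0 p ++ map t e'); rewrite ?q0 ?q1.
Qed.

Context (x0 : seq pt) (x0b : ample x0 [::]) (x0A : forall a, E a -> At a x0).

(** One generic chain performs the tasks of containing the points of [B],
    the Henkin tasks, the refutations that keep the types in [Q] good, and
    the separations of its root from the types [b v] over [B]. The root,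
    which starts as a part of [x0], is the tuple [x']. *)
Lemma generic_extension a dl B (Q : set (set pt * seq pt)) (b : W -> seq pt) :
  E dl -> a <= dl -> base a B -> countable Q -> (forall r, Q r -> good a B r.1 r.2) ->
  exists B' x', [/\ base dl B', B `<=` B', inside x' B', forall r, Q r -> good dl B' r.1 r.2 &
     a = dl -> forall v, ~ eqs B (b v) x'].
Proof.
move=> Edl adl bB Qc Qg.
have aB : atomicAt dl B by exact: atomicAt_le adl bB.1.
pose I := ({z | B z} + nat * nat + {r | Q r} * (seq W * (nat * seq nat * nat * seq nat)) + W)%type.
pose Dn (i : I) : set (seq (pt * nat)) := match i with
  | inl (inl (inl z)) => [set p | (sval z, 0%N) \in p]
  | inl (inl (inr i)) => henkin dl i
  | inl (inr (r, (sg, (k, tz, n, ps)))) => refuted dl B sg k tz n ps (sval r).1 (sval r).2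
  | inr v => separated (b v) end.
have IW : embeds I W.
  apply: (embeds_either W1); last by exists id.
  apply: (embeds_either W1).
    by apply: (embeds_either W1); [exact: (embeds_set W1 bB.1.1)|exact: (embeds_count W1)].
  apply: (embeds_pair W1); first exact: (embeds_set W1).
  by apply: (embeds_pair W1); [exact: (embeds_seq W1)|exact: (embeds_count W1)].
have Cinv : cjginv (cond dl B) by move=> p q pq; exact: valid_cjg.
have Cp0 : cond dl B (put 1 x0).
  apply/condE; rewrite !bk_put /= els_put; split=> //; last exact: x0A.
  by apply/allP => j /mapP[_ /mapP[c _ ->] ->].
have [|||e [_ eC eS eD]] := @generic_dec _ _ cov G B (cond dl B) dl I Dn _ bB.1.1 IW Cinv _ _ _ Cp0.
- by move=> p [].
- by move=> p /condE[].
- move=> [[[z|i]|[q [sg [[[k tz] n] ps]]]]|v] p q' pq [Cp Dp]; split; try exact: Cinv pq Cp.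
  + case: pq => t ta [tf <-]; apply/mapP; exists (sval z, 0%N) => //=.
    by congr pair; rewrite tf //; apply/mapP; exists (sval z, 0%N) => //; rewrite mem_filter.
  + exact: henkin_cjg pq Dp.
  + exact: refuted_cjg pq Dp.
  + exact: separated_cjg pq Dp.
have eE n := (condE dl B (e n)).1 (eC n).
have bB' : base dl (union_els e).
  apply: henkin_base => //; first exact: E_lev.
    by move=> n; case: (eE n).
  move=> [k c] j /= kj; apply: (eD (inl (inl (inr (k, c)))) j) => p Cp /size_prefix jp.
  have [p1 pB pA pb] := (condE dl B p).1 Cp.
  have [|q [<-|[y Ay ->]] Hq] := @henkin_dense _ _ G dl p k c (E_lev Edl) pA; first by rewrite kj.
    by exists p; split=> //; have := extendable_cat p [::]; rewrite cats0.
  exists (p ++ [:: (y, 1%N)]); split=> //; first exact: extendable_cat.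
  apply/condE; rewrite !bk_cat /= cats0; split=> //.
  + by rewrite tags_cat all_cat p1.
  + by rewrite els_cat.
  + apply: (ample_rcons W1 cov (F := F)) => //.
    exists dl; first exact: E_lev.
    by apply: At_sub Ay _ => c'; rewrite !mem_cat els_bk01 // mem_cat => /orP[->|/orP[->|->]]; rewrite ?orbT.
have sz n : (m <= size (bk 1 (e n)))%N by have [_ _ _ /ample_size] := eE n.
have root n : take m (bk 1 (e n)) = take m (bk 1 (e 0%N)).
  have /prefixP[f ->] := prefix_le eS (leq0n n).
  by rewrite bk_cat takel_cat.
exists (union_els e), (take m (bk 1 (e 0%N))); split=> //.
- move=> z Bz; have [|n zn] := eD (inl (inl (inl (exist _ z Bz)))) 0%N; last first.
    by exists n; apply/mapP; exists (z, 0%N).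
  move=> p Cp _.
  have zB : inside [:: z] B by exact: inside1.
  have ls : levels dl [:: dl] by split=> /=; [rewrite lexx|move=> c; rewrite inE => /eqP->].
  have [t [ta tf tv]] := valid_add ls aB Cp zB.
  exists (act t p ++ put 0 [:: z]); split=> //; first by exists t, (put 0 [:: z]).
  by rewrite /Dn /= mem_cat mem_head orbT.
- by move=> c /mem_take cb; exists 0%N; exact: bk_sub cb.
- move=> q Qq; apply: (good_union Edl aB eC eS bB') => sg k z y ls dz.
  apply: (eD (inl (inr (exist _ q Qq, (sg, (size (e k), tags z, _, _))))) k) => p Cp kp.
  have T : take (size (e k)) p = e k by have /prefixP[f ->] := kp; rewrite take_size_cat.
  apply: (@refuted_dense a dl B Edl adl _ _ _ _ _ _ _ p z y (Qg q Qq) ls Cp (size_prefix kp)).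
  by rewrite T.
- move=> adl' v h; have [|n [c cn nc]] := eD (inr v) 0%N.
    by move=> p Cp _; apply: separated_dense => //; rewrite -adl'.
  apply: nc; rewrite root; apply: h => z /cn; have [_ h _ _] := eE n; exact: h.
Qed.
End Iterated.

(** * A club of levels without splitting *)

Section NonsplitCase.
Context {d : Order.disp_t} {W : orderType d} (W1 : is_omega1 W)
  (cov : cov_meager_ge_succ W) (Phi : weak_diamond_star W) (G : frame W).
Notation pt := (pt G).
Notation aut := (aut G).
Implicit Types (s : state G) (f g : W -> bool) (A B D M N : set pt) (x y : seq pt).

(** An isomorphism preserves types, and [t] moves the type of [x] in the
    same way over [A]. *)
Lemma realised_iso M N h k t A x : tp_iso M N h k -> A `<=` M -> aut t ->
  (forall z, A z -> t z = h z) -> (exists2 y, inside y M & eqs A y x) ->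
  exists2 y, inside y N & eqs (h @` A) y (map t x).
Proof.
move=> [i1 i2 i3 i4 i5] AM ta tA [y yM yx].
exists (map h y); first by move=> _ /mapP[z /yM/i1 ? ->].
move=> e eA; pose e0 := map k e.
have e0A : inside e0 A.
  move=> _ /mapP[z /eA[z' Az' <-] ->]; rewrite i3 ?inE //; exact: AM.
have he : map h e0 = e.
  rewrite -map_comp -[RHS]map_id; apply/eq_in_map => z /eA[z' Az' <-] /=.
  by rewrite i3 // inE; exact: AM.
have te : map t e0 = e.
  by rewrite -he; apply/eq_in_map => z /e0A/tA.
apply: (@eqo_trans _ _ _ _ _ (map t y)); last by rewrite -te; apply: eqo_aut => //; exact: yx.
apply/eqo_cat; apply: (@eqo_trans _ _ _ _ _ (e0 ++ y)).
  apply: eqo_sym; rewrite -{1}he -map_cat; apply: i5; apply/inside_cat; split=> // z /e0A; exact: AM.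
by exists t => //; split=> //; rewrite map_cat te.
Qed.

Context (F : set W) (Fc : club F) (F1 : F `<=` limit_level G)
  (m : nat) (E : set W) (Ec : club E) (Ewl : forall a, E a -> witness_level G F m a).
Context (x0 : seq pt) (x0b : ample F m x0 [::]) (x0A : forall a, E a -> At a x0).

Local Notation valid := (valid W1 (G := G) F m).
Local Notation good := (good W1 (G := G) F m E).

Lemma E_limit_level a : E a -> limit_level G a. Proof. by move=> /Ewl[/F1]. Qed.

Lemma valid_le B D sg w : B `<=` D -> valid B sg w -> valid D sg w.
Proof. by move=> BD [h1 h2 h3]; split=> //; exact: inside_sub h2. Qed.

(** A tuple in the base is itself a condition, with all points of tag 0, and
    no stronger condition can refute that it has its own type. *)
Lemma good_not_realised a B A x : atomicAt a B -> good a B A x -> ~ exists2 y, inside y B & eqs A y x.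
Proof.
move=> aB gA [y yB yx].
have ls : levels E a [::] by split.
have vy : valid B [::] (put 0 y).
  split=> //; last by rewrite bk_put.
  by apply/allP => n /mapP[_ /mapP[z _ ->] ->].
have [|t [f [e [ta tf _ [eA _] ne]]]] := gA _ ls _ vy y; first by rewrite els_put.
apply: ne; rewrite (fixes_map t y).1; last by rewrite bk_put in tf.
exact: yx.
Qed.

Definition promise_state : set (state G) := [set s | [/\ E (lv s), base (lv s) (bas s), countable (prm s) &
  forall r, prm s r -> good (lv s) (bas s) r.1 r.2]].

(** A condition over the union has its points of tag 0 in some member of the
    chain, where the promise is kept. *)
Lemma promise_state_sup (K : set (state G)) : K !=set0 -> countable K -> K `<=` promise_state -> total_on K (@sle _ _ G) ->
  promise_state (ssup W1 K).
Proof.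
move=> K0 Kc KV Kt; have [s1 Ks1] := K0; split.
- apply: lubW_club => //; [by exists (lv s1), s1|exact: countable_image|].
  by move=> _ [t /KV[? _ _ _] <-].
- by apply: sup_base => // t /KV[/E_limit_level[_ ?] ? _ _].
- by apply: bigcup_countable => // t /KV[].
- move=> r [s Ks sr] sg ls w vw y yw; have [w1 wB ws] := vw.
  have [t Kt_ tw] := chain_fin Kt K0 wB.
  have [u [Ku su tu]] : exists u, [/\ K u, sle s u & sle t u].
    by have [h|h] := Kt s t Ks Kt_; [exists t|exists s]; split=> //; exact: sle_refl.
  have [_ _ _ ug] := KV u Ku; have [_ _ h3] := su; have [_ k2 _] := tu.
  have [l1 l2 _] := ssup_ub W1 Kc Ku.
  have vu : valid (bas u) sg w by split=> //; exact: inside_sub tw.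
  have [t' [f [e [ta tf tv [eA ef] ne]]]] := ug r (h3 _ sr) sg (levels_weak l1 ls) w vu y yw.
  by exists t', f, e; split=> //; exact: valid_le tv.
Qed.

Lemma promise_state_extend s a (b : W -> seq pt) : promise_state s -> E a -> lv s <= a -> exists t x,
  [/\ promise_state t /\ lv t = a, sle s t, inside x (bas t), prm t = prm s &
      lv s = a -> forall v, ~ eqs (bas s) (b v) x].
Proof.
move=> [Es bs ps gs] Ea sa.
have [B [x [bB sB xB gB nb]]] :=
  generic_extension cov F1 Ewl x0b x0A b Ea sa bs ps gs.
exists (State a B (prm s)), x; split=> //; by do ?split.
Qed.

(** Only aleph_1 many types over [bas s] are not good. The generic extension
    realises a type outside this list; as the type is good it may also be
    promised instead. *)
Lemma promise_state_undecided s : promise_state s -> exists x t1 t0,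
  [/\ promise_state t1 /\ sle s t1, promise_state t0 /\ sle s t0, realised_in t1 (bas s) x,
      forall u, promise_state u -> sle t0 u -> ~ realised_in u (bas s) x &
      exists2 z, bas t1 z & ~ bas s z].
Proof.
move=> Vs; have [Es bs ps gs] := Vs.
have [b bP] := not_good_few W1 Ewl bs.1 (@subset_refl _ (bas s)).
have [t [x [[Vt lt] st xt pt nb]]] := promise_state_extend b Vs Es (lexx _).
have gx : good (lv s) (bas s) (bas s) x.
  by apply: contrapT => /bP[v]; exact: nb.
exists x, t, (State (lv s) (bas s) (prm s `|` [set (bas s, x)])); split.
- by split.
- split; last by split=> // r; left.
  split=> //=; first by apply: countable_setU => //; exact: countable1.
  by move=> r [/gs//|->].
- by exists x => //; exact: eqs_refl.
- move=> u [_ bu _ gu] [_ _ pu]; apply: good_not_realised bu.1 _.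
  by apply: (gu (bas s, x)); apply: pu; right.
- apply: contrapT => H; apply: (good_not_realised bs.1 gx); exists x; last exact: eqs_refl.
  move=> z zx; apply: contrapT => nz; apply: H; exists z => //; exact: xt.
Qed.

Lemma promise_state_class : state_class W1 promise_state.
Proof.
split; first by move=> s [/E_limit_level[? _] ? _ _].
  exact: promise_state_sup.
move=> s a Vs; have [x [t1 [_ [[V1 s1] _ _ _ [z z1 nz]]]]] := promise_state_undecided Vs.
have [b Eb] := Ec.1 (Order.max a (lv t1)); rewrite gt_max => /andP[ab tb].
have [t [_ [[Vt lt] tt _ _ _]]] := promise_state_extend (fun=> [::]) V1 Eb (ltW tb).
exists t; split=> //; [exact: sle_trans tt|by rewrite lt|].
by exists z => //; have [_ h _] := tt; exact: h.
Qed.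

(** At a stable state a realisable type stays so, and hence cannot be
    promised. *)
Lemma reach_not_good s A x : promise_state s -> stable promise_state s A -> reach promise_state s A x -> ~ good (lv s) (bas s) A x.
Proof.
move=> Vs sA rx gx; have [Es bs ps gs] := Vs.
pose t := State (lv s) (bas s) (prm s `|` [set (A, x)]).
have Vt : promise_state t.
  split=> //=; first by apply: countable_setU => //; exact: countable1.
  by move=> r [/gs//|->].
have st : sle s t by split=> // r; left.
have [u [[_ bu _ gu] [_ _ pu] ru]] := sA t Vt st x rx.
by apply: (good_not_realised bu.1 (gu (A, x) _)) ru; apply: pu; right.
Qed.

Lemma realised_eqs s A x y : eqs A x y -> realised_in s A x -> realised_in s A y.
Proof. by move=> xy [z zs zx]; exists z => //; exact: eqs_trans xy. Qed.

(** At every stage the state is extended by realising or promising a type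
    over it, and made stable. By [reach_not_good] and [not_good_few] the
    types over the trunk that can be realised then are at most aleph_1 many,
    and bookkeeping realises each of them along the branch. So the set of
    types over the trunk that are realised in the union is determined by the
    bit at this stage. *)
Lemma many_models_nonsplitting : many_models G.
Proof.
have VP := promise_state_class.
have [//|stab] := stable_or_many Phi VP.
have [a0 Ea0 _] := Ec.1 (w0 W1).
have [|B0 bB0 _] := @base_ext _ _ W1 cov G a0 set0 (E_limit_level Ea0).1.
  split; first exact: countable0.
  move=> [|z x] h; first exact: At_nil (E_limit_level Ea0).1.
  by have := h z (mem_head _ _).
pose s0 := State a0 B0 set0.
have V0 : promise_state s0 by split=> //; exact: countable0.
have bc s : promise_state s -> countable (bas s) by case=> _ [[]].
have /choice_rel[ch chP] : forall s, exists r : state G * state G,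
    promise_state s ->
    [/\ promise_state r.1 /\ sle s r.1, promise_state r.2 /\ sle s r.2, stable promise_state r.1 (bas s), stable promise_state r.2 (bas s) &
      exists2 x, reach promise_state r.1 (bas s) x & ~ reach promise_state r.2 (bas s) x].
  move=> s; have [Vs|?] := pselect (promise_state s); last by exists (s, s).
  have [x [t1 [t0 [[Vt1 st1] [Vt0 st0] r1 r0 _]]]] := promise_state_undecided Vs.
  have [_ k1 _] := st1; have [_ k0 _] := st0.
  have [u1 [Vu1 tu1 su1]] := stab t1 (bas s) Vt1 (bc s Vs) k1.
  have [u0 [Vu0 tu0 su0]] := stab t0 (bas s) Vt0 (bc s Vs) k0.
  exists (u1, u0) => _; split=> //=.
  - by split=> //; exact: sle_trans st1 tu1.
  - by split=> //; exact: sle_trans st0 tu0.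
  exists x; last by move=> [u [Vu uu ru]]; apply: (r0 u) => //; exact: sle_trans uu.
  by exists u1; split=> //; [exact: sle_refl|exact: realised_le tu1 r1].
have [p pP] := W_tasks W1 (W_inh W1) (ex_intro _ id (fun _ _ => id) : embeds W W).
have /choice_rel[en enP] : forall sA : state G * set pt, exists b : W -> seq pt,
    promise_state sA.1 -> stable promise_state sA.1 sA.2 -> sA.2 `<=` bas sA.1 ->
    forall x, reach promise_state sA.1 sA.2 x -> exists v, eqs sA.2 (b v) x.
  move=> [s A] /=; have [Vs|?] := pselect (promise_state s); last by exists (fun=> [::]).
  have [sA|?] := pselect (stable promise_state s A); last by exists (fun=> [::]).
  have [As|?] := pselect (A `<=` bas s); last by exists (fun=> [::]).
  have [_ bs _ _] := Vs; have [b bP] := not_good_few W1 Ewl bs.1 As.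
  by exists b => _ _ _ x /(reach_not_good Vs sA)/bP.
have /choice_rel[re reP] : forall r : state G * (set pt * seq pt), exists t,
    (promise_state r.1 -> promise_state t /\ sle r.1 t) /\ (reach promise_state r.1 r.2.1 r.2.2 -> realised_in t r.2.1 r.2.2).
  move=> [s [A x]] /=; have [[t [Vt st rt]]|nr] := pselect (reach promise_state s A x).
    by exists t.
  by exists s; split=> // Vs; split=> //; exact: sle_refl.
(* The side chosen by the bit is followed by a realisation of a type over an
   earlier trunk, which the bookkeeping [p] assigns to this stage. *)
pose step (b : W) (h : W -> state G) s (i : bool) :=
  let s1 := if i then (ch s).1 else (ch s).2 in
  let a := (p b).1 in let A := bas (before W1 s0 h a) in
  (re (s1, (A, en (h a, A) (p b).2))).
have stepE b h s i : step b h s i = re (if i then (ch s).1 else (ch s).2,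
  (bas (before W1 s0 h (p b).1), en (h (p b).1, bas (before W1 s0 h (p b).1)) (p b).2)) by [].
have stepP b h s i : promise_state s -> sle s0 s -> promise_state (step b h s i) /\ sle s (step b h s i).
  move=> Vs _; rewrite /step; have [[h1 k1] [h2 k2] _ _ _] := chP s Vs.
  have [V1 ss1] : promise_state (if i then (ch s).1 else (ch s).2) /\ sle s (if i then (ch s).1 else (ch s).2).
    by case: i.
  set s1 := if i then _ else _ in V1 ss1 *.
  set r := (s1, _); have [/(_ V1)[? k] _] := reP r; split=> //; exact: sle_trans k.
pose nd := node W1 promise_state s0 step; pose tr := trunk W1 promise_state s0 step; pose M := model W1 promise_state s0 step.
have Vn f b : promise_state (nd f b) by exact: V_node.
have Vt f b : promise_state (tr f b) by exact: V_trunk.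
pose side f b := if f b then (ch (tr f b)).1 else (ch (tr f b)).2.
have sideP f b : [/\ promise_state (side f b), sle (tr f b) (side f b) & stable promise_state (side f b) (bas (tr f b))].
  by have [[? ?] [? ?] ? ? _] := chP (tr f b) (Vt f b); rewrite /side; case: (f b).
have side_nd f b : sle (side f b) (nd f b).
  apply: sle_trans (step_node VP V0 stepP f b); rewrite /step -/tr -/(side f b).
  have [Vsd _ _] := sideP f b.
  by set r := (side f b, _); have [/(_ Vsd)[_ k] _] := reP r.
have nd_stable f b : stable promise_state (nd f b) (bas (tr f b)).
  have [_ _ h] := sideP f b; exact: stable_le (Vn f b) (side_nd f b) h.
pose I (M : set pt) (A : set pt) : set (seq pt) := [set x | exists2 y, inside y M & eqs A y x].
have key f a : I (M f) (bas (tr f a)) = reach promise_state (side f a) (bas (tr f a)).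
  have [Vsd tsd ssd] := sideP f a.
  apply/seteqP; split=> x.
    move=> /(realised_model VP V0 stepP)[c rc].
    have [e [ae ce]] : exists e, a <= e /\ c <= e.
      by exists (Order.max a c); rewrite !le_max !lexx orbT.
    exists (nd f e); split=> //.
      exact: sle_trans (side_nd f a) (node_le VP V0 stepP f ae).
    exact: realised_le (node_le VP V0 stepP f ce) rc.
  move=> /(stable_reach x ssd (Vn f a) (side_nd f a)) rx.
  have trnd : bas (tr f a) `<=` bas (nd f a).
    by have [_ h _] := sle_trans tsd (side_nd f a).
  have [v vx] := enP (nd f a, bas (tr f a)) (Vn f a) (nd_stable f a) trnd x rx.
  have [b ab pb] := pP a v.
  suff : realised_in (nd f b) (bas (tr f a)) (en (nd f a, bas (tr f a)) v).
    by move=> /(realised_eqs vx) rb; apply/(realised_model VP V0 stepP); exists b.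
  apply: realised_le (step_node VP V0 stepP f b) _.
  have Eb : before W1 s0 (cut W1 promise_state s0 step f b) a = tr f a.
    by apply: before_loc => c ca; rewrite /cut (lt_trans ca ab).
  have Ec' : cut W1 promise_state s0 step f b a = nd f a by rewrite /cut ab.
  rewrite stepE pb -[(a, v).1]/a -[(a, v).2]/v Eb Ec' -/(side f b).
  set r := (side f b, _); have [_] := reP r; apply=> /=.
  have [Vsdb tsdb _] := sideP f b.
  apply: (nd_stable f a) => //.
    exact: sle_trans (node_trunk W1 promise_state s0 step f ab) tsdb.
  have [u [Vu nu ru]] := rx; exists u; split=> //.
  by apply: realised_eqs ru; exact: eqs_sym.
apply: (@many_models_diamond _ _ W1 G M (fun f b => bas (nd f b)) I setT) => //.
- exact: stationaryT.
- by move=> f; exact: rich_node.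
- by move=> f b; apply: bc.
- by move=> f b; have [z ? _] := node_new VP V0 stepP f b; exists z.
- by move=> f g b fg; rewrite /nd (node_loc W1 promise_state s0 step fg).
- move=> f; exists (cl_pts (fun=> set0)); first by apply: cl_pts_club => // b; exact: countable0.
  move=> a [[a' a'a] _] _ g fg.
  have ta : tr f a = tr g a by exact: trunk_loc.
  have Ba : \bigcup_(b in [set b | b < a]) bas (nd f b) = bas (tr f a).
    by rewrite /tr (trunk_bas f VP V0 stepP) //; exists a'.
  rewrite Ba key {2}ta key /side -ta; split=> [->//|].
  have [_ _ _ _ [x x1 x2]] := chP (tr f a) (Vt f a).
  case: (f a); case: (g a) => // E'; exfalso; apply: x2; first by rewrite -E'.
  by rewrite E'.
- by move=> f g h k t A iso Ac AM ta tA x; exact: realised_iso iso AM ta tA.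
Qed.
End NonsplitCase.

(** * From crowded sets of types to many models *)

Section Dichotomy.
Context {d : Order.disp_t} {W : orderType d} (W1 : is_omega1 W)
  (cov : cov_meager_ge_succ W) (Phi : weak_diamond_star W) (G : frame W).
Notation pt := (pt G).
Notation aut := (aut G).
Implicit Types (A B D M N : set pt) (x y e : seq pt).

(** A set of atomic types over [D] without isolated points, given by
    realisations. *)
Definition crowded D (P : set (seq pt)) :=
  [/\ P !=set0, forall b, P b -> atomic (D `|` pts b) &
      forall b e, P b -> inside e D -> exists2 b', P b' & eqo e b b' /\ ~ eqs D b b'].

Lemma inside_setU D y s : inside s (D `|` pts y) -> exists2 l, inside l D & {subset s <= l ++ y}.
Proof.
elim: s => [|z s IH] h; first by exists [::].
have [|l lD sl] := IH; first by move=> c cs; apply: h; rewrite inE cs orbT.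
have [Dz|zy] := h z (mem_head _ _).
  exists (z :: l); first by move=> c; rewrite inE => /orP[/eqP->//|/lD].
  by move=> c; rewrite !inE => /orP[->//|/sl ->]; rewrite orbT.
exists l => // c; rewrite inE => /orP[/eqP->|/sl//].
by rewrite mem_cat [z \in y]zy orbT.
Qed.

(** A binary tree in [P]. A node is a tuple [b] with a parameter tuple [e];
    both successors keep the type of [b] over [e] and they differ over a
    longer parameter tuple. The parameters along a branch exhaust [D], and
    [straighten] realises the limit. *)
Lemma crowded_cantor D P : countable D -> crowded D P -> exists (b0 : seq pt) (y : (nat -> bool) -> seq pt),
  P b0 /\ forall r, [/\ eqo [::] b0 (y r), atomic (D `|` pts (y r)) &
     forall r', r <> r' -> ~ eqs D (y r) (y r')].
Proof.
move=> Dc [[b0 Pb0] PA Pc]; have [l [lD lE]] := lists_enum Dc.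
have /choice_rel[sp spP] : forall be : seq pt * seq pt, exists bc : seq pt * seq pt,
    P be.1 -> inside be.2 D -> [/\ P bc.1, inside bc.2 D, eqo be.2 be.1 bc.1 & ~ eqo bc.2 be.1 bc.1].
  move=> [b e] /=; have [Pb|?] := pselect (P b); last by exists (b, e).
  have [eD|?] := pselect (inside e D); last by exists (b, e).
  have [b' Pb' [bb' nb]] := Pc b e Pb eD.
  have [c [cD nc]] : exists c, inside c D /\ ~ eqo c b b'.
    by apply: contrapT => H; apply: nb => c cD; apply: contrapT => nc; apply: H; exists c.
  by exists (b', c).
pose nd := fix nd (r : nat -> bool) n : seq pt * seq pt := if n is k.+1 then
  let be := nd r k in (if r k then (sp be).1 else be.1, be.2 ++ (sp be).2 ++ l k) else (b0, [::]).
have ndP r n : P (nd r n).1 /\ inside (nd r n).2 D.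
  elim: n => [//|n [IH1 IH2]] /=; have [h1 h2 _ _] := spP (nd r n) IH1 IH2.
  by split; [case: (r n)|apply/inside_cat; split=> //; exact/inside_cat].
have ndS r n : eqo (nd r n).2 (nd r n).1 (nd r n.+1).1.
  have [h1 h2] := ndP r n; have [_ _ h _] := spP (nd r n) h1 h2.
  by rewrite /=; case: (r n) => //; exact: eqo_refl.
pose p r n := put 1 (nd r n).1 ++ put 0 (nd r n).2.
have p0 r n : bk 0 (p r n) = (nd r n).2 by rewrite bk_cat !bk_put.
have p1 r n : bk 1 (p r n) = (nd r n).1 by rewrite bk_cat !bk_put /= cats0.
have pB r n : inside (bk 0 (p r n)) D by rewrite p0; case: (ndP r n).
have act_put (t : pt -> pt) k s : act t (put k s) = put k (map t s).
  by rewrite /act /put -!map_comp.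
have pS r n : exists t f, [/\ aut t, fixes t (bk 0 (p r n)) & p r n.+1 = act t (p r n) ++ f].
  have [t ta [tf tE]] := ndS r n.
  exists t, (put 0 ((sp (nd r n)).2 ++ l n)); rewrite p0; split=> //.
  rewrite /p act_cat !act_put tE ((fixes_map t _).1 tf) -catA /=; congr cat.
  by rewrite /put -map_cat.
have /choice_rel[y yP] : forall r, exists y, forall n, eqo (nd r n).2 (nd r n).1 y.
  move=> r; have [e [eC eS]] := straighten Dc (pB r) (pS r).
  have sz n : size (bk 1 (e n)) = size b0.
    have [t ta [_ <-]] := eC n; rewrite bk_act size_map p1.
    by elim: n => // n <-; rewrite (eqo_size (ndS r n)).
  have cst n : bk 1 (e n) = bk 1 (e 0%N).
    have /prefixP[f E] := prefix_le eS (leq0n n); rewrite E bk_cat.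
    have := sz n; rewrite E bk_cat size_cat sz => /eqP; rewrite -{2}[size b0]addn0 eqn_add2l.
    by move=> /nilP ->; rewrite cats0.
  exists (bk 1 (e 0%N)) => n; have [t ta [tf tE]] := eC n; exists t => //.
  by rewrite -p0; split=> //; rewrite -(cst n) -tE bk_act p1.
exists b0, y; split=> // r; split.
- exact: (yP r 0%N).
- split; first by apply: countable_setU => //; exact: countable_mem.
  move=> s /inside_setU[c cD sc]; have [k kE] := lE c cD.
  have [Pn en] := ndP r k.+1; have [_ A] := PA _ Pn.
  have : AtS ((nd r k.+1).2 ++ (nd r k.+1).1).
    by apply: A; apply/inside_cat; split; [move=> z /en; left|right].
  move=> /(AtS_eqo (yP r k.+1)); apply: AtS_sub => z /sc.
  by rewrite !mem_cat -kE => /orP[->|->]; rewrite ?orbT.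
- move=> r' rr' yy'.
  have [n [lo ne]] : exists n, (forall k, (k < n)%N -> r k = r' k) /\ r n <> r' n.
    have ex : exists n, r n != r' n.
      apply: contrapT => H; apply: rr'; apply/funext => n; apply: contrapT => h.
      by apply: H; exists n; apply/eqP.
    exists (ex_minn ex); case: ex_minnP => n /eqP ne mn; split=> // k kn.
    by apply/eqP; apply: contraTT kn => /mn; rewrite -leqNgt.
  have En : nd r n = nd r' n.
    elim: {ne} n lo => //= n IH lo; rewrite IH ?lo //; by move=> k kn; apply: lo; exact: ltnW.
  have [h1 h2] := ndP r n; have [_ cD _ nc] := spP (nd r n) h1 h2.
  have cs q : {subset (sp (nd q n)).2 <= (nd q n.+1).2}.
    by move=> z zc; rewrite /= !mem_cat zc orbT.
  have e1 := eqo_sub (cs r) (yP r n.+1); have := eqo_sub (cs r') (yP r' n.+1).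
  rewrite /= -En => e2; rewrite /= in e1; have e3 := yy' _ cD.
  have key : eqo (sp (nd r n)).2 (if r n then (sp (nd r n)).1 else (nd r n).1)
      (if r' n then (sp (nd r n)).1 else (nd r n).1).
    exact: eqo_trans e1 (eqo_trans e3 (eqo_sym e2)).
  move: ne key; case: (r n); case: (r' n) => ne k; [by case: ne| |exact: nc k|by case: ne].
  exact: nc (eqo_sym k).
Qed.

(** By [crowded_cantor] there are 2^aleph_0 types over [D]. If no [x] were
    large, those of any given orbit code at any given level would be covered
    by aleph_1 many, and then all by aleph_1 many, against
    [cantor_not_embeds]. *)
Lemma crowded_large D P : countable D -> crowded D P ->
  exists x m, [/\ size x = m, AtS x & large m D x [::]].
Proof.
move=> Dc /(crowded_cantor Dc)[b0 [y [Pb0 yP]]]; pose m := size b0.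
have sy r : size (y r) = m by have [/eqo_size <-] := yP r.
apply: contrapT => nl; apply: (cantor_not_embeds cov).
pose bad (i : W * nat) x := [/\ size x = m, At i.1 x, orb i.1 x = i.2 & atomic (D `|` pts x)].
have AS x : atomic (D `|` pts x) -> AtS x by move=> [_]; apply=> z; right.
have /choice_rel[b bP] : forall i, exists b : W -> seq pt, forall x, bad i x ->
    exists w, eqs D (b w) x.
  move=> [dl n]; have [[x [/= sx Ax ox Dx]]|h] := pselect (exists x, bad (dl, n) x); last first.
    by exists (fun=> [::]) => x xb; case: h; exists x.
  have [b bP] : exists b : W -> seq pt, ~ exists z, [/\ eqo [::] x z, atomic (D `|` pts z) & forall w, ~ eqs D (b w) (take m z)].
    apply: contrapT => H; apply: nl; exists x, m; split=> //; first exact: AS.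
    split; first by rewrite sx.
    by move=> b; apply: contrapT => nb; apply: H; exists b.
  exists b => z [/= sz Az oz Dz]; apply: contrapT => nw; apply: bP; exists z; split=> //.
    have [|u ua uE] := orb_inj Ax Az _ (etrans ox (esym oz)); first by rewrite sx sz.
    by exists u.
  by move=> w h; apply: nw; exists w; rewrite -[z]take_size sz.
have /choice_rel[c cP] : forall r, exists iw : (W * nat) * W, eqs D (b iw.1 iw.2) (y r).
  move=> r; have [_ Dy _] := yP r; have [dl _ Ay] := AS _ Dy.
  have [|w h] := bP (dl, orb dl (y r)) (y r); first by split.
  by exists ((dl, orb dl (y r)), w).
have IW : embeds ((W * nat) * W) W.
  apply: (embeds_pair W1); last by exists id.
  by apply: (embeds_pair W1); [exists id|exact: embeds_nat].
apply: embeds_trans IW; exists c => r r' E; apply: contrapT => ne.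
have [_ _ h] := yP r; apply: (h r' ne); apply: eqs_trans (cP r').
by rewrite -E; apply: eqs_sym.
Qed.

Theorem many_models_crowded :
  (forall K, club K -> exists a D P, [/\ K a, lev G a, base a D & crowded D P]) ->
  many_models G.
Proof.
move=> H.
have [SS|nS] := pselect (stationary (split_level G `&` limit_level G)).
  exact: (many_models_splitting W1 cov Phi).
have [K [Kc nK]] : exists K, club K /\ ~ ((split_level G `&` limit_level G) `&` K !=set0).
  apply: contrapT => h; apply: nS => K Kc; apply: contrapT => nK; apply: h.
  by exists K.
pose F := K `&` limit_level G.
have Fc : club F by apply: clubI => //; exact: limit_level_club.
have F1 : F `<=` limit_level G by move=> a [].
have Fns a : F a -> ~ split_level G a.
  by move=> [Ka la] sa; apply: nK; exists a; split.
have [a [D [P [Fa la bD PD]]]] := H F Fc.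
have [x [m [sx [c lc Ac] xL]]] := crowded_large bD.1.1 PD.
have [E Ec Ewl] := witness_club W1 cov Fc F1 Fns m.
pose E' := E `&` [set b | c < b].
have E'c : club E' by apply: clubI => //; exact: club_gt.
apply: (@many_models_nonsplitting _ _ W1 cov Phi G F F1 m E' E'c _ x).
- by move=> b [/Ewl].
- by exists a, D; split.
- by move=> b [_ /ltW cb]; exact: At_le Ac.
Qed.
End Dichotomy.

(** * First-order syntax *)

Fixpoint tren L V V' (g : V -> V') (t : term L V) : term L V' :=
  match t with
  | Var x => Var (g x)
  | App f ts => App f (fun i => tren g (ts i))
  end.

Fixpoint fren L V V' (g : V -> V') (p : fml L V) : fml L V' :=
  match p with
  | FBot => FBot
  | FEq t u => FEq (tren g t) (tren g u)
  | FRel r ts => FRel r (fun i => tren g (ts i))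
  | FImp p q => FImp (fren g p) (fren g q)
  | FAll p => FAll (fren (omap g) p)
  end.

Definition no_ord (X : Type) (i : 'I_0) : X := False_rect X (notF (ltn_ord i)).

Section Syntax.
Context {L : language}.
Implicit Types (M N : structure L) (V : Type).

Lemma eval_tren M V V' (g : V -> V') (t : term L V) (v : V' -> M) :
  term_eval v (tren g t) = term_eval (v \o g) t.
Proof. by elim: t => //= f ts IH; congr (fint M f _); apply/funext => i; exact: IH. Qed.

Lemma extend_asg_omap (X V V' : Type) (g : V -> V') (v : V' -> X) x :
  extend_asg v x \o omap g = extend_asg (v \o g) x.
Proof. by apply/funext => -[]. Qed.

Lemma sat_fren M V V' (g : V -> V') (p : fml L V) (v : V' -> M) :
  sat (fren g p) v <-> sat p (v \o g).
Proof.
elim: p V' g v => {V} [V|V t u|V r ts|V p IHp q IHq|V p IH] V' g v /=.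
- by [].
- by rewrite !eval_tren.
- by under eq_fun do rewrite eval_tren.
- by rewrite IHp IHq.
- by split=> H x; move: (H x); rewrite IH extend_asg_omap.
Qed.

Definition FEx V (p : fml L (option V)) := FNeg (FAll (FNeg p)).

Lemma sat_ex M V (p : fml L (option V)) (v : V -> M) :
  sat (FEx p) v <-> exists x, sat p (extend_asg v x).
Proof.
split=> [H|[x px] H]; last exact: (H x).
by apply: contrapT => n; apply: H => x px; apply: n; exists x.
Qed.

Definition FAnd V (p q : fml L V) := FNeg (FImp p (FNeg q)).

Lemma sat_and M V (p q : fml L V) (v : V -> M) : sat (FAnd p q) v <-> sat p v /\ sat q v.
Proof.
split=> [H|[pv qv] H]; last exact: (H pv).
by split; apply: contrapT => n; apply: H => pv; [case: n|move=> qv; case: n].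
Qed.

Lemma sat_allfin V k (p : 'I_k -> fml L V) : exists q : fml L V,
  forall M (v : V -> M), sat q v <-> forall i, sat (p i) v.
Proof.
elim: k p => [|k IH] p; first by exists (FNeg FBot) => M v; split=> [_ []//|_ /=].
have [q qP] := IH (fun i => p (lift ord0 i)).
exists (FAnd (p ord0) q) => M v; rewrite sat_and qP; split=> [[h1 h2] i|H]; last by split.
by case: (unliftP ord0 i) => [j|] ->.
Qed.

Lemma sat_exfin V k (p : fml L (V + 'I_k)) : exists q : fml L V,
  forall M (v : V -> M), sat q v <->
    exists w : 'I_k -> M, sat p (fun x => match x with inl y => v y | inr i => w i end).
Proof.
elim: k V p => [|k IH] V p.
  exists (fren (fun x : V + 'I_0 => match x with inl y => y | inr i => no_ord V i end) p).
  move=> M v; rewrite sat_fren; split=> [H|[w]].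
    exists (@no_ord M); move: H; congr (sat p _).
    by apply/funext => -[|[]].
  by congr (sat p _); apply/funext => -[|[]].
pose h (x : V + 'I_k.+1) : option V + 'I_k :=
  match x with inl y => inl (Some y) | inr i => if unlift ord0 i is Some j then inr j else inl None end.
have [q qP] := IH (option V) (fren h p).
exists (FEx q) => M v; rewrite sat_ex; split=> [[x /qP[w]]|[w pw]].
  rewrite sat_fren => H; exists (fun i => if unlift ord0 i is Some j then w j else x).
  move: H; congr (sat p _); apply/funext => -[//|i] /=.
  by case: unlift.
exists (w ord0); apply/qP; exists (fun j => w (lift ord0 j)); rewrite sat_fren.
move: pw; congr (sat p _); apply/funext => -[//|i] /=.
by case: (unliftP ord0 i) => [j|] ->.
Qed.

Lemma eval_support V (t : term L V) : exists k (x : 'I_k -> V), forall M (v v' : V -> M),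
  (forall i, v (x i) = v' (x i)) -> term_eval v t = term_eval v' t.
Proof.
elim: t => [y|f ts IH]; first by exists 1%N, (fun=> y) => M v v' /(_ ord0).
have /choice_rel[n nP] : forall i, exists kx : {k & 'I_k -> V}, forall M (v v' : V -> M),
    (forall j, v (projT2 kx j) = v' (projT2 kx j)) -> term_eval v (ts i) = term_eval v' (ts i).
  by move=> i; have [k [x H]] := IH i; exists (existT _ k x).
pose I := {i : 'I_(far f) & 'I_(projT1 (n i))}.
exists #|{: I}|, (fun c => let j := enum_val c in projT2 (n (tag j)) (tagged j)) => M v v' H /=.
congr (fint M f _); apply/funext => i; apply: nP => j.
have := H (enum_rank (Tagged (fun i => 'I_(projT1 (n i))) j)).
by rewrite enum_rankK.
Qed.

Lemma sat_support V (p : fml L V) : exists k (x : 'I_k -> V), forall M (v v' : V -> M),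
  (forall i, v (x i) = v' (x i)) -> sat p v <-> sat p v'.
Proof.
elim: p => {V} [V|V t u|V r ts|V p [k [x Hp]] q [l [y Hq]]|V p [k [x H]]].
- by exists 0%N, (@no_ord V).
- have [k [x Hx]] := eval_support t; have [l [y Hy]] := eval_support u.
  exists (k + l)%N, (fun i => match fintype.split i with inl j => x j | inr j => y j end).
  move=> M v v' H /=; rewrite (Hx M v v') ?(Hy M v v') // => j.
    by have := H (rshift k j); rewrite (unsplitK (inr j)).
  by have := H (lshift l j); rewrite (unsplitK (inl j)).
- have [k [x Hx]] : exists k (x : 'I_k -> V), forall M (v v' : V -> M),
      (forall i, v (x i) = v' (x i)) -> forall i, term_eval v (ts i) = term_eval v' (ts i).
    have /choice_rel[n nP] : forall i, exists kx : {k & 'I_k -> V}, forall M (v v' : V -> M),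
        (forall j, v (projT2 kx j) = v' (projT2 kx j)) -> term_eval v (ts i) = term_eval v' (ts i).
      by move=> i; have [k [x H]] := eval_support (ts i); exists (existT _ k x).
    pose I := {i : 'I_(rar r) & 'I_(projT1 (n i))}.
    exists #|{: I}|, (fun c => let j := enum_val c in projT2 (n (tag j)) (tagged j)) => M v v' H i.
    apply: nP => j; have := H (enum_rank (Tagged (fun i => 'I_(projT1 (n i))) j)).
    by rewrite enum_rankK.
  exists k, x => M v v' H /=; suff -> : (fun i => term_eval v (ts i)) = (fun i => term_eval v' (ts i)) by [].
  by apply/funext => i; apply: Hx.
- exists (k + l)%N, (fun i => match fintype.split i with inl j => x j | inr j => y j end).
  move=> M v v' H /=; rewrite (Hp M v v') ?(Hq M v v') // => j.
    by have := H (rshift k j); rewrite (unsplitK (inr j)).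
  by have := H (lshift l j); rewrite (unsplitK (inl j)).
- have [[y0]|nV] := pselect (inhabited V).
    exists k, (fun i => odflt y0 (x i)) => M v v' Hv /=.
    have E z : sat p (extend_asg v z) <-> sat p (extend_asg v' z).
      apply: H => i; have := Hv i; by case: (x i).
    by split=> h z; apply/E.
  exists 0%N, (@no_ord V) => M v v' _.
  suff -> : v = v' by []. 
  by apply/funext => y; case: nV.
Qed.

Lemma eval_iso M N (h : M -> N) V (t : term L V) (v : V -> M) :
  (forall f a, h (fint M f a) = fint N f (h \o a)) -> h (term_eval v t) = term_eval (h \o v) t.
Proof.
by move=> hf; elim: t => //= f ts IH; rewrite hf; congr (fint N f _); apply/funext => i; exact: IH.
Qed.

Lemma sat_iso M N (h : M -> N) V (p : fml L V) (v : V -> M) : bijective h ->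
  (forall f a, h (fint M f a) = fint N f (h \o a)) ->
  (forall r a, rint M r a <-> rint N r (h \o a)) -> sat p v <-> sat p (h \o v).
Proof.
move=> hb hf hr; elim: p v => {V} [V|V t u|V r ts|V p IHp q IHq|V p IH] v /=.
- by [].
- rewrite -!eval_iso //; split=> [->//|]; exact: (bij_inj hb).
- rewrite hr; suff -> : h \o (fun i => term_eval v (ts i)) = (fun i => term_eval (h \o v) (ts i)) by [].
  by apply/funext => i /=; rewrite eval_iso.
- by rewrite IHp IHq.
- have E x : h \o extend_asg v x = extend_asg (h \o v) (h x) by apply/funext => -[].
  have [g hg gh] := hb; split=> H x; last by rewrite IH E.
  by have := H (g x); rewrite IH E gh.
Qed.

Fixpoint tsyms V (t : term L V) : set (symbol L) :=
  match t with
  | Var _ => set0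
  | App f ts => [set (inl f : symbol L)] `|` \bigcup_i tsyms (ts i)
  end.

Fixpoint fsyms V (p : fml L V) : set (symbol L) :=
  match p with
  | FBot => set0
  | FEq t u => tsyms t `|` tsyms u
  | FRel r ts => [set (inr r : symbol L)] `|` \bigcup_i tsyms (ts i)
  | FImp p q => fsyms p `|` fsyms q
  | FAll p => fsyms p
  end.

Lemma tsyms_finite V (t : term L V) : finite_set (tsyms t).
Proof.
elim: t => [x|f ts IH] /=; first exact: finite_set0.
rewrite finite_setU; split; first exact: finite_set1.
by apply: bigcup_finite => //; exact: finite_finset.
Qed.

Lemma fsyms_finite V (p : fml L V) : finite_set (fsyms p).
Proof.
elim: p => {V} [V|V t u|V r ts|V p IHp q IHq|V p IH] //=.
- by rewrite finite_setU; split; exact: tsyms_finite.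
- rewrite finite_setU; split; first exact: finite_set1.
  by apply: bigcup_finite => [|i _]; [exact: finite_finset|exact: tsyms_finite].
- by rewrite finite_setU.
Qed.

Context (S : set (symbol L)).

Lemma eval_lift M V (t : term (sublang S) V) (v : V -> M) :
  term_eval v (lift_term t) = @term_eval _ (reduct S M) V v t.
Proof. by elim: t => //= f ts IH; congr (fint M _ _); apply/funext => i; exact: IH. Qed.

Lemma sat_lift M V (p : fml (sublang S) V) (v : V -> M) :
  sat (lift_fml p) v <-> @sat _ (reduct S M) V p v.
Proof.
elim: p v => {V} [V|V t u|V r ts|V p IHp q IHq|V p IH] v /=.
- by [].
- by rewrite !eval_lift.
- suff -> : (fun i => term_eval v (lift_term (ts i))) =
     (fun i => @term_eval _ (reduct S M) V v (ts i)) by [].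
  by apply/funext => i; rewrite eval_lift.
- by rewrite IHp IHq.
- by split=> H x; move: (H x); rewrite IH.
Qed.

Lemma tsyms_lift V (t : term (sublang S) V) : tsyms (lift_term t) `<=` S.
Proof.
elim: t => [y|f ts IH] x /=; first by case.
by move=> [->|[i _ /IH//]]; exact: (svalP f).
Qed.

Lemma fsyms_lift V (p : fml (sublang S) V) : fsyms (lift_fml p) `<=` S.
Proof.
elim: p => {V} [V|V t u|V r ts|V p IHp q IHq|V p IH] //=.
- by move=> x [] /tsyms_lift.
- by move=> x [->|[i _ /tsyms_lift//]]; exact: (svalP r).
- by move=> x [/IHp|/IHq].
Qed.

Lemma lift_term_ex V (t : term L V) : tsyms t `<=` S -> exists u : term (sublang S) V, lift_term u = t.
Proof.
elim: t => [x|f ts IH] /= H; first by exists (Var x).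
have Sf : S (inl f) by apply: H; left.
have /choice_rel[us usP] : forall i, exists u : term (sublang S) V, lift_term u = ts i.
  by move=> i; apply: IH => x xi; apply: H; right; exists i.
exists (@App (sublang S) V (exist _ f Sf) us) => /=; congr (App f _); apply/funext => i; exact: usP.
Qed.

Lemma lift_fml_ex V (p : fml L V) : fsyms p `<=` S -> exists q : fml (sublang S) V, lift_fml q = p.
Proof.
elim: p => {V} [V|V t u|V r ts|V p IHp q IHq|V p IH] /= H.
- by exists FBot.
- have [|t' tE] := @lift_term_ex V t; first by move=> x ?; apply: H; left.
  have [|u' uE] := @lift_term_ex V u; first by move=> x ?; apply: H; right.
  by exists (FEq t' u'); rewrite /= tE uE.
- have Sr : S (inr r) by apply: H; left.
  have /choice_rel[us usP] : forall i, exists u : term (sublang S) V, lift_term u = ts i.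
    by move=> i; apply: lift_term_ex => x xi; apply: H; right; exists i.
  exists (@FRel (sublang S) V (exist _ r Sr) us) => /=; congr (FRel r _); apply/funext => i; exact: usP.
- have [|p' pE] := IHp; first by move=> x ?; apply: H; left.
  have [|q' qE] := IHq; first by move=> x ?; apply: H; right.
  by exists (FImp p' q'); rewrite /= pE qE.
- by have [p' pE] := IH H; exists (FAll p'); rewrite /= pE.
Qed.
End Syntax.

Section Coding.
Context {L : language} (cs : symbol L -> nat) (csI : injective cs).
Import GenTree.

Fixpoint tcode V (cv : V -> nat) (t : term L V) : tree nat :=
  match t with
  | Var x => Leaf (cv x)
  | App f ts => Node (cs (inl f)) [seq tcode cv (ts i) | i <- enum 'I_(far f)]
  end.

Definition ocode V (cv : V -> nat) (o : option V) : nat := if o is Some x then (cv x).+1 else 0%N.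

Fixpoint fcode V (cv : V -> nat) (p : fml L V) : tree nat :=
  match p with
  | FBot => Node 0 [::]
  | FEq t u => Node 1 [:: tcode cv t; tcode cv u]
  | FRel r ts => Node (cs (inr r)).+4 [seq tcode cv (ts i) | i <- enum 'I_(rar r)]
  | FImp p q => Node 2 [:: fcode cv p; fcode cv q]
  | FAll p => Node 3 [:: fcode (ocode cv) p]
  end.

Lemma map_enum_inj k (X : Type) (a b : 'I_k -> X) :
  [seq a i | i <- enum 'I_k] = [seq b i | i <- enum 'I_k] -> a = b.
Proof.
move=> /eq_in_map E; apply/funext => i.
exact: E (mem_enum 'I_k i).
Qed.

Lemma tcode_inj V (cv : V -> nat) : injective cv -> injective (tcode cv).
Proof.
move=> cI; elim=> [x|f ts IH] [y|g us] //= []; first by move=> /cI->.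
move=> /csI[E]; case: _ / E us => us E; congr (App f _).
have {}E : [seq tcode cv (ts i) | i <- enum 'I_(far f)] = [seq tcode cv (us i) | i <- enum 'I_(far f)] by [].
by apply/funext => i; apply: IH; move/map_enum_inj: E => /(congr1 (fun h => h i)).
Qed.

Lemma fcode_inj V (cv : V -> nat) : injective cv -> injective (fcode cv).
Proof.
move=> cI p; elim: p cv cI => {V} [V|V t u|V r ts|V p IHp q IHq|V p IH] cv cI [|t' u'|r' ts'|p' q'|p'] //=.
- by move=> [] /(tcode_inj cI)-> /(tcode_inj cI)->.
- move=> [] /csI[E]; case: _ / E ts' => ts' E; congr (FRel r _).
  have {}E : [seq tcode cv (ts i) | i <- enum 'I_(rar r)] = [seq tcode cv (ts' i) | i <- enum 'I_(rar r)] by [].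
  by apply/funext => i; apply: (tcode_inj cI); move/map_enum_inj: E => /(congr1 (fun h => h i)).
- by move=> [] /(IHp _ cI)-> /(IHq _ cI)->.
- move=> [] /IH-> //; by move=> [x|] [y|] //= [/cI->].
Qed.
End Coding.

Lemma fml_countable (L : language) (S : set (symbol L)) n : countable S ->
  exists c : fml (sublang S) 'I_n -> nat, injective c.
Proof.
move=> /countable_code[c cI].
pose cs (x : symbol (sublang S)) : nat :=
  match x with inl f => (c (inl (sval f))).*2 | inr r => (c (inr (sval r))).*2.+1 end.
have csI : injective cs.
  move=> [[f pf]|[r pr]] [[g pg]|[q pq]] /= E.
  - have [E'] := cI _ _ pf pg (double_inj E); congr inl; exact: eq_exist.
  - by have := congr1 odd E; rewrite /= !odd_double.
  - by have := congr1 odd E; rewrite /= !odd_double.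
  - case: E => E; have [E'] := cI _ _ pr pq (double_inj E); congr inr; exact: eq_exist.
exists (fun p => pickle (fcode cs (@nat_of_ord n) p)) => p q /(pcan_inj pickleK).
by apply: (fcode_inj csI); exact: ord_inj.
Qed.

(** * Finite tuples as lists *)

Section Lists.
Context {X : Type}.

Definition lst n (a : 'I_n -> X) : seq X := [seq a i | i <- enum 'I_n].

Lemma size_lst n (a : 'I_n -> X) : size (lst a) = n.
Proof. by rewrite size_map size_enum_ord. Qed.

Lemma lst_inj n (a b : 'I_n -> X) : lst a = lst b -> a = b.
Proof. exact: map_enum_inj. Qed.

Lemma enum_ord1 : enum 'I_1 = [:: ord0].
Proof. by apply: (inj_map (@ord_inj 1)); rewrite [LHS]val_enum_ord. Qed.

Lemma enum_ord_cat n k :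
  enum 'I_(n + k) = map (@lshift n k) (enum 'I_n) ++ map (@rshift n k) (enum 'I_k).
Proof.
have E l : map (@nat_of_ord l) (enum 'I_l) = iota 0 l by exact: val_enum_ord.
have cmp (l : nat) (f : 'I_l -> 'I_(n + k)) : map (@nat_of_ord (n + k)) (map f (enum 'I_l)) =
    [seq nat_of_ord (f i) | i <- enum 'I_l].
  by elim: (enum 'I_l) => //= i s ->.
apply: (inj_map (@ord_inj (n + k))); rewrite E map_cat !cmp iotaD add0n; congr cat.
  exact/esym/E.
rewrite -[X in iota X k]addn0 iotaDl -(E k).
by elim: (enum 'I_k) => //= i s ->.
Qed.

Definition cat_fun n k (a : 'I_n -> X) (b : 'I_k -> X) (i : 'I_(n + k)) : X :=
  match fintype.split i with inl j => a j | inr j => b j end.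

Lemma cat_fun_l n k (a : 'I_n -> X) (b : 'I_k -> X) i : cat_fun a b (lshift k i) = a i.
Proof. by rewrite /cat_fun (unsplitK (inl i)). Qed.

Lemma cat_fun_r n k (a : 'I_n -> X) (b : 'I_k -> X) i : cat_fun a b (rshift n i) = b i.
Proof. by rewrite /cat_fun (unsplitK (inr i)). Qed.

Lemma cat_funE n k (c : 'I_(n + k) -> X) : cat_fun (c \o lshift k) (c \o @rshift n k) = c.
Proof. by apply/funext => i; rewrite /cat_fun; case: splitP => j ij /=; congr c; exact: val_inj. Qed.

Lemma cat_fun_inj n k (a a' : 'I_n -> X) (b b' : 'I_k -> X) : cat_fun a b = cat_fun a' b' -> a = a' /\ b = b'.
Proof.
move=> E; split; apply/funext => i.
  by rewrite -(cat_fun_l a b) E cat_fun_l.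
by rewrite -(cat_fun_r a b) E cat_fun_r.
Qed.

Lemma lst_cat n k (a : 'I_n -> X) (b : 'I_k -> X) : lst (cat_fun a b) = lst a ++ lst b.
Proof.
rewrite /lst enum_ord_cat map_cat -!map_comp; congr cat; apply: eq_map => i /=.
  exact: cat_fun_l.
exact: cat_fun_r.
Qed.

Lemma lst_ex (s : seq X) : exists n (a : 'I_n -> X), s = lst a.
Proof.
elim: s => [|x s [n [a ->]]].
  by exists 0%N, (@no_ord X); apply/esym/size0nil; rewrite size_lst.
exists (1 + n)%N, (cat_fun (fun=> x) a); rewrite lst_cat /lst.
by rewrite enum_ord1.
Qed.

End Lists.

Lemma lst1 X (a : 'I_1 -> X) : lst a = [:: a ord0].
Proof.
by rewrite /lst enum_ord1.
Qed.

Lemma map_lst X Y (h : X -> Y) n (a : 'I_n -> X) : map h (lst a) = lst (h \o a).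
Proof. by rewrite /lst -map_comp. Qed.

Lemma mem_lst (X : eqType) n (a : 'I_n -> X) x : (x \in lst a) <-> exists i, a i = x.
Proof.
split=> [/mapP[i _ ->]|[i <-]]; first by exists i.
by apply: map_f; exact: mem_enum.
Qed.

Lemma embeds_card X Y : embeds X Y -> ([set: X] #<= [set: Y])%card.
Proof.
move=> [f fI]; have : (f @` [set: X] #= [set: X])%card by apply: inj_card_eq => x y _ _; exact: fI.
rewrite card_eq_le => /andP[_ h]; apply: card_le_trans h _.
exact: subset_card_le.
Qed.

(** * Automorphisms and isolated types in the monster model *)

Section ModelTheory.
Context {d : Order.disp_t} {W : orderType d} (W1 : is_omega1 W).
Context {L : language} (T : theory L) (T_compl : complete_theory T).
Context (La : W -> set (symbol L)) (La_chain : language_chain La).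
Context (C : structure L) (C_monster : monster W T C).

Lemma C_models : models C T. Proof. by case: C_monster. Qed.

Definition isaut (h : C -> C) := [/\ bijective h,
  forall f a, h (fint C f a) = fint C f (h \o a) &
  forall r a, rint C r a <-> rint C r (h \o a)].

Lemma sat_isaut h V (p : fml L V) v : isaut h -> sat p v <-> sat p (h \o v).
Proof. by move=> [h1 h2 h3]; exact: sat_iso. Qed.

Lemma isaut_id : isaut id.
Proof. by split=> //; exists id. Qed.

Lemma isaut_comp h k : isaut h -> isaut k -> isaut (h \o k).
Proof.
move=> [h1 h2 h3] [k1 k2 k3]; split; first exact: bij_comp.
  by move=> f a /=; rewrite k2 h2.
by move=> r a; rewrite k3 h3.
Qed.

Lemma isaut_inv h : isaut h -> exists k, [/\ isaut k, cancel h k & cancel k h].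
Proof.
move=> [[k hk kh] h2 h3]; exists k; split=> //; split; first by exists h.
  move=> f a; apply: (can_inj hk); rewrite kh h2; congr (fint C f _).
  by apply/funext => i /=; rewrite kh.
move=> r a; rewrite (h3 r (k \o a)); suff -> : h \o (k \o a) = a by [].
by apply/funext => i /=; rewrite kh.
Qed.

Lemma countable_le_W (A : set C) : countable A -> (A #<= [set: W])%card.
Proof. by move=> Ac; apply: card_le_trans Ac _; apply: embeds_card; exact: embeds_nat. Qed.

(** Whether a map on [A] is elementary depends on finitely many elements at
    a time. *)
Lemma isaut_ext (A : set C) (g : C -> C) : countable A ->
  (forall n (a : 'I_n -> C), (forall i, A (a i)) -> exists2 h, isaut h & h \o a = g \o a) ->
  exists2 h, isaut h & forall x, A x -> h x = g x.
Proof.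
move=> Ac H; have [_ _ mon] := C_monster.
have [|h [h1 h2 h3 h4]] := mon A (g \o \val) (countable_le_W Ac).
  move=> p; have [k [x xP]] := sat_support p.
  have [|h ha hE] := H k (\val \o x); first by move=> i; exact: set_valP.
  rewrite (sat_isaut p _ ha); apply: xP => i.
  exact: (congr1 (fun f : 'I_k -> C => f i) hE).
exists h; first by split.
by move=> x Ax; have := h4 (SigSub (mem_set Ax)).
Qed.

Lemma same_type_aut n (a b : 'I_n -> C) : (forall p : fml L 'I_n, sat p a <-> sat p b) ->
  exists2 h, isaut h & h \o a = b.
Proof.
move=> ab; have [_ _ mon] := C_monster.
have Ac : countable (range a) by apply: countable_range.
have /choice_rel[g gP] : forall x : range a, exists i, a i = \val x.
  by move=> x; have [i _ ix] := set_valP x; exists i.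
have [|h [h1 h2 h3 h4]] := mon (range a) (b \o g) (countable_le_W Ac).
  move=> p; have := ab (fren g p); rewrite !sat_fren.
  by have -> : a \o g = \val by apply/funext => x; exact: gP.
exists h; first by split.
apply/funext => i /=.
have ai : range a (a i) by exists i.
have /= -> := h4 (SigSub (mem_set ai)).
set j := g _; have aj : a j = a i by rewrite gP.
have := ab (FEq (Var j) (Var i)); move=> /=; rewrite aj => -[h' _]; exact: h'.
Qed.

Lemma isolates_sat n (a b : 'I_n -> C) (p : fml L 'I_n) : isolates T a p -> sat p b -> isolates T b p.
Proof.
move=> [pa aP] pb; split=> // q qb; apply: (aP q); apply: contrapT => nq.
exact: (aP (FNeg q) nq C C_models b pb).
Qed.

Lemma isolates_aut n (a b : 'I_n -> C) (p : fml L 'I_n) : isolates T a p -> sat p b ->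
  exists2 h, isaut h & h \o a = b.
Proof.
move=> ia pb; have ib := isolates_sat ia pb; apply: same_type_aut => q; split=> h.
  exact: (ia.2 q h C C_models b pb).
exact: (ib.2 q h C C_models a ia.1).
Qed.

Lemma isolates_image h n (a : 'I_n -> C) p : isaut h -> isolates T a p -> isolates T (h \o a) p.
Proof.
move=> hh [pa aP]; split; first by rewrite -sat_isaut.
by move=> q; rewrite -sat_isaut //; exact: aP.
Qed.

(** That [p] has a solution is expressed by a sentence, which a complete
    theory decides. *)
Lemma consistent_realised n (p : fml L 'I_n) : consistent_with T p -> exists a, @sat _ C _ p a.
Proof.
move=> [M MT [v pv]].
have [q qP] := @sat_exfin L void n (fren inr p).
have qM : sat q (of_void M).
  by apply/qP; exists v; rewrite sat_fren.
have [[_ _] /(_ C C_models (of_void C)) ] : (True /\ True) /\ entails T q.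
  split=> //; have [//|nq] := T_compl.2 q.
  by have := nq M MT (of_void M) qM.
by move=> /qP[w]; rewrite sat_fren => pw; exists w.
Qed.

Section Level.
Context (a : W) (a_dense : T_complete_dense T La a).

Lemma dense_realise n (p : fml (sublang (La a)) 'I_n) (c : 'I_n -> C) : sat (lift_fml p) c ->
  exists (c' : 'I_n -> C) (q : fml (sublang (La a)) 'I_n), [/\ isolates T c' (lift_fml q) &
    sat (lift_fml p) c'].
Proof.
move=> pc; have [|q [[qc qd] qp]] := a_dense (phi := p).
  by exists C; [exact: C_models|exists c].
have [c' qc'] := consistent_realised qc.
exists c', q; split; last exact: qp C C_models c' qc'.
split=> // r rc'; have [//|nr] := qd r.
by have := nr C C_models c' qc'.
Qed.
End Level.

(** The formula saying that the variables are part of a solution of [p]. *)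
Lemma isolates_proj (S : set (symbol L)) n k (c : 'I_n -> C) (g : 'I_k -> 'I_n) (p : fml (sublang S) 'I_n) :
  isolates T c (lift_fml p) -> exists q : fml (sublang S) 'I_k, isolates T (c \o g) (lift_fml q).
Proof.
move=> [pc cP].
have [e eP] := @sat_allfin (sublang S) ('I_k + 'I_n) k (fun j => FEq (Var (inl j)) (Var (inr (g j)))).
have [q qP] := @sat_exfin (sublang S) 'I_k n (FAnd (fren inr p) e).
have qE (M : structure L) (v : 'I_k -> M) : sat (lift_fml q) v <-> exists2 w, sat (lift_fml p) w & v = w \o g.
  rewrite sat_lift qP; split=> [[w]|[w pw ->]].
    rewrite sat_and sat_fren eP /= => -[pw H]; exists w; first by rewrite sat_lift.
    by apply/funext => j; exact: H.
  by exists w; rewrite sat_and sat_fren eP /=; split=> //; rewrite -sat_lift.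
exists q; split; first by apply/qE; exists c.
move=> r rc M MT v /= /qE[w pw ->].
have gc : sat (fren g r) c by apply/sat_fren.
have gw : sat (fren g r) w by exact: (cP _ gc M MT w pw).
by move/sat_fren: gw.
Qed.

Lemma fsyms_level V (p : fml L V) (A : set W) : A !=set0 -> fsyms p `<=` \bigcup_(b in A) La b ->
  exists2 b, A b & fsyms p `<=` La b.
Proof.
move=> [a0 Aa0] pA; have [_ mono _ _] := La_chain.
have /(@finite_seqP {classic (symbol L)})[s sE] := fsyms_finite p.
have sA x : x \in s -> exists2 b, A b & La b x.
  by move=> xs; apply: pA; rewrite sE.
suff [b Ab bs] : exists2 b, A b & forall x, x \in s -> La b x.
  by exists b => //; rewrite sE.
elim: {sE} s sA => [|x s IH] sA; first by exists a0.
have [|b Ab bs] := IH; first by move=> y ys; apply: sA; rewrite inE ys orbT.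
have [c Ac cx] := sA x (mem_head _ _).
have [bc|/ltW cb] := leP b c; [exists c|exists b] => // y; rewrite inE => /orP[/eqP->|/bs] //.
  exact: mono.
exact: (mono c).
Qed.

End ModelTheory.

(** * The frame of the monster model *)

Section MonsterFrame.
Context {d : Order.disp_t} {W : orderType d} (W1 : is_omega1 W).
Context {L : language} (T : theory L) (T_compl : complete_theory T).
Context (La : W -> set (symbol L)) (La_chain : language_chain La).
Context (C0 : set W) (C0_club : club C0).
Context (C0_dense : forall a, C0 a -> T_complete_dense T La a).
Context (C : structure L) (C_monster : monster W T C).

Definition isoAt b n (a : 'I_n -> C) := exists p : fml (sublang (La b)) 'I_n, isolates T a (lift_fml p).

Definition AtC b (s : seq {classic C}) := exists n (a : 'I_n -> C), s = lst a /\ isoAt b a.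

Lemma AtC_lst b n (a : 'I_n -> C) : AtC b (lst a) <-> isoAt b a.
Proof.
split=> [[k [c [E ic]]]|ia]; last by exists n, a.
have nk : n = k by have := congr1 size E; rewrite !size_lst.
by case: _ / nk c E ic => c /lst_inj ->.
Qed.

Lemma isoAt_syms b n (a : 'I_n -> C) (p : fml L 'I_n) : isolates T a p -> fsyms p `<=` La b -> isoAt b a.
Proof. by move=> ip /lift_fml_ex[q qE]; exists q; rewrite qE. Qed.

Lemma isoAt_le b c n (a : 'I_n -> C) : b <= c -> isoAt b a -> isoAt c a.
Proof.
move=> bc [p ip]; apply: isoAt_syms ip _ => x /fsyms_lift; have [_ mono _ _] := La_chain.
exact: mono.
Qed.

Lemma isoAt_comp b n k (c : 'I_n -> C) (g : 'I_k -> 'I_n) : isoAt b c -> isoAt b (c \o g).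
Proof. by move=> [p /(isolates_proj g)]. Qed.

Lemma isoAt_image b h n (a : 'I_n -> C) : isaut h -> isoAt b a -> isoAt b (h \o a).
Proof. by move=> hh [p ip]; exists p; exact: isolates_image. Qed.

Definition fml_code b n : fml (sublang (La b)) 'I_n -> nat :=
  projT1 (cid (@fml_countable L (La b) n (let: And4 h _ _ _ := La_chain in h b))).

Lemma fml_code_inj b n : injective (@fml_code b n).
Proof. by rewrite /fml_code; case: cid. Qed.

Definition isolating_codes b (s : seq {classic C}) : set nat := [set k | exists n (a : 'I_n -> C) p,
  [/\ s = lst a, isolates T a (lift_fml p) & @fml_code b n p = k]].

(** Several formulas may isolate the type of [s]; the choice among them
    depends only on the set of all of them, which automorphisms preserve. *)
Definition orbit_code b s : nat := xget 0%N (isolating_codes b s).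

Lemma isolating_codes_aut b h s : isaut h -> isolating_codes b s `<=` isolating_codes b (map h s).
Proof.
move=> hh k [n [a [p [-> ip <-]]]]; exists n, (h \o a), p; split=> //.
  by rewrite map_lst.
exact: isolates_image.
Qed.

Lemma orbit_code_aut b h s : isaut h -> orbit_code b (map h s) = orbit_code b s.
Proof.
move=> hh; congr (xget _ _); apply/seteqP; split; last exact: isolating_codes_aut.
have [k [ka hk kh]] := isaut_inv hh.
by move=> n /(isolating_codes_aut ka); rewrite (mapK hk).
Qed.

Lemma orbit_code_inj b s t : AtC b s -> AtC b t -> size s = size t -> orbit_code b s = orbit_code b t ->
  exists2 h, isaut h & map h s = t.
Proof.
have get u : AtC b u -> isolating_codes b u (orbit_code b u).
  by move=> [n [a [-> [p ip]]]]; apply: xgetPex; exists (fml_code p), n, a, p.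
move=> /get[n [a [p [-> ip pk]]]] /get[k [c [q [-> iq qk]]]]; rewrite !size_lst => nk.
case: _ / nk c q iq qk => c q iq qk E.
have pq : p = q by apply: (@fml_code_inj b n); rewrite pk qk.
rewrite -pq in iq; have [h ha hE] := isolates_aut W1 C_monster ip iq.1.
by exists h => //; rewrite map_lst hE.
Qed.

Lemma mem_lstC n (a : 'I_n -> C) (x : {classic C}) :
  x \in (lst a : seq {classic C}) <-> exists i, a i = x.
Proof. exact: (@mem_lst {classic C}). Qed.

Lemma AtC_sub b s t : AtC b s -> {subset t <= s} -> AtC b t.
Proof.
move=> [n [a [-> ia]]] ts; have [k [c tE]] := lst_ex t.
have /choice_rel[g gP] : forall j, exists i, a i = c j.
  by move=> j; apply/mem_lstC; apply: ts; rewrite tE; apply/mem_lstC; exists j.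
exists k, c; split=> //; rewrite (_ : c = a \o g); first exact: isoAt_comp.
by apply/funext => j /=; rewrite gP.
Qed.

Lemma AtC_nil b : AtC b [::].
Proof.
exists 0%N, (@no_ord C); split; first by apply/esym/size0nil; rewrite size_lst.
exists (FNeg FBot); split; first by case.
move=> q qc M MT v _.
have E (N : structure L) (e : 'I_0 -> N) : sat q e <-> sat (fren (@no_ord void) q) (of_void N).
  by rewrite sat_fren; suff -> : of_void N \o @no_ord void = e by []; apply/funext => -[].
apply/E; have [h|h] := T_compl.2 (fren (@no_ord void) q); first exact: h M MT _.
by case: (h C (C_models C_monster) (of_void C)); apply/(E C (@no_ord C)).
Qed.

Lemma AtC_limit b s : is_limit b -> AtC b s -> exists2 c, c < b & AtC c s.
Proof.
move=> lb [n [a [-> [p ip]]]]; have [_ _ lim _] := La_chain.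
have [||c cb pc] := @fsyms_level _ _ _ _ La_chain _ (lift_fml p) [set c | c < b].
- by case: lb => -[c cb] _; exists c.
- by rewrite -lim //; exact: fsyms_lift.
- by exists c => //; apply/AtC_lst; exact: isoAt_syms ip pc.
Qed.

(** Below the conjunction of the formulas isolating [s ++ t] and [s ++ u]
    there is an isolated type at the level [b]; a realisation of it is moved
    so that its first two parts become [s] and [t]. *)
Lemma AtC_amalg b s t u : C0 b -> AtC b (s ++ t) -> AtC b (s ++ u) ->
  exists2 v, isaut v & map v s = s /\ AtC b (s ++ t ++ map v u).
Proof.
move=> Cb; have [n1 [a1 ->]] := lst_ex s; have [n2 [a2 ->]] := lst_ex t; have [n3 [a3 ->]] := lst_ex u.
rewrite -!lst_cat => /AtC_lst[p ip] /AtC_lst[q iq].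
pose g1 (i : 'I_(n1 + n2)) : 'I_(n1 + (n2 + n3)) :=
  match fintype.split i with inl j => lshift _ j | inr j => rshift n1 (lshift n3 j) end.
pose g2 (i : 'I_(n1 + n3)) : 'I_(n1 + (n2 + n3)) :=
  match fintype.split i with inl j => lshift _ j | inr j => rshift n1 (rshift n2 j) end.
pose c := cat_fun a1 (cat_fun a2 a3).
have g1E e1 e2 e3 : cat_fun e1 (cat_fun e2 e3) \o g1 = cat_fun e1 e2 :> ('I_(n1 + n2) -> C).
  apply/funext => i; rewrite /= /g1 [RHS]/cat_fun.
  by case: (fintype.split i) => j; rewrite ?cat_fun_l // cat_fun_r cat_fun_l.
have g2E e1 e2 e3 : cat_fun e1 (cat_fun e2 e3) \o g2 = cat_fun e1 e3 :> ('I_(n1 + n3) -> C).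
  apply/funext => i; rewrite /= /g2 [RHS]/cat_fun.
  by case: (fintype.split i) => j; rewrite ?cat_fun_l // cat_fun_r cat_fun_r.
pose r := FAnd (fren g1 p) (fren g2 q).
have rE (e : 'I_(n1 + (n2 + n3)) -> C) : sat (lift_fml r) e <-> sat (lift_fml p) (e \o g1) /\ sat (lift_fml q) (e \o g2).
  by rewrite sat_lift sat_and !sat_fren -!sat_lift.
have rc : sat (lift_fml r) c by apply/rE; rewrite g1E g2E; split; [exact: ip.1|exact: iq.1].
have [e [w [iw re]]] := dense_realise T_compl C_monster (C0_dense Cb) rc.
have [pe qe] := (rE e).1 re.
have [h ha hE] := isolates_aut W1 C_monster (isolates_sat C_monster ip pe) ip.1.
pose d' := h \o e.
have [e1 [e2 [e3 dE]]] : exists e1 e2 e3, d' = cat_fun e1 (cat_fun e2 e3).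
  by exists (d' \o lshift _), (d' \o @rshift _ _ \o lshift _), (d' \o @rshift _ _ \o @rshift _ _); rewrite !cat_funE.
have id' : isoAt b d' by exists w; exact: isolates_image.
have hE' : d' \o g1 = cat_fun a1 a2 by rewrite -hE.
move: hE'; rewrite dE g1E => /cat_fun_inj[E1 E2].
have qd : sat (lift_fml q) (cat_fun a1 e3).
  rewrite -E1 -(g2E e1 e2 e3) -dE (_ : d' \o g2 = h \o (e \o g2)) //.
  by rewrite -sat_isaut.
have [v va vE] := isolates_aut W1 C_monster iq qd.
have /cat_fun_inj[v1 v3] : cat_fun (v \o a1) (v \o a3) = cat_fun a1 e3.
  rewrite -vE; apply/funext => i; rewrite /= /cat_fun.
  by case: (fintype.split i).
exists v => //; rewrite !map_lst v1 v3; split=> //.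
by rewrite -!lst_cat -E1 -E2; apply/AtC_lst; rewrite -dE.
Qed.

Lemma isaut_ext_seq (A : set {classic C}) (g : {classic C} -> {classic C}) : countable A ->
  (forall s : seq {classic C}, (forall x, x \in s -> A x) -> exists2 h, isaut h & map h s = map g s) ->
  exists2 h, isaut h & forall x, A x -> h x = g x.
Proof.
move=> Ac H; apply: (isaut_ext W1 C_monster Ac) => n a aA.
have [|h ha hE] := H (lst a); first by move=> x /mem_lstC[i <-].
by exists h => //; move: hE; rewrite !map_lst => /lst_inj.
Qed.

Definition monster_frame : frame W := @Frame d W {classic C} (@isaut L C) AtC C0 orbit_code
  (@isaut_id _ C) (@isaut_comp _ C) (@isaut_inv _ C) isaut_ext_seq C0_club (fun b _ => AtC_nil b)
  AtC_sub (fun b c s bc => fun '(ex_intro n (ex_intro a (conj E ia))) =>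
     ex_intro _ n (ex_intro _ a (conj E (isoAt_le bc ia))))
  AtC_limit
  (fun b h s ha => fun '(ex_intro n (ex_intro a (conj E ia))) =>
     ex_intro _ n (ex_intro _ (h \o a) (conj (etrans (congr1 (map h) E) (map_lst h a)) (isoAt_image ha ia))))
  orbit_code_aut orbit_code_inj AtC_amalg.
End MonsterFrame.

(** * Perfect sets of atomic types *)

Lemma stone_basic_open (L : language) (M : structure L) (A : set M) n (p : fml L (A + 'I_n)) :
  open (stone_basic p : set (stone A n)).
Proof.
exists [set stone_basic p]; last by rewrite bigcup_set1.
move=> _ ->; exists (finmap.fset1 (stone_basic p : set (stone A n))).
  by move=> i /finmap.fset1P ->; rewrite inE; exists p.
by rewrite set_fset1 bigcap_set1.
Qed.

Lemma stone_inj (L : language) (M : structure L) (A : set M) n (p q : stone A n) :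
  sval p = sval q -> p = q.
Proof. by case: p q => [p hp] [q hq] /= E; exact: eq_exist. Qed.

Section Types.
Context {d : Order.disp_t} {W : orderType d} (W1 : is_omega1 W).
Context {L : language} (T : theory L) (T_compl : complete_theory T).
Context (La : W -> set (symbol L)) (La_chain : language_chain La).
Context (C0 : set W) (C0_club : club C0).
Context (C0_dense : forall a, C0 a -> T_complete_dense T La a).
Context (C : structure L) (C_monster : monster W T C).

Local Notation G := (monster_frame W1 T_compl La_chain C0_club C0_dense C_monster).

Lemma fsyms_lev V (p : fml L V) (a : W) : exists b, [/\ C0 b, a < b & fsyms p `<=` La b].
Proof.
have [_ mono _ full] := La_chain.
have [||c _ pc] := fsyms_level La_chain (p := p) (A := setT).
- by exists a.
- by rewrite full.
have [b Cb] := C0_club.1 (Order.max a c); rewrite gt_max => /andP[ab cb].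
by exists b; split=> // x /pc; apply: mono; exact: ltW.
Qed.

Lemma lst_exC (s : seq (pt G)) : exists n (a : 'I_n -> C), s = lst a.
Proof. exact: lst_ex. Qed.

(** That the formula isolating [s ++ [:: z]] has a solution over [s] is
    inherited by an elementary subset. *)
Lemma base_S_base b A : S_base T (La b) A -> base (G := G) b A.
Proof.
move=> [[Ac AA] [N [e [eE eA]]]]; split; first split=> //.
  move=> s sA; have [n [a aE]] := lst_exC s; exists n, a; split=> //.
  by apply: AA => i; apply: sA; rewrite aE; apply/mem_lstC; exists i.
move=> s z sA; have [n [a aE]] := lst_exC s.
have -> : s ++ [:: z] = lst (cat_fun a (fun _ : 'I_1 => z : C)) by rewrite lst_cat lst1 aE.
move=> /AtC_lst[p ip].
have /choice_rel[a' a'P] : forall i, exists x, e x = a i.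
  move=> i; have : A (a i) by apply: sA; rewrite aE; apply/mem_lstC; exists i.
  by rewrite -eA => -[x _ <-]; exists x.
have ea : (e \o a' : 'I_n -> C) = a by apply/funext => i; exact: a'P.
pose g (i : 'I_(n + 1)) : option 'I_n := if fintype.split i is inl j then Some j else None.
have gE (X : Type) (f : 'I_n -> X) x : extend_asg f x \o g = cat_fun f (fun _ : 'I_1 => x).
  by apply/funext => i; rewrite /= /g /cat_fun; case: (fintype.split i).
have : @sat _ (reduct (La b) C) _ (FEx (fren g p)) (e \o a').
  apply/sat_ex; exists z; rewrite sat_fren gE -sat_lift.
  by rewrite ea; exact: ip.1.
move=> /eE /sat_ex[x]; rewrite sat_fren gE => /eE.
have -> : (e \o cat_fun a' (fun=> x) : 'I_(n + 1) -> C) = cat_fun a (fun=> e x).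
  by rewrite -ea; apply/funext => i; rewrite /= /cat_fun; case: (fintype.split i).
rewrite -sat_lift => pe; exists (e x); first by rewrite -eA; exists x.
have [h ha hE] := isolates_aut W1 C_monster ip pe.
have /cat_fun_inj[h1 h2] : cat_fun (h \o a) (fun _ : 'I_1 => h z) = cat_fun a (fun=> e x).
  by rewrite -hE; apply/funext => i; rewrite /= /cat_fun; case: (fintype.split i).
exists h => //; split; last by congr [:: _]; exact: (congr1 (fun f : 'I_1 -> C => f ord0) h2).
by apply/fixes_map; rewrite aE map_lst h1.
Qed.

Lemma atomic_atomic_set A : atomic_set T A -> atomic (G := G) A.
Proof.
move=> [Ac AA]; split=> // s sA; have [n [a aE]] := lst_exC s.
have [|p ip] := AA n a; first by move=> i; apply: sA; rewrite aE; apply/mem_lstC; exists i.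
have [b [Cb _ pb]] := fsyms_lev p (w0 W1); exists b => //.
by exists n, a; split=> //; exact: isoAt_syms ip pb.
Qed.

Lemma stone_sat (A : set C) n (p : stone A n) (b : 'I_n -> C) : realizes b (sval p) ->
  forall q, sval p q <-> sat q (with_params b).
Proof.
move=> bp q; split; first exact: bp.
move=> qb; have [_ H] := svalP p; have [//|/bp nq] := H q.
by case: nq.
Qed.

Lemma eqs_sat (A : set C) n (b b' : 'I_n -> C) : eqs (G := G) A (lst b) (lst b') ->
  forall q : fml L (A + 'I_n), sat q (with_params b) <-> sat q (with_params b').
Proof.
move=> bb q; have [k [x xP]] := sat_support q.
pose par (i : 'I_k) : option {classic C} := if x i is inl a then Some (\val a : C) else None.
pose e : seq {classic C} := pmap par (enum 'I_k).
have eA : inside (G := G) e A.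
  move=> z; rewrite mem_pmap => /mapP[i _]; rewrite /par; case: (x i) => // a [->].
  exact: set_valP.
have [h ha [he hb]] := bb e eA; move: hb; rewrite map_lst => /lst_inj hb.
rewrite (sat_isaut q _ ha); apply: xP => i.
have ei := erefl (par i); rewrite {2}/par in ei; move: ei.
case: (x i) => [a|j] /= ei; last by rewrite -hb.
apply: he; rewrite mem_pmap; apply/mapP; exists i; first exact: mem_enum.
by rewrite ei.
Qed.

(** The realisations of the types in a perfect set are crowded: the formula
    isolating the type of a realisation together with a tuple [e] of
    parameters defines a neighbourhood of the type, and all realisations of
    types in this neighbourhood are conjugate over [e]. *)
Lemma crowded_not_scattered b A : C0 b -> S_base T (La b) A -> ~ scattered (S_at_all T A) ->
  exists P, crowded (G := G) A P.
Proof.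
move=> Cb bA; have [Ac _] := bA.1.
have [_ sat_mon _] := C_monster.
have AW := countable_le_W W1 Ac.
move=> /contrapT[P [[[n q0] Pq0] [_ Plim]]].
pose R : set (seq {classic C}) := [set s | exists (b : 'I_n -> C) (q : set_type (S_at T A n)),
  [/\ s = lst b, P (existT _ n q) & realizes b (sval (\val q))]].
exists R; split.
- have [c cq] := sat_mon A AW n (\val q0).
  by exists (lst c), c, q0.
- move=> _ [c [q [-> Pq cq]]].
  have : atomic_set T (A `|` range c) by apply: (set_valP q).
  move=> /atomic_atomic_set; apply: atomic_sub => z [Az|/mem_lstC[i <-]]; [by left|by right; exists i].
- move=> _ e [c [q [-> Pq cq]]] eA.
  have [k [u uE]] := lst_exC e.
  have uA i : A (u i) by apply: eA; rewrite uE; apply/mem_lstC; exists i.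
  have [p ip] : exists p : fml L 'I_(k + n), isolates T (cat_fun u c) p.
    have [_ cA] : atomic_set T (A `|` range c) by apply: (set_valP q).
    apply: cA => i; rewrite /cat_fun; case: (fintype.split i) => j; first by left.
    by right; exists j.
  pose g (i : 'I_(k + n)) : A + 'I_n := match fintype.split i with
    | inl j => inl (SigSub (mem_set (uA j))) | inr j => inr j end.
  have gE (c' : 'I_n -> C) : with_params c' \o g = cat_fun u c'.
    by apply/funext => i; rewrite /= /g /cat_fun; case: (fintype.split i).
  have qp : sval (\val q) (fren g p).
    by apply/(stone_sat cq); rewrite sat_fren gE; exact: ip.1.
  have : limit_point P (existT _ n q) by rewrite Plim.
  move=> /(_ (existT _ n @` [set q' : set_type (S_at T A n) | sval (\val q') (fren g p)])).
  case.
    apply: existT_nbhs.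
    have cont := @initial_continuous (set_type (S_at T A n)) (stone A n) set_val q (stone_basic (fren g p)).
    by apply: cont; exact: (open_nbhs_nbhs (conj (stone_basic_open _) qp)).
  move=> y [/eqP ne Pq' [q' q'p E]]; rewrite -E in ne Pq'.
  have [c' c'q] := sat_mon A AW n (\val q').
  exists (lst c'); first by exists c', q'.
  split.
    have /(stone_sat c'q) := q'p; rewrite sat_fren gE => pc'.
    have [h ha hE] := isolates_aut W1 C_monster ip pc'.
    have /cat_fun_inj[h1 h2] : cat_fun (h \o u) (h \o c) = cat_fun u c'.
      by rewrite -hE; apply/funext => i; rewrite /= /cat_fun; case: (fintype.split i).
    by exists h => //; split; [apply/fixes_map; rewrite uE map_lst h1|rewrite map_lst h2].
  move=> cc'; apply: ne; congr existT; apply: val_inj; apply: stone_inj.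
  apply/seteqP; split=> r /=.
    by move=> /(stone_sat c'q)/(eqs_sat cc')/(stone_sat cq).
  by move=> /(stone_sat cq)/(eqs_sat cc')/(stone_sat c'q).
Qed.
End Types.

(** * Rich sets as atomic models *)

Lemma embeds_antisym X Y : embeds X Y -> embeds Y X -> ([set: X] #= [set: Y])%card.
Proof. by move=> /embeds_card h /embeds_card k; exact: Cantor_Bernstein. Qed.

Section Models.
Context {d : Order.disp_t} {W : orderType d} (W1 : is_omega1 W).
Context {L : language} (T : theory L) (T_compl : complete_theory T).
Context (La : W -> set (symbol L)) (La_chain : language_chain La).
Context (C0 : set W) (C0_club : club C0).
Context (C0_dense : forall a, C0 a -> T_complete_dense T La a).
Context (C : structure L) (C_monster : monster W T C).

Local Notation G := (monster_frame W1 T_compl La_chain C0_club C0_dense C_monster).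

(** The solution [x] may have a type over [a] that is not isolated, but
    density at a high level [b] provides a solution [c] for which it is, and
    the base at [b] realises the type of [c] over [a]. *)
Lemma rich_tarski_vaught (M : set C) n (a : 'I_n -> C) (p : fml L (option 'I_n)) :
  rich_model (G := G) M -> (forall i, M (a i)) -> (exists x, sat p (extend_asg a x)) ->
  exists2 x, M x & sat p (extend_asg a x).
Proof.
move=> [_ _ rich] Ma [x px].
have [b0 [_ _ pb0]] := fsyms_lev La_chain C0_club p (w0 W1).
have [|b [E [b0b Cb bE EM aE]]] := rich [set z | z \in (lst a : seq {classic C})] (countable_mem (G := G) _) _ b0.
  by move=> z /= /mem_lstC[i <-].
have [_ mono _ _] := La_chain.
have [p0 p0E] : exists p0 : fml (sublang (La b)) _, lift_fml p0 = p.
  by apply: lift_fml_ex => y /pb0; apply: mono; exact: ltW.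
have aE' : inside (G := G) (lst a) E by move=> z za; exact: aE.
have /AtC_lst[t it] := bE.1.2 _ aE'.
pose g (o : option 'I_n) : 'I_(n + 1) := if o is Some j then lshift 1 j else rshift n ord0.
have gE (X : Type) (e : 'I_n -> X) (f : 'I_1 -> X) : cat_fun e f \o g = extend_asg e (f ord0).
  by apply/funext => -[j|] /=; rewrite ?cat_fun_l ?cat_fun_r.
have lE (X : Type) (e : 'I_n -> X) (f : 'I_1 -> X) : cat_fun e f \o lshift 1 = e.
  by apply/funext => j /=; rewrite cat_fun_l.
pose r := FAnd (fren (lshift 1) t) (fren g p0).
have rE e f : sat (lift_fml r) (cat_fun e f) <-> sat (lift_fml t) e /\ sat p (extend_asg e (f ord0)).
  by rewrite sat_lift sat_and !sat_fren gE lE -p0E -!sat_lift.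
have rx : sat (lift_fml r) (cat_fun a (fun=> x)) by apply/rE; split=> //; exact: it.1.
have [c [q [iq]]] := dense_realise T_compl C_monster (C0_dense Cb) rx.
rewrite -(cat_funE c) => /rE[tc pc].
have [h ha hE] := isolates_aut W1 C_monster (isolates_sat C_monster it tc) it.1.
pose dd := h (c (rshift n ord0)).
have hc : h \o c = cat_fun a (fun=> dd).
  rewrite -(cat_funE c) -hE; apply/funext => i; rewrite /= /cat_fun.
  by case: (fintype.split i) => // j; rewrite /= (ord1 j).
have Ad : At (f := G) b (lst a ++ [:: dd : {classic C}]).
  rewrite -[[:: dd]](lst1 (fun _ : 'I_1 => dd)) -lst_cat; apply/AtC_lst; exists q.
  by rewrite -hc; exact: isolates_image.
have [d' Ed' [k ka [kf [kd]]]] := bE.2 _ _ aE' Ad.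
exists d'; first exact: EM.
have pd : sat p (extend_asg a dd).
  move/(sat_isaut p _ ha): pc; rewrite /= -/dd.
  suff -> : h \o extend_asg (c \o lshift 1) (c (rshift n ord0)) = extend_asg a dd by [].
  by apply/funext => -[j|] //=; rewrite -hE.
move/(sat_isaut p _ ka): pd.
suff -> : k \o extend_asg a dd = extend_asg a d' by [].
apply/funext => -[j|] //=; apply: kf; apply/mem_lstC; by exists j.
Qed.

Section Substructure.
Context (M : set C) (rM : rich_model (G := G) M).

Lemma rich_closed (f : Defs.fsym L) (a : 'I_(far f) -> {x | M x}) : M (fint C f (sval \o a)).
Proof.
have [||x Mx /= E] := @rich_tarski_vaught M (far f) (sval \o a)
  (FEq (App f (fun i => Var (Some i))) (Var None)) rM.
- by move=> i; exact: svalP.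
- by exists (fint C f (sval \o a)).
- by rewrite -E in Mx.
Qed.

Lemma rich_inhabited : inhabited {x | M x}.
Proof. by have [_ [i _] _] := rM; constructor; exact: (i (w0 W1)). Qed.

Definition submodel : structure L := @Structure L {x | M x} rich_inhabited
  (fun f a => exist _ _ (rich_closed a)) (fun r a => rint C r (sval \o a)).

Lemma eval_submodel V (t : term L V) (v : V -> submodel) :
  sval (term_eval v t) = term_eval (sval \o v) t.
Proof.
by elim: t => //= f ts IH; congr (fint C f _); apply/funext => i; exact: IH.
Qed.

(** [rich_tarski_vaught] concerns the variables ['I_n]; other finite sets of
    variables, which arise under quantifiers, are renamed to these. *)
Definition finite_vars (V : Type) := exists n (k : V -> 'I_n) (g : 'I_n -> V), cancel k g.

Lemma finite_vars_option V : finite_vars V -> finite_vars (option V).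
Proof.
move=> [n [k [g kg]]].
exists n.+1, (fun o => if o is Some x then lift ord0 (k x) else ord0),
  (fun i => if unlift ord0 i is Some j then Some (g j) else None).
by move=> [x|]; rewrite ?liftK ?kg ?unlift_none.
Qed.

Lemma sat_submodel V (p : fml L V) (v : V -> submodel) : finite_vars V ->
  sat p v <-> sat p (sval \o v : V -> C).
Proof.
move=> fV; elim: p fV v => {V} [V|V t u|V r ts|V p IHp q IHq|V p IH] fV v /=.
- by [].
- rewrite -!eval_submodel; split=> [->//|].
  by case: (term_eval v t) => x px; case: (term_eval v u) => y py /= E; exact: eq_exist.
- suff -> : sval \o (fun i => term_eval v (ts i)) = (fun i => term_eval (sval \o v) (ts i)) by [].
  by apply/funext => i /=; rewrite eval_submodel.
- by rewrite IHp // IHq.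
- have E (x : submodel) : sval \o extend_asg v x = extend_asg (sval \o v) (sval x) :> (option V -> C).
    by apply/funext => -[].
  have fO := finite_vars_option fV.
  split=> H x; last by apply/IH => //; rewrite E; exact: H.
  apply: contrapT => nx; have [n [k [g kg]]] := fV.
  have vg (y : C) : extend_asg (sval \o v \o g) y \o omap k = extend_asg (sval \o v) y.
    by rewrite extend_asg_omap; congr extend_asg; apply/funext => z /=; rewrite kg.
  have [||y My] := @rich_tarski_vaught M n (sval \o v \o g) (fren (omap k) (FNeg p)) rM.
  + by move=> i; exact: svalP.
  + by exists x; rewrite sat_fren vg.
  + rewrite sat_fren vg; apply.
    have := H (exist _ y My); rewrite IH // E; exact.
Qed.

Lemma finite_vars_ord n : finite_vars 'I_n.
Proof. by exists n, id, id. Qed.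

Lemma submodel_isolates n (a : 'I_n -> submodel) (p : fml L 'I_n) :
  isolates T (sval \o a : 'I_n -> C) p <-> isolates T a p.
Proof.
have E q : sat q a <-> sat q (sval \o a : 'I_n -> C) by apply: sat_submodel; exact: finite_vars_ord.
by split=> -[h1 h2]; split=> [|q /E]; try exact/E; exact: h2.
Qed.

Lemma submodel_atomic : atomic_model T submodel.
Proof.
split=> [s Ts|n a].
  apply/sat_submodel; first by exists 0%N, (fun x : void => match x with end), (@no_ord void) => -[].
  suff -> : sval \o of_void submodel = of_void C by exact: (C_models C_monster).
  by apply/funext => -[].
have [_ _ rich] := rM.
have [|b [E [_ Cb bE EM aE]]] := rich [set z | z \in (lst (sval \o a : 'I_n -> C) : seq {classic C})] (countable_mem (G := G) _) _ (w0 W1).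
  by move=> z /= /mem_lstC[i <-]; exact: svalP.
have /AtC_lst[p ip] : At (f := G) b (lst (sval \o a : 'I_n -> C)) by apply: bE.1.2 => z; exact: aE.
by exists (lift_fml p); apply/submodel_isolates.
Qed.

Lemma submodel_card : ([set: submodel] #= [set: W])%card.
Proof. by have [h k _] := rM; exact: embeds_antisym. Qed.
End Substructure.

(** An isomorphism preserves the formulas isolating the types of tuples, and
    a formula isolating a type in the submodel does so in the monster model. *)
Lemma isomorphic_tp_iso (M N : set C) (rM : rich_model (G := G) M) (rN : rich_model (G := G) N) :
  isomorphic (submodel rM) (submodel rN) -> exists h k, tp_iso (G := G) M N h k.
Proof.
move=> [h [hb hf hr]]; have [k hk kh] := hb.
pose H (x : C) : C := if pselect (M x) is left Mx then sval (h (exist _ x Mx)) else x.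
pose K (x : C) : C := if pselect (N x) is left Nx then sval (k (exist _ x Nx)) else x.
have HE (x : submodel rM) : H (sval x) = sval (h x).
  rewrite /H; case: pselect => [Mx|[]]; last exact: svalP.
  by congr (sval (h _)); case: x Mx => x px Mx; exact: eq_exist.
have KE (x : submodel rN) : K (sval x) = sval (k x).
  rewrite /K; case: pselect => [Mx|[]]; last exact: svalP.
  by congr (sval (k _)); case: x Mx => x px Mx; exact: eq_exist.
exists H, K; split.
- by move=> x Mx; rewrite -[x]/(sval (exist _ x Mx : submodel rM)) HE; exact: svalP.
- by move=> x Nx; rewrite -[x]/(sval (exist _ x Nx : submodel rN)) KE; exact: svalP.
- move=> x; rewrite inE => Mx.
  by rewrite -[x]/(sval (exist _ x Mx : submodel rM)) HE KE hk.
- move=> x; rewrite inE => Nx.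
  by rewrite -[x]/(sval (exist _ x Nx : submodel rN)) KE HE kh.
- move=> s sM; have [n [a aE]] := lst_ex s.
  have aM i : M (a i) by apply: sM; rewrite aE; apply/mem_lstC; exists i.
  pose a' (i : 'I_n) : submodel rM := exist _ (a i) (aM i).
  have [p ip] := (submodel_atomic rM).2 n a'.
  have pE : sat p (sval \o (h \o a') : 'I_n -> C).
    apply/(sat_submodel p (h \o a') (finite_vars_ord n)).
    by apply/(sat_iso p a' hb hf hr); exact: ip.1.
  have [t ta tE] := isolates_aut W1 C_monster ((submodel_isolates a' p).2 ip) pE.
  apply/eqvP; exists t => //; rewrite aE !map_lst.
  have -> : a = sval \o a' :> ('I_n -> C) by [].
  rewrite tE; congr lst; apply/funext => i; exact/esym/HE.
Qed.

Lemma many_atomic_models : many_models G -> exists M : (W -> bool) -> structure L,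
  (forall f, atomic_model T (M f) /\ ([set: M f] #= [set: W])%card) /\
  (forall f g, f <> g -> ~ isomorphic (M f) (M g)).
Proof.
move=> [M [rM nM]]; exists (fun f => submodel (rM f)); split=> [f|f g fg].
  by split; [exact: submodel_atomic|exact: submodel_card].
by move=> /isomorphic_tp_iso[h [k iso]]; exact: (nM f g fg h k).
Qed.

Theorem many_atomic_models_nontt : weak_diamond_star W -> cov_meager_ge_succ W ->
  ~ club_tt T La C0 C -> many_models G.
Proof.
move=> Phi cov ntt; apply: (many_models_crowded W1 cov Phi) => K Kc.
have [a [[Ka Ca] ntt_a]] : exists a, (K `&` C0) a /\ ~ tt_at T La C a.
  apply: contrapT => H; apply: ntt; exists (K `&` C0); split; first exact: clubI.
  move=> a [Ka Ca]; split=> //; apply: contrapT => na; apply: H; by exists a.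
have [A [bA sA]] : exists A : set C, S_base T (La a) A /\ ~ scattered (S_at_all T A).
  apply: contrapT => H; apply: ntt_a => A bA; apply: contrapT => sA; apply: H.
  by exists A.
have [P PA] := crowded_not_scattered W1 T_compl La_chain C0_club C0_dense C_monster Ca bA sA.
by exists a, A, P; split=> //; exact: base_S_base.
Qed.
End Models.

Theorem theorem2p8
  (d : Order.disp_t) (W : orderType d)
  (W_omega1 : is_omega1 W)
  (Phi_star : weak_diamond_star W)
  (cov_ge_aleph2 : cov_meager_ge_succ W)
  (L : language)
  (L_aleph1 : ([set: symbol L] #= [set: W])%card)
  (T : theory L)
  (T_compl : complete_theory T)
  (T_atomic : exists M : structure L, atomic_model T M)
  (La : W -> set (symbol L))
  (La_chain : language_chain La)
  (C0 : set W)
  (C0_club : club C0)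
  (C0_dense : forall a : W, C0 a -> T_complete_dense T La a)
  (C : structure L)
  (C_monster : monster W T C)
  (not_club_tt : ~ club_tt T La C0 C) :
  exists M : (W -> bool) -> structure L,
    (forall f : W -> bool,
       atomic_model T (M f) /\ ([set: M f] #= [set: W])%card) /\
    (forall f g : W -> bool, f <> g -> ~ isomorphic (M f) (M g)).
Proof.
apply: (@many_atomic_models _ _ W_omega1 L T T_compl La La_chain C0 C0_club C0_dense C C_monster).
exact: many_atomic_models_nontt.
Qed.
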